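(* For a fixed integer $k$ and any $\epsilon\in(0,1)$, there exists a randomized algorithm which, given $n$ points $P\subset\mathbb{R}^d$ and an integer $1\le l\le k$, with constant probability outputs a $(1+\epsilon)$-approximate solution of $(l,k)$-FMeans on $P$, in $O\big(2^{poly(\frac{k}{\epsilon})}(\log n)^{k+1}nd\big)$ time.
   Context: Fault tolerant $k$-means, $(l,k)$-FMeans: find $k$ points $\mathcal{C}=\{c_1,\dots,c_k\}\subset\mathbb{R}^d$ minimizing the average, over $p\in P$, of the sum of the squared distances from $p$ to its $l$ nearest points in $\mathcal{C}$. A $(1+\epsilon)$-approximate solution is a $k$-point set with cost at most $(1+\epsilon)$ times the optimum. $poly(\cdot)$ denotes some polynomial. *)

(* Defs.v *)
From Stdlib Require Import Reals List Arith Lia.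
From Stdlib Require Import ClassicalDescription.
Import ListNotations.
Open Scope R_scope.

(*  A point set P of n points in R^d is given as P : nat -> nat -> R,  *)
(*  P i j = j-th coordinate of the i-th point (i < n, j < d).          *)
(*  A k-point solution C : nat -> nat -> R, C c j (c < k, j < d).      *)

Fixpoint sumR (m : nat) (f : nat -> R) : R :=
  match m with
  | O => 0
  | S m' => sumR m' f + f m'
  end.

Definition sqdist (d : nat) (x y : nat -> R) : R :=
  sumR d (fun j => (x j - y j) ^ 2).

(* lsmall l xs = minimum, over all l-element sub-multisets of xs, of their sum,
   i.e. the sum of the l smallest entries of xs (meaningful for l <= length xs). *)
Fixpoint lsmall (l : nat) (xs : list R) : R :=
  match l, xs with
  | O, _ => 0
  | S _, [] => 0 (* unreachable when l <= length xs *)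
  | S l', x :: xs' =>
      if Nat.ltb (length xs') l
      then x + lsmall l' xs'                          (* x must be taken *)
      else Rmin (x + lsmall l' xs') (lsmall l xs')
  end.

Definition lnear_cost (d k l : nat) (C : nat -> nat -> R) (p : nat -> R) : R :=
  lsmall l (map (fun c => sqdist d p (C c)) (seq 0 k)).

Definition fmeans_cost (n d k l : nat) (P C : nat -> nat -> R) : R :=
  / INR n * sumR n (fun i => lnear_cost d k l C (P i)).

(* C is a (1+eps)-approximate solution: cost(C) <= (1+eps) * cost(C') for every
   k-point set C' (equivalently, <= (1+eps) * OPT). *)
Definition approx_solution (n d k l : nat) (eps : R) (P C : nat -> nat -> R) : Prop :=
  forall C' : nat -> nat -> R,
    fmeans_cost n d k l P C <= (1 + eps) * fmeans_cost n d k l P C'.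

(*  Machine model: a randomized real-RAM with unit-cost instructions.  *)

Inductive instr : Type :=
| NConst  (a c : nat)
| NAdd    (a b c : nat)
| NSub    (a b c : nat)
| NHalf   (a b : nat)
| NLoad   (a b : nat)
| NStore  (a b : nat)
| NJumpLt (a b t : nat)
| NRand   (a b : nat)        (* N[a] := uniform random in [0, N[b]) (0 if N[b] = 0) *)
| RofN    (a b : nat)
| RAdd    (a b c : nat)
| RSub    (a b c : nat)
| RMul    (a b c : nat)
| RDiv    (a b c : nat)
| RLoad   (a b : nat)
| RStore  (a b : nat)
| RJumpLt (a b t : nat)
| RInput  (a b c : nat)
| Jump    (t : nat)
| Halt.

Definition program := list instr.

Record state : Type := mkState { pc : nat; nreg : nat -> nat; rreg : nat -> R }.

Definition updN (f : nat -> nat) (a v : nat) : nat -> nat :=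
  fun x => if Nat.eqb x a then v else f x.
Definition updR (f : nat -> R) (a : nat) (v : R) : nat -> R :=
  fun x => if Nat.eqb x a then v else f x.

Record input : Type := mkInput { in_n : nat; in_d : nat; in_l : nat; in_P : nat -> nat -> R }.

Definition init_state (I : input) : state :=
  mkState 0 (updN (updN (updN (fun _ => 0%nat) 0 (in_n I)) 1 (in_d I)) 2 (in_l I))
          (fun _ => 0).

Definition nchoices (i : instr) (s : state) : nat :=
  match i with
  | NRand _ b => Nat.max 1 (nreg s b)
  | _ => 1%nat
  end.

Definition exec (I : input) (i : instr) (s : state) (r : nat) : state :=
  let N := nreg s in
  let Rg := rreg s in
  let nx := S (pc s) in
  match i with
  | NConst a c => mkState nx (updN N a c) Rg
  | NAdd a b c => mkState nx (updN N a (N b + N c)%nat) Rg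
  | NSub a b c => mkState nx (updN N a (N b - N c)%nat) Rg
  | NHalf a b => mkState nx (updN N a (Nat.div2 (N b))) Rg
  | NLoad a b => mkState nx (updN N a (N (N b))) Rg
  | NStore a b => mkState nx (updN N (N a) (N b)) Rg
  | NJumpLt a b t => mkState (if Nat.ltb (N a) (N b) then t else nx) N Rg
  | NRand a b => mkState nx (updN N a r) Rg
  | RofN a b => mkState nx N (updR Rg a (INR (N b)))
  | RAdd a b c => mkState nx N (updR Rg a (Rg b + Rg c))
  | RSub a b c => mkState nx N (updR Rg a (Rg b - Rg c))
  | RMul a b c => mkState nx N (updR Rg a (Rg b * Rg c))
  | RDiv a b c => mkState nx N (updR Rg a (Rg b / Rg c))
  | RLoad a b => mkState nx N (updR Rg a (Rg (N b)))
  | RStore a b => mkState nx N (updR Rg (N a) (Rg b))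
  | RJumpLt a b t => mkState (if Rlt_dec (Rg a) (Rg b) then t else nx) N Rg
  | RInput a b c =>
      mkState nx N (updR Rg a
        (if andb (Nat.ltb (N b) (in_n I)) (Nat.ltb (N c) (in_d I))
         then in_P I (N b) (N c) else 0))
  | Jump t => mkState t N Rg
  | Halt => s
  end.

Definition current (p : program) (s : state) : option instr :=
  match nth_error p (pc s) with
  | Some Halt => None
  | o => o
  end.

Fixpoint halts_within (p : program) (I : input) (T : nat) (s : state) : Prop :=
  match current p s with
  | None => True
  | Some i =>
      match T with
      | O => False
      | S T' => forall r, (r < nchoices i s)%nat -> halts_within p I T' (exec I i s r)
      end
  end.

Fixpoint succ_prob (p : program) (I : input) (good : (nat -> R) -> Prop)
         (T : nat) (s : state) : R :=
  match current p s with
  | None => if excluded_middle_informative (good (rreg s)) then 1 else 0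
  | Some i =>
      match T with
      | O => 0
      | S T' => / INR (nchoices i s) *
                sumR (nchoices i s) (fun r => succ_prob p I good T' (exec I i s r))
      end
  end.

Definition output_centers (d : nat) (regs : nat -> R) : nat -> nat -> R :=
  fun c j => regs (c * d + j)%nat.

Definition good_output (k : nat) (eps : R) (I : input) (regs : nat -> R) : Prop :=
  approx_solution (in_n I) (in_d I) k (in_l I) eps (in_P I)
                  (output_centers (in_d I) regs).

(* Main.v *)
(** Points are clustered by repeated [D^2]-sampling. A trial chooses centres Q_1, .., Q_k one
    after the other; each is the mean of O(k/eps) random vectors, a random vector being, with
    equal probabilities, one of the previous centres or a point of P drawn with probability
    (almost) proportional to its squared distance to the previous centres.

    Fix a reference solution, its clusters S_j (the points having the j-th centre among their l
    nearest ones; they overlap) and their centroids o_j. Some cluster S that is not yet served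
    has the following property: its points close to the previous centres can be moved onto
    them at a total cost that is a small fraction of the reference cost, and each other
    point of S is drawn with probability at least poly(eps/k) / |S|. Hence a random vector
    dominates poly(eps/k) times a uniform sample of the moved cluster, and since the mean of
    O(k/eps) uniform samples is, with probability 1/2, close to the centroid, the trial
    serves S with probability 2^(-poly(k/eps)). If all clusters are served, the cost of the
    trial is at most (1 + eps) times the reference cost, so it suffices to repeat the trial
    2^(poly(k/eps)) times and to keep the cheapest outcome. *)

Require Import Defs.
From Stdlib Require Import Reals List Arith.
From Stdlib Require Import ZArith Lia Lra Psatz Permutation Classical ClassicalDescription.
Import ListNotations.
Open Scope R_scope.

(** * Finite sums and averages *)

(** No optimal solution is at hand, and a reference of cost zero would give no scale for the errors.
    Hence the reference is an arbitrary [C] and the target is its cost plus [1 / (j + 1)], which is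
    positive. One program, independent of [C] and [j], meets each target with probability 1/2; the
    targets are nested, so it meets all of them at once with this probability. The machine draws
    uniform integers only. A point is found by locating a random multiple of [potential / M] among
    the partial sums of the weights. This grid may miss light points, but those are the ones that
    are moved onto a chosen centre. Centre 0 is an arbitrary vector: it makes the potential
    meaningful before the first choice, so the first centre needs no separate treatment. Constants:
    with [E >= k / eps] a served cluster may lose [A / E], in total at most [eps * A]. Markov's
    inequality asks for an expected loss of [A / (2 E)]: half of it is spent on moving points, half
    on the variance of a mean of [m = 16 E] vectors. [G = 64 k E] bounds the inverse frequency of
    heavy points, and the 2 in [M = 2 G n] pays for rounding to the grid. *)

Lemma sumR_ext m f g : (forall i, (i < m)%nat -> f i = g i) -> sumR m f = sumR m g.
Proof.
  induction m as [|m IH]; intros H; simpl; [reflexivity|].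
  rewrite IH, (H m); [reflexivity|lia|]. intros; apply H; lia.
Qed.

Lemma sumR_le m f g : (forall i, (i < m)%nat -> f i <= g i) -> sumR m f <= sumR m g.
Proof.
  induction m as [|m IH]; intros H; simpl; [lra|].
  apply Rplus_le_compat; [|apply H; lia]. apply IH; intros; apply H; lia.
Qed.

Lemma sumR_plus m f g : sumR m (fun i => f i + g i) = sumR m f + sumR m g.
Proof. induction m as [|m IH]; simpl; [lra|]. rewrite IH; lra. Qed.

Lemma sumR_scal m a f : sumR m (fun i => a * f i) = a * sumR m f.
Proof. induction m as [|m IH]; simpl; [lra|]. rewrite IH; lra. Qed.

Lemma sumR_const m a : sumR m (fun _ => a) = INR m * a.
Proof. induction m as [|m IH]; [simpl; lra|]. rewrite S_INR. simpl sumR. rewrite IH; lra. Qed.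

Lemma sumR_nonneg m f : (forall i, (i < m)%nat -> 0 <= f i) -> 0 <= sumR m f.
Proof.
  intros H. rewrite <- (Rmult_0_r (INR m)), <- sumR_const. apply sumR_le; assumption.
Qed.

Lemma sumR_swap m p (f : nat -> nat -> R) :
  sumR m (fun i => sumR p (f i)) = sumR p (fun j => sumR m (fun i => f i j)).
Proof.
  induction m as [|m IH]; simpl; [rewrite sumR_const; lra|].
  now rewrite IH, <- sumR_plus.
Qed.

Lemma sumR_term_le m f i :
  (forall j, (j < m)%nat -> 0 <= f j) -> (i < m)%nat -> f i <= sumR m f.
Proof.
  induction m as [|m IH]; intros H Hi; [lia|]. simpl.
  destruct (Nat.eq_dec i m) as [->|].
  - assert (0 <= sumR m f) by (apply sumR_nonneg; intros; apply H; lia). lra.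
  - assert (f i <= sumR m f) by (apply IH; [intros; apply H|]; lia).
    assert (0 <= f m) by (apply H; lia). lra.
Qed.

Lemma sumR_S_l m f : sumR (S m) f = f 0%nat + sumR m (fun i => f (S i)).
Proof. induction m as [|m IH]; [simpl; lra|]. simpl in *. rewrite IH. lra. Qed.

Definition avg (m : nat) (f : nat -> R) : R := / INR m * sumR m f.

Lemma inv_INR_nonneg m : 0 <= / INR m.
Proof.
  destruct m; [simpl; rewrite Rinv_0; lra|].
  left; apply Rinv_0_lt_compat, lt_0_INR; lia.
Qed.

Lemma avg_le m f g : (forall i, (i < m)%nat -> f i <= g i) -> avg m f <= avg m g.
Proof.
  intros H. apply Rmult_le_compat_l; [apply inv_INR_nonneg|]. now apply sumR_le.
Qed.

Lemma avg_affine m a c f :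
  (0 < m)%nat -> avg m (fun i => a + c * f i) = a + c * avg m f.
Proof.
  intros H. unfold avg. rewrite sumR_plus, sumR_const, sumR_scal.
  assert (INR m <> 0) by (apply not_0_INR; lia). field; assumption.
Qed.

Lemma avg_const m a : (0 < m)%nat -> avg m (fun _ => a) = a.
Proof.
  intros H. unfold avg. rewrite sumR_const.
  assert (INR m <> 0) by (apply not_0_INR; lia). field; assumption.
Qed.

(** * Runs of the machine *)

(** Termination on all branches and the probability bound are carried together, since the same
    traversal of the program proves both. *)
Definition ok (p : program) (I : input) (good : (nat -> R) -> Prop) (T : nat) (s : state)
  (v : R) : Prop :=
  halts_within p I T s /\ v <= succ_prob p I good T s.

Lemma succ_prob_nonneg p I good T s : 0 <= succ_prob p I good T s.
Proof.
  revert s; induction T as [|T IH]; intros s; simpl; destruct (current p s);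
    try (destruct excluded_middle_informative; lra); [lra|].
  apply Rmult_le_pos; [apply inv_INR_nonneg|]. apply sumR_nonneg; intros; apply IH.
Qed.

Lemma ok_S p I good T s v : ok p I good T s v -> ok p I good (S T) s v.
Proof.
  revert s v; induction T as [|T IH]; intros s v [Hh Hv]; split.
  - simpl in *. destruct (current p s); tauto.
  - simpl in *. destruct (current p s); [tauto|assumption].
  - simpl in Hh. simpl. destruct (current p s) as [i|]; [|exact Logic.I].
    intros r Hr. apply (IH (exec I i s r) 0); split; [now apply Hh|apply succ_prob_nonneg].
  - eapply Rle_trans; [exact Hv|]. simpl in *. destruct (current p s) as [i|]; [|lra].
    apply Rmult_le_compat_l; [apply inv_INR_nonneg|]. apply sumR_le; intros r Hr.
    apply (IH (exec I i s r) _). split; [now apply Hh|apply Rle_refl].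
Qed.

Lemma ok_mono p I good T T' s v v' :
  ok p I good T s v -> (T <= T')%nat -> v' <= v -> ok p I good T' s v'.
Proof.
  intros H HT Hv. assert (ok p I good T' s v) as [H1 H2].
  { induction HT; [assumption|now apply ok_S]. }
  split; [assumption|lra].
Qed.

Lemma ok_step p I good T s i (vr : nat -> R) :
  current p s = Some i ->
  (forall r, (r < nchoices i s)%nat -> ok p I good T (exec I i s r) (vr r)) ->
  ok p I good (S T) s (avg (nchoices i s) vr).
Proof.
  intros Hc H. split; simpl; rewrite Hc; [intros; now apply H|].
  apply Rmult_le_compat_l; [apply inv_INR_nonneg|]. apply sumR_le; intros; now apply H.
Qed.

Lemma ok_step1 p I good T s i v :
  current p s = Some i -> nchoices i s = 1%nat ->
  ok p I good T (exec I i s 0) v -> ok p I good (S T) s v.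
Proof.
  intros Hc H1 H.
  assert (Hv : v = avg (nchoices i s) (fun _ => v)).
  { rewrite avg_const; [reflexivity|lia]. }
  rewrite Hv. apply ok_step; [assumption|].
  intros r Hr. replace r with 0%nat by lia. assumption.
Qed.

Lemma ok_stop p I good T s :
  current p s = None ->
  ok p I good T s (if excluded_middle_informative (good (rreg s)) then 1 else 0).
Proof. intros Hc. split; destruct T; simpl; rewrite Hc; auto; lra. Qed.

(* The events [good x] form a chain and a run has finitely many outcomes, so the
   smallest relevant event is one of the [good x]. *)
Lemma succ_prob_chain (X : Type) (x0 : X) (good : X -> (nat -> R) -> Prop) (key : X -> R)
  (Hchain : forall x y s, key x <= key y -> good x s -> good y s) p I T s :
  exists x, succ_prob p I (good x) T s <= succ_prob p I (fun o => forall y, good y o) T s.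
Proof.
  (* The form for all smaller keys survives branching: among the finitely many branches the witness
     with the least key serves all of them. *)
  enough (exists x, forall x', key x' <= key x ->
      succ_prob p I (good x') T s <= succ_prob p I (fun o => forall y, good y o) T s)
    as [x Hx] by (exists x; apply Hx; lra).
  assert (Hleaf : forall o, exists x, forall x', key x' <= key x ->
      (if excluded_middle_informative (good x' o) then 1 else 0)
      <= (if excluded_middle_informative (forall y, good y o) then 1 else 0)).
  { intros o. destruct (excluded_middle_informative (forall y, good y o)) as [|Hn].
    - exists x0; intros; destruct excluded_middle_informative; lra.
    - apply not_all_ex_not in Hn as [y Hy]. exists y; intros x' Hx'.
      destruct excluded_middle_informative as [Hg|]; [|lra].
      exfalso; apply Hy; eapply Hchain; eauto. }
  revert s; induction T as [|T IH]; intros s; simpl; destruct (current p s) as [i|];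
    try apply Hleaf; [exists x0; intros; lra|].
  assert (Hmin : forall m, exists x, forall r, (r < m)%nat -> forall x', key x' <= key x ->
      succ_prob p I (good x') T (exec I i s r)
      <= succ_prob p I (fun o => forall y, good y o) T (exec I i s r)).
  { induction m as [|m [x Hx]]; [exists x0; intros; lia|].
    destruct (IH (exec I i s m)) as [y Hy].
    destruct (Rle_dec (key x) (key y)) as [Hxy|Hxy].
    - exists x; intros r Hr x' Hx'. destruct (Nat.eq_dec r m) as [->|].
      + apply Hy; lra.
      + apply Hx; [lia|lra].
    - exists y; intros r Hr x' Hx'. destruct (Nat.eq_dec r m) as [->|].
      + apply Hy; lra.
      + apply Hx; [lia|lra]. }
  destruct (Hmin (nchoices i s)) as [x Hx]. exists x; intros x' Hx'.
  apply Rmult_le_compat_l; [apply inv_INR_nonneg|]. apply sumR_le; intros r Hr.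
  now apply Hx.
Qed.

(** * Structured programs *)

Inductive cmd : Type :=
| Prim (i : instr)
| Skip
| Seq (c1 c2 : cmd)
| While (a b : nat) (c : cmd)
| IfN (a b : nat) (c1 c2 : cmd)
| IfR (a b : nat) (c1 c2 : cmd).

Declare Scope cmd_scope.
Bind Scope cmd_scope with cmd.
Delimit Scope cmd_scope with cmd.
Notation "c1 ;; c2" := (Seq c1 c2) (at level 70, right associativity) : cmd_scope.
Coercion Prim : instr >-> cmd.

Fixpoint clen (c : cmd) : nat :=
  match c with
  | Prim _ => 1
  | Skip => 0
  | Seq c1 c2 => clen c1 + clen c2
  | While _ _ c => 3 + clen c
  | IfN _ _ c1 c2 | IfR _ _ c1 c2 => 2 + clen c1 + clen c2
  end.

(* [compile a c] is the code of [c] placed at address [a]; every jump target is absolute. *)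
Fixpoint compile (a : nat) (c : cmd) : program :=
  match c with
  | Prim i => [i]
  | Skip => []
  | Seq c1 c2 => compile a c1 ++ compile (a + clen c1) c2
  | While x y c =>
      [NJumpLt x y (a + 2); Jump (a + 3 + clen c)] ++ compile (a + 2) c ++ [Jump a]
  | IfN x y c1 c2 =>
      [NJumpLt x y (a + 2 + clen c2)] ++ compile (a + 1) c2
        ++ [Jump (a + 2 + clen c2 + clen c1)] ++ compile (a + 2 + clen c2) c1
  | IfR x y c1 c2 =>
      [RJumpLt x y (a + 2 + clen c2)] ++ compile (a + 1) c2
        ++ [Jump (a + 2 + clen c2 + clen c1)] ++ compile (a + 2 + clen c2) c1
  end.

Lemma length_compile c : forall a, length (compile a c) = clen c.
Proof.
  induction c; intros a0; simpl; rewrite ?length_app; simpl; rewrite ?length_app; simpl;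
    rewrite ?IHc1, ?IHc2, ?IHc; lia.
Qed.

Definition code_at (p : program) (a : nat) (q : program) : Prop :=
  exists u v, p = u ++ q ++ v /\ length u = a.

Lemma code_at_app p a q1 q2 :
  code_at p a (q1 ++ q2) -> code_at p a q1 /\ code_at p (a + length q1) q2.
Proof.
  intros (u & v & -> & <-). split.
  - exists u, (q2 ++ v). now rewrite <- app_assoc.
  - exists (u ++ q1), v. rewrite <- !app_assoc. split; [reflexivity|apply length_app].
Qed.

Lemma code_at_cons p a i q :
  code_at p a (i :: q) -> nth_error p a = Some i /\ code_at p (a + 1) q.
Proof.
  intros H. split.
  - destruct H as (u & v & -> & <-). rewrite nth_error_app2 by lia.
    now rewrite Nat.sub_diag.
  - now apply (code_at_app p a [i] q) in H.
Qed.

Definition mem : Type := ((nat -> nat) * (nat -> R))%type.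
Definition at_pc (a : nat) (m : mem) : state := mkState a (fst m) (snd m).
Definition exec_mem (I : input) (i : instr) (m : mem) (r : nat) : mem :=
  let s := exec I i (at_pc 0 m) r in (nreg s, rreg s).

Definition is_prim (i : instr) : bool :=
  match i with
  | NJumpLt _ _ _ | RJumpLt _ _ _ | Jump _ | Halt | NRand _ _ => false
  | _ => true
  end.

Definition assertion : Type := mem -> R -> Prop.

Section WP.
Variable I : input.
Variable good : (nat -> R) -> Prop.

(* If success from the end of [c] has probability at least [v'] whenever the memory [m']
   satisfies [Phi m' v'], and is decided in [T] more steps, then from the start of [c] in
   memory [m] it has probability at least [v] and is decided in [t + T] steps. *)
Definition wp (c : cmd) (t : nat) (m : mem) (Phi : assertion) (v : R) : Prop :=
  forall p a T, code_at p a (compile a c) ->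
  (forall m' v', Phi m' v' -> ok p I good T (at_pc (a + clen c) m') v') ->
  ok p I good (t + T) (at_pc a m) v.

Lemma wp_weaken c t t' m (Phi Psi : assertion) v :
  wp c t m Phi v -> (t <= t')%nat -> (forall m' v', Phi m' v' -> Psi m' v') ->
  wp c t' m Psi v.
Proof.
  intros H Ht HPhi p a T Hc HT. apply (ok_mono _ _ _ (t + T) _ _ v); [|lia|lra].
  apply H; auto.
Qed.

Lemma wp_le c t m Phi v v' : wp c t m Phi v -> v' <= v -> wp c t m Phi v'.
Proof.
  intros H Hv p a T Hc HT. apply (ok_mono _ _ _ (t + T) _ _ v); [|lia|lra].
  now apply H.
Qed.

Lemma wp_skip m (Phi : assertion) v : Phi m v -> wp Skip 0 m Phi v.
Proof. intros H p a T _ HT. simpl. rewrite <- (Nat.add_0_r a). now apply HT. Qed.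

Lemma wp_seq c1 c2 t1 t2 m Psi Phi v :
  wp c1 t1 m Psi v -> (forall m' v', Psi m' v' -> wp c2 t2 m' Phi v') ->
  wp (Seq c1 c2) (t1 + t2) m Phi v.
Proof.
  intros H1 H2 p a T Hc HT. simpl in Hc. apply code_at_app in Hc as [Hc1 Hc2].
  rewrite length_compile in Hc2. rewrite <- Nat.add_assoc. apply H1; [assumption|].
  intros m' v' Hm. apply (H2 _ _ Hm); [assumption|]. intros m'' v'' Hm'.
  specialize (HT _ _ Hm'). simpl in HT. now rewrite Nat.add_assoc in HT.
Qed.

Lemma current_at p a m i :
  nth_error p a = Some i -> i <> Halt -> current p (at_pc a m) = Some i.
Proof. intros H Hi. unfold current, at_pc; simpl. rewrite H. destruct i; congruence. Qed.

Lemma wp_prim i m (Phi : assertion) v :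
  is_prim i = true -> Phi (exec_mem I i m 0) v -> wp (Prim i) 1 m Phi v.
Proof.
  intros Hi HPhi p a T Hc HT. simpl in Hc. apply code_at_cons in Hc as [Hn _].
  eapply ok_step1; [apply current_at; [exact Hn|destruct i; discriminate]| |].
  - destruct i; discriminate || reflexivity.
  - apply HT in HPhi. simpl clen in HPhi. rewrite Nat.add_1_r in HPhi.
    destruct i; try discriminate; exact HPhi.
Qed.

Lemma wp_rand x b m (Phi : assertion) (vr : nat -> R) :
  (0 < fst m b)%nat ->
  (forall r, (r < fst m b)%nat -> Phi (updN (fst m) x r, snd m) (vr r)) ->
  wp (NRand x b) 1 m Phi (avg (fst m b) vr).
Proof.
  intros Hb HPhi p a T Hc HT. simpl in Hc. apply code_at_cons in Hc as [Hn _].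
  assert (Hnc : nchoices (NRand x b) (at_pc a m) = fst m b).
  { simpl. destruct (fst m b); lia. }
  rewrite <- Hnc. apply ok_step; [apply current_at; [exact Hn|discriminate]|].
  intros r Hr. rewrite Hnc in Hr. specialize (HT _ _ (HPhi r Hr)).
  simpl clen in HT. rewrite Nat.add_1_r in HT. exact HT.
Qed.

(** The times of the branches are added instead of taking their maximum. The 2 pays for the test and
    for the jump that ends the else-branch, which is placed first in the code. *)
Lemma wp_ifN x y c1 c2 t1 t2 m Phi v :
  ((fst m x < fst m y)%nat -> wp c1 t1 m Phi v) ->
  ((fst m y <= fst m x)%nat -> wp c2 t2 m Phi v) ->
  wp (IfN x y c1 c2) (2 + (t1 + t2)) m Phi v.
Proof.
  intros H1 H2 p a T Hc HT. cbn [compile clen] in Hc, HT.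
  apply code_at_cons in Hc as [Hn Hc]. apply code_at_app in Hc as [Hc2 Hc].
  apply code_at_cons in Hc as [Hj Hc1]. rewrite length_compile in Hj, Hc1.
  apply (ok_step1 _ _ _ (1 + (t1 + t2) + T) _ _ _ (current_at _ _ m _ Hn ltac:(discriminate)));
    [reflexivity|].
  change (exec I _ (at_pc a m) 0)
    with (at_pc (if Nat.ltb (fst m x) (fst m y) then a + 2 + clen c2 else S a)%nat m).
  destruct (Nat.ltb_spec (fst m x) (fst m y)) as [Hlt|Hge].
  - apply (ok_mono _ _ _ (t1 + T) _ _ v); [|lia|lra]. apply H1; [assumption| |].
    + now replace (a + 1 + clen c2 + 1)%nat with (a + 2 + clen c2)%nat in Hc1 by lia.
    + intros m' v' Hm. replace (a + 2 + clen c2 + clen c1)%nat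
        with (a + (2 + clen c1 + clen c2))%nat by lia. now apply HT.
  - apply (ok_mono _ _ _ (t2 + (1 + T)) _ _ v); [|lia|lra].
    replace (S a) with (a + 1)%nat by lia. apply H2; [assumption|assumption|].
    intros m' v' Hm. apply (ok_step1 _ _ _ T _ _ _
      (current_at _ _ m' _ Hj ltac:(discriminate))); [reflexivity|].
    replace (exec I _ _ 0) with (at_pc (a + (2 + clen c1 + clen c2)) m').
    + now apply HT.
    + unfold at_pc; simpl. f_equal; lia.
Qed.

Lemma wp_ifR x y c1 c2 t1 t2 m Phi v :
  (snd m x < snd m y -> wp c1 t1 m Phi v) ->
  (snd m y <= snd m x -> wp c2 t2 m Phi v) ->
  wp (IfR x y c1 c2) (2 + (t1 + t2)) m Phi v.
Proof.
  intros H1 H2 p a T Hc HT. cbn [compile clen] in Hc, HT.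
  apply code_at_cons in Hc as [Hn Hc]. apply code_at_app in Hc as [Hc2 Hc].
  apply code_at_cons in Hc as [Hj Hc1]. rewrite length_compile in Hj, Hc1.
  apply (ok_step1 _ _ _ (1 + (t1 + t2) + T) _ _ _ (current_at _ _ m _ Hn ltac:(discriminate)));
    [reflexivity|].
  change (exec I _ (at_pc a m) 0)
    with (at_pc (if Rlt_dec (snd m x) (snd m y) then a + 2 + clen c2 else S a)%nat m).
  destruct (Rlt_dec (snd m x) (snd m y)) as [Hlt|Hge].
  - apply (ok_mono _ _ _ (t1 + T) _ _ v); [|lia|lra]. apply H1; [assumption| |].
    + now replace (a + 1 + clen c2 + 1)%nat with (a + 2 + clen c2)%nat in Hc1 by lia.
    + intros m' v' Hm. replace (a + 2 + clen c2 + clen c1)%nat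
        with (a + (2 + clen c1 + clen c2))%nat by lia. now apply HT.
  - apply (ok_mono _ _ _ (t2 + (1 + T)) _ _ v); [|lia|lra].
    replace (S a) with (a + 1)%nat by lia. apply H2; [lra|assumption|].
    intros m' v' Hm. apply (ok_step1 _ _ _ T _ _ _
      (current_at _ _ m' _ Hj ltac:(discriminate))); [reflexivity|].
    replace (exec I _ _ 0) with (at_pc (a + (2 + clen c1 + clen c2)) m').
    + now apply HT.
    + unfold at_pc; simpl. f_equal; lia.
Qed.

(** Each round costs the test and the jump back; the final 2 pays for the failing test and the jump
    out. The invariant speaks about the probability as well, so that it may change from round to
    round. *)
Lemma wp_while x y c t L (Inv : nat -> assertion) m v :
  (forall i m' v', (i <= L)%nat -> Inv i m' v' -> fst m' x = i /\ fst m' y = L) ->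
  (forall i m' v', (i < L)%nat -> Inv i m' v' -> wp c t m' (Inv (S i)) v') ->
  Inv 0%nat m v ->
  wp (While x y c) (L * (t + 2) + 2) m (Inv L) v.
Proof.
  intros Hxy Hbody H0 p a T Hc HT. cbn [compile clen] in Hc, HT.
  apply code_at_cons in Hc as [Hn Hc]. apply code_at_cons in Hc as [Hout Hc].
  apply code_at_app in Hc as [Hc Hback].
  apply code_at_cons in Hback as [Hback _]. rewrite length_compile in Hback.
  enough (Hgen : forall j i m v, (i + j = L)%nat -> Inv i m v ->
      ok p I good (j * (t + 2) + 2 + T) (at_pc a m) v).
  { now apply (Hgen L 0%nat m v). }
  clear m v H0. induction j as [|j IHj]; intros i m v Hij Hinv.
  - replace i with L in Hinv by lia. destruct (Hxy _ _ _ (le_n L) Hinv) as [Hx Hy].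
    apply (ok_step1 _ _ _ (S T) _ _ _ (current_at _ _ m _ Hn ltac:(discriminate)));
      [reflexivity|].
    change (exec I _ (at_pc a m) 0)
      with (at_pc (if Nat.ltb (fst m x) (fst m y) then a + 2 else S a)%nat m).
    rewrite Hx, Hy, Nat.ltb_irrefl. replace (S a) with (a + 1)%nat by lia.
    apply (ok_step1 _ _ _ T _ _ _ (current_at _ _ m _ Hout ltac:(discriminate)));
      [reflexivity|].
    replace (exec I _ _ 0) with (at_pc (a + (3 + clen c)) m).
    + now apply HT.
    + unfold at_pc; simpl. f_equal; lia.
  - destruct (Hxy i _ _ ltac:(lia) Hinv) as [Hx Hy].
    change (S j * (t + 2) + 2 + T)%nat with (t + 2 + j * (t + 2) + 2 + T)%nat.
    apply (ok_mono _ _ _ (S (t + (S (j * (t + 2) + 2 + T)))) _ _ v); [|lia|lra].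
    apply (ok_step1 _ _ _ _ _ _ _ (current_at _ _ m _ Hn ltac:(discriminate)));
      [reflexivity|].
    change (exec I _ (at_pc a m) 0)
      with (at_pc (if Nat.ltb (fst m x) (fst m y) then a + 2 else S a)%nat m).
    rewrite Hx, Hy. replace (Nat.ltb i L) with true by (symmetry; apply Nat.ltb_lt; lia).
    apply (Hbody i m v); [lia|assumption| |].
    + now replace (a + 1 + 1)%nat with (a + 2)%nat in Hc by lia.
    + intros m' v' Hm. replace (a + 1 + 1)%nat with (a + 2)%nat in Hback by lia.
      apply (ok_step1 _ _ _ _ _ _ _ (current_at _ _ m' _ Hback ltac:(discriminate)));
        [reflexivity|].
      change (exec I _ _ 0) with (at_pc a m'). apply (IHj (S i)); [lia|assumption].
Qed.

End WP.

(** * Geometry of weighted point sets *)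

Lemma sqdist_ext d x x' y :
  (forall j, (j < d)%nat -> x j = x' j) -> sqdist d x y = sqdist d x' y.
Proof. intros H. apply sumR_ext; intros j Hj. now rewrite H. Qed.

Lemma sqdist_nonneg d x y : 0 <= sqdist d x y.
Proof. apply sumR_nonneg; intros; apply pow2_ge_0. Qed.

Lemma sqdist_sym d x y : sqdist d x y = sqdist d y x.
Proof. apply sumR_ext; intros; ring. Qed.

Lemma sqdist_refl d x : sqdist d x x = 0.
Proof.
  unfold sqdist. rewrite (sumR_ext _ _ (fun _ => 0)) by (intros; ring).
  rewrite sumR_const; ring.
Qed.

Lemma sqdist_triangle d x y z : sqdist d x z <= 2 * sqdist d x y + 2 * sqdist d y z.
Proof.
  unfold sqdist. rewrite <- !sumR_scal, <- sumR_plus. apply sumR_le; intros j _.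
  pose proof (pow2_ge_0 ((x j - y j) - (y j - z j))). nra.
Qed.

Definition centroid (n : nat) (chi : nat -> R) (a : nat -> nat -> R) : nat -> R :=
  fun x => / sumR n chi * sumR n (fun i => chi i * a i x).

(** The cross terms vanish, as the weighted deviations from the centroid sum to zero. The shift [u]
    and the factor [c] provide the induction step of [unif_sqdist]. *)
Lemma sumR_shift_sqdist n d chi a u c o :
  0 < sumR n chi ->
  sumR n (fun i => chi i * sqdist d (fun x => u x + c * a i x) o)
  = sumR n chi * sqdist d (fun x => u x + c * centroid n chi a x) o
    + c ^ 2 * sumR n (fun i => chi i * sqdist d (a i) (centroid n chi a)).
Proof.
  intros Hs. unfold sqdist.
  rewrite (sumR_ext n _ (fun i => sumR d (fun x => chi i * (u x + c * a i x - o x) ^ 2)))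
    by (intros; now rewrite sumR_scal).
  rewrite (sumR_ext n (fun i => chi i * sumR d _)
    (fun i => sumR d (fun x => chi i * (a i x - centroid n chi a x) ^ 2)))
    by (intros; now rewrite sumR_scal).
  rewrite !(sumR_swap n d), <- !sumR_scal, <- sumR_plus.
  apply sumR_ext; intros x _.
  set (mu := centroid n chi a x).
  assert (Hmu : sumR n (fun i => chi i * a i x) = sumR n chi * mu).
  { unfold mu, centroid. field; lra. }
  rewrite <- sumR_scal.
  rewrite (sumR_ext n _ (fun i => (u x + c * mu - o x) ^ 2 * chi i
    + (2 * c * (u x + c * mu - o x) * (chi i * a i x)
      + (- 2 * c * (u x + c * mu - o x) * mu * chi i
      + c ^ 2 * (chi i * (a i x - mu) ^ 2))))) by (intros; ring).
  rewrite !sumR_plus, !sumR_scal, Hmu. ring.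
Qed.

Lemma sumR_sqdist_centroid n d chi a o :
  0 < sumR n chi ->
  sumR n (fun i => chi i * sqdist d (a i) o)
  = sumR n chi * sqdist d (centroid n chi a) o
    + sumR n (fun i => chi i * sqdist d (a i) (centroid n chi a)).
Proof.
  intros Hs. pose proof (sumR_shift_sqdist n d chi a (fun _ => 0) 1 o Hs) as H.
  rewrite (sumR_ext n _ (fun i => chi i * sqdist d (a i) o)) in H.
  2:{ intros; f_equal; apply sqdist_ext; intros; ring. }
  rewrite H. rewrite (sqdist_ext d _ (centroid n chi a)) by (intros; ring). ring.
Qed.

(** * Drawing from uniform samples of a cluster *)

(* The expectation of [V] at [y + b * (x_1 + .. + x_j)], where the [x_l] are
   independent and [x_l = a i] with probability proportional to [chi i]. *)
Fixpoint unif (n : nat) (chi : nat -> R) (a : nat -> nat -> R) (b : R) (j : nat)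
  (y : nat -> R) (V : (nat -> R) -> R) : R :=
  match j with
  | O => V y
  | S j' => / sumR n chi *
      sumR n (fun i => chi i * unif n chi a b j' (fun x => y x + a i x * b) V)
  end.

(** Bias plus variance: variances of independent draws add up. For [b = / INR j] the second term is
    the variance of the cluster divided by [j]. *)
Lemma unif_sqdist n d chi a b o j : 0 < sumR n chi -> forall y,
  unif n chi a b j y (fun z => sqdist d z o)
  = sqdist d (fun x => y x + INR j * b * centroid n chi a x) o
    + INR j * b ^ 2 * (/ sumR n chi
        * sumR n (fun i => chi i * sqdist d (a i) (centroid n chi a))).
Proof.
  intros Hs. induction j as [|j IH]; intros y.
  - cbn [unif]. rewrite (sqdist_ext d (fun x => y x + _) y) by (intros; simpl; ring). simpl; ring.
  - cbn [unif]. set (mu := centroid n chi a) in *.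
    set (var := / sumR n chi * sumR n (fun i => chi i * sqdist d (a i) mu)) in *.
    set (u := fun x => y x + INR j * b * mu x).
    rewrite (sumR_ext n (fun i => chi i * unif n chi a b j _ _)
      (fun i => chi i * sqdist d (fun x => u x + b * a i x) o + INR j * b ^ 2 * var * chi i)).
    2:{ intros i _. rewrite IH.
        rewrite (sqdist_ext d _ (fun x => u x + b * a i x)) by (intros; unfold u; ring).
        ring. }
    rewrite sumR_plus, sumR_scal, sumR_shift_sqdist by assumption. fold mu.
    rewrite (sqdist_ext d (fun x => u x + b * mu x)
      (fun x => y x + INR (S j) * b * mu x)) by (intros; unfold u; rewrite S_INR; ring).
    rewrite S_INR. unfold var. field. lra.
Qed.

(** An affine minorant passes through the expectation, also when [c] is negative: [c0 = 1] with
    [c < 0] yields Markov's inequality, [c0 = c = 0] yields positivity. *)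
Lemma unif_affine_le n chi a b V W c0 c j :
  (forall i, (i < n)%nat -> 0 <= chi i) -> 0 < sumR n chi ->
  (forall y, c0 + c * W y <= V y) ->
  forall y, c0 + c * unif n chi a b j y W <= unif n chi a b j y V.
Proof.
  intros Hchi Hs HVW. induction j as [|j IH]; intros y; cbn [unif]; [apply HVW|].
  apply (Rmult_le_reg_l (sumR n chi)); [assumption|].
  replace (sumR n chi * (/ sumR n chi *
    sumR n (fun i => chi i * unif n chi a b j (fun x => y x + a i x * b) V)))
    with (sumR n (fun i => chi i * unif n chi a b j (fun x => y x + a i x * b) V))
    by (field; lra).
  replace (sumR n chi * (c0 + c * (/ sumR n chi *
    sumR n (fun i => chi i * unif n chi a b j (fun x => y x + a i x * b) W))))
    with (c0 * sumR n chi
      + c * sumR n (fun i => chi i * unif n chi a b j (fun x => y x + a i x * b) W))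
    by (field; lra).
  rewrite <- !sumR_scal, <- sumR_plus. apply sumR_le; intros i Hi.
  specialize (IH (fun x => y x + a i x * b)). specialize (Hchi i Hi). nra.
Qed.

(** * The sampling step *)

Fixpoint amin (d : nat) (Q : nat -> nat -> R) (t : nat) (p : nat -> R) : nat :=
  match t with
  | O => 0
  | S t' => if Rlt_dec (sqdist d p (Q t)) (sqdist d p (Q (amin d Q t' p)))
            then t else amin d Q t' p
  end.

Definition dmin (d : nat) (Q : nat -> nat -> R) (t : nat) (p : nat -> R) : R :=
  sqdist d p (Q (amin d Q t p)).

Lemma amin_le d Q t p : (amin d Q t p <= t)%nat.
Proof. induction t as [|t IH]; simpl; [lia|]. destruct Rlt_dec; lia. Qed.

Lemma dmin_le d Q t p c : (c <= t)%nat -> dmin d Q t p <= sqdist d p (Q c).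
Proof.
  unfold dmin. induction t as [|t IH]; intros Hc; simpl.
  - replace c with 0%nat by lia. lra.
  - destruct (Nat.eq_dec c (S t)) as [->|].
    + destruct Rlt_dec; lra.
    + specialize (IH ltac:(lia)). destruct Rlt_dec; lra.
Qed.

Lemma dmin_nonneg d Q t p : 0 <= dmin d Q t p.
Proof. apply sqdist_nonneg. Qed.

Lemma dmin_triangle d Q t p o : dmin d Q t p <= 2 * sqdist d p o + 2 * dmin d Q t o.
Proof.
  eapply Rle_trans; [apply (dmin_le d Q t p (amin d Q t o)), amin_le|].
  apply sqdist_triangle.
Qed.

(** Inversion of the cumulative weights. The pair holds the last index reached and what remains of
    [u]; a negative remainder means that the search is over. *)
Fixpoint scan (w : nat -> R) (m : nat) (u : R) : nat * R :=
  match m with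
  | O => (0%nat, u)
  | S m' => if Rlt_dec (snd (scan w m' u)) 0 then scan w m' u
            else (m', snd (scan w m' u) - w m')
  end.

Lemma scan_hit w n i u :
  (forall j, 0 <= w j) -> (i < n)%nat -> sumR i w <= u < sumR (S i) w ->
  fst (scan w n u) = i.
Proof.
  intros Hw Hi [Hlo Hhi].
  assert (Hbefore : forall m, (m <= i)%nat -> snd (scan w m u) = u - sumR m w).
  { induction m as [|m IH]; intros Hm; [simpl; ring|]. simpl. rewrite IH by lia.
    assert (sumR m w <= u).
    { eapply Rle_trans; [|exact Hlo]. clear - Hw Hm.
      induction i as [|i IHi]; [lia|]. destruct (Nat.eq_dec m (S i)) as [->|]; [lra|].
      assert (sumR m w <= sumR i w).
      { destruct (Nat.eq_dec m i) as [->|]; [lra|]. apply IHi; lia. }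
      simpl. specialize (Hw i); lra. }
    destruct Rlt_dec; simpl; lra. }
  assert (Hafter : forall m, fst (scan w (S i + m) u) = i /\ snd (scan w (S i + m) u) < 0).
  { induction m as [|m [IH1 IH2]].
    - rewrite Nat.add_0_r. simpl. rewrite Hbefore by lia. simpl in Hhi.
      destruct Rlt_dec; simpl; [lra|]. split; [reflexivity|lra].
    - rewrite <- plus_n_Sm. cbn [scan]. destruct Rlt_dec; [now split|lra]. }
  replace n with (S i + (n - S i))%nat by lia. apply Hafter.
Qed.

(** Used at both ends of an interval: the number of multiples of [h] inside is at least its length
    divided by [h], minus one. *)
Lemma count_multiples m h b : 0 < h -> 0 <= b ->
  Rmin (INR m) (b / h) <= sumR m (fun r => if Rlt_dec (INR r * h) b then 1 else 0)
  <= b / h + 1.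
Proof.
  intros Hh Hb.
  assert (Hdiv : forall x, x * h < b <-> x < b / h).
  { intros x. split; intros H.
    - apply (Rmult_lt_reg_r h); [assumption|]. unfold Rdiv.
      rewrite Rmult_assoc, Rinv_l; lra.
    - apply (Rmult_lt_compat_r h) in H; [|assumption]. unfold Rdiv in H.
      rewrite Rmult_assoc, Rinv_l in H; lra. }
  assert (Hpos : 0 <= b / h).
  { apply Rmult_le_pos; [assumption|left; now apply Rinv_0_lt_compat]. }
  assert (Htriv : forall l,
    sumR l (fun r => if Rlt_dec (INR r * h) b then 1 else 0) <= INR l).
  { intros l. rewrite <- (Rmult_1_r (INR l)), <- sumR_const. apply sumR_le; intros.
    destruct Rlt_dec; lra. }
  induction m as [|m IH].
  - simpl. split; [apply Rmin_l|lra].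
  - cbn [sumR]. specialize (Htriv m). rewrite S_INR.
    destruct (Rlt_dec (INR m * h) b) as [Hlt|Hge].
    + apply Hdiv in Hlt. rewrite (Rmin_left (INR m)) in IH by lra.
      split; [|lra]. pose proof (Rmin_l (INR m + 1) (b / h)). lra.
    + assert (b / h <= INR m) by (apply Rnot_lt_le; rewrite <- Hdiv; assumption).
      rewrite (Rmin_right (INR m)) in IH by lra. rewrite Rmin_right by lra. lra.
Qed.

Lemma sumR_pick_le n (f : nat -> R) idx :
  (forall i, 0 <= f i) -> sumR n (fun i => if Nat.eqb idx i then f i else 0) <= f idx.
Proof.
  intros Hf.
  enough (sumR n (fun i => if Nat.eqb idx i then f i else 0)
          <= if Nat.ltb idx n then f idx else 0).
  { specialize (Hf idx). destruct Nat.ltb; lra. }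
  induction n as [|n IH]; simpl; [lra|].
  destruct (Nat.eqb_spec idx n) as [->|Hne].
  - rewrite Nat.ltb_irrefl in IH. replace (Nat.ltb n (S n)) with true; [lra|].
    symmetry; apply Nat.ltb_lt; lia.
  - replace (Nat.ltb idx (S n)) with (Nat.ltb idx n); [lra|].
    destruct (Nat.ltb_spec idx n), (Nat.ltb_spec idx (S n)); lia || reflexivity.
Qed.

Section Step.
Variables n d : nat.
Variable P : nat -> nat -> R.
Hypothesis Hn : (0 < n)%nat.

Definition potential (Q : nat -> nat -> R) (t : nat) : R :=
  sumR n (fun i => dmin d Q t (P i)).

(** [q <= t] selects a chosen centre and [q = t + 1] a point of [P]. Centres must be possible
    outcomes, because moved points coincide with them. *)
Definition pick (M : nat) (Q : nat -> nat -> R) (t q r : nat) : nat -> R :=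
  if Nat.ltb q (t + 1) then Q q
  else P (fst (scan (fun i => dmin d Q t (P i)) n (INR r * (potential Q t / INR M)))).

Fixpoint draws (M : nat) (b : R) (Q : nat -> nat -> R) (t j : nat) (y : nat -> R)
  (V : (nat -> R) -> R) : R :=
  match j with
  | O => V y
  | S j' => avg (t + 2) (fun q => avg M (fun r =>
      draws M b Q t j' (fun x => y x + pick M Q t q r x * b) V))
  end.

(* [snap Q t rho i] moves the points at squared distance at most [rho] from the chosen
   centres onto their nearest centre: such points are too unlikely to be drawn. *)
Definition snap (Q : nat -> nat -> R) (t : nat) (rho : R) (i : nat) : nat -> R :=
  if Rle_dec (dmin d Q t (P i)) rho then Q (amin d Q t (P i)) else P i.

(** The weight of [i] spans at least [M / (s G) >= 2] grid steps, by [M = 2 G n] and [s <= n].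
    Rounding loses at most one step, hence at most half of them. *)
Lemma scan_frequency Q t M i s G :
  (i < n)%nat -> (0 < M)%nat -> 0 < dmin d Q t (P i) -> 0 < s <= INR n -> 0 < G ->
  INR M = 2 * G * INR n -> potential Q t <= dmin d Q t (P i) * (s * G) ->
  / (2 * s * G) <= avg M (fun r =>
    if Nat.eqb (fst (scan (fun i => dmin d Q t (P i)) n
      (INR r * (potential Q t / INR M)))) i then 1 else 0).
Proof.
  intros Hi HM Hpos Hs HG HMG Hpot.
  set (w := fun i => dmin d Q t (P i)). fold (w i) in Hpos, Hpot.
  set (Delta := potential Q t) in *. set (h := Delta / INR M).
  assert (Hw : forall j, 0 <= w j) by (intros; apply dmin_nonneg).
  assert (HDelta : sumR (S i) w <= Delta).
  { unfold Delta, potential. fold w. clear - Hi Hw. induction n as [|m IH]; [lia|].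
    destruct (Nat.eq_dec i m) as [->|]; [lra|].
    specialize (IH ltac:(lia)). specialize (Hw m). simpl in *; lra. }
  assert (HW : 0 <= sumR i w) by (apply sumR_nonneg; intros; apply Hw).
  cbn [sumR] in HDelta.
  assert (HD : 0 < Delta) by lra.
  assert (HMr : 0 < INR M) by (apply lt_0_INR; assumption).
  assert (Hh : 0 < h) by (apply Rmult_lt_0_compat; [|apply Rinv_0_lt_compat]; assumption).
  apply (Rmult_le_reg_l (INR M)); [assumption|]. unfold avg.
  rewrite <- (Rmult_assoc (INR M)), Rinv_r, Rmult_1_l by lra.
  (* The grid points that hit [i] lie between two consecutive partial sums, so they are counted as a
     difference. *)
  apply Rle_trans with (sumR M (fun r =>
    (if Rlt_dec (INR r * h) (sumR (S i) w) then 1 else 0)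
    + -1 * (if Rlt_dec (INR r * h) (sumR i w) then 1 else 0))).
  2:{ apply sumR_le; intros r _. cbn [sumR].
      destruct (Rlt_dec (INR r * h) (sumR i w)), (Rlt_dec (INR r * h) (sumR i w + w i));
        [| lra | |]; try (destruct Nat.eqb; lra).
      rewrite (scan_hit w n i); [rewrite Nat.eqb_refl; lra|assumption|assumption|].
      cbn [sumR]; lra. }
  rewrite sumR_plus, sumR_scal.
  destruct (count_multiples M h (sumR (S i) w) Hh) as [Hlo _]; [cbn [sumR]; lra|].
  destruct (count_multiples M h (sumR i w) Hh) as [_ Hhi]; [lra|].
  cbn [sumR] in Hlo.
  assert (HMh : Delta / h = INR M) by (unfold h; field; split; lra).
  rewrite Rmin_right in Hlo.
  2:{ rewrite <- HMh. apply Rmult_le_compat_r; [left; now apply Rinv_0_lt_compat|lra]. }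
  assert (Hx : INR M / (s * G) <= w i / h).
  { unfold h. apply (Rmult_le_reg_r (Delta * (s * G))); [apply Rmult_lt_0_compat; nra|].
    replace (INR M / (s * G) * (Delta * (s * G))) with (INR M * Delta) by (field; lra).
    replace (w i / (Delta / INR M) * (Delta * (s * G))) with (INR M * (w i * (s * G)))
      by (field; lra).
    apply Rmult_le_compat_l; lra. }
  assert (H2 : 2 <= INR M / (s * G)).
  { rewrite HMG. replace (2 * G * INR n / (s * G)) with (2 * (INR n / s)) by (field; lra).
    assert (1 <= INR n / s); [|lra]. apply (Rmult_le_reg_r s); [lra|].
    unfold Rdiv; rewrite Rmult_assoc, Rinv_l; lra. }
  replace ((sumR i w + w i) / h) with (sumR i w / h + w i / h) in Hlo by (field; lra).
  replace (INR M * / (2 * s * G)) with (INR M / (s * G) / 2) by (field; lra).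
  cbn [sumR]. fold h. lra.
Qed.

(** A moved point sits on a chosen centre, and each centre alone has probability [1 / (t + 2)],
    which outweighs the normalised mass of all points moved there. The other points have weight
    above [rho] and are covered by [scan_frequency]. Finally [t + 2 <= k + 1]. *)
Lemma pick_expectation Q t k G M chi rho phi :
  (t < k)%nat -> (0 < G)%nat -> M = (2 * G * n)%nat ->
  (forall i, (i < n)%nat -> 0 <= chi i <= 1) -> 0 < sumR n chi -> 0 <= rho ->
  potential Q t <= rho * (sumR n chi * INR G) ->
  (forall y, 0 <= phi y) ->
  / INR (2 * G * (k + 1)) * (/ sumR n chi * sumR n (fun i => chi i * phi (snap Q t rho i)))
  <= avg (t + 2) (fun q => avg M (fun r => phi (pick M Q t q r))).
Proof.
  intros Ht HG HM Hchi Hs Hrho Hpot Hphi. set (s := sumR n chi) in *.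
  assert (Hsn : s <= INR n).
  { unfold s. rewrite <- (Rmult_1_r (INR n)), <- sumR_const. apply sumR_le.
    intros; now apply Hchi. }
  assert (HMpos : (0 < M)%nat) by (subst M; nia).
  assert (HGr : 1 <= INR G) by (apply (le_INR 1); lia).
  assert (HMr : INR M = 2 * INR G * INR n).
  { subst M. rewrite !mult_INR. reflexivity. }
  set (near := sumR n (fun i => if Rle_dec (dmin d Q t (P i)) rho
    then chi i * phi (Q (amin d Q t (P i))) else 0)).
  set (far := sumR n (fun i => if Rle_dec (dmin d Q t (P i)) rho
    then 0 else chi i * phi (P i))).
  replace (sumR n (fun i => chi i * phi (snap Q t rho i))) with (near + far).
  2:{ unfold near, far. rewrite <- sumR_plus. apply sumR_ext; intros i _.
      unfold snap. destruct Rle_dec; lra. }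
  assert (Hnear : / s * near <= sumR (t + 1) (fun q => phi (Q q))).
  { apply (Rmult_le_reg_l s); [assumption|].
    rewrite <- (Rmult_assoc s), Rinv_r, Rmult_1_l by lra.
    rewrite Rmult_comm. unfold s. rewrite <- sumR_scal. apply sumR_le; intros i Hi.
    assert (H0 : phi (Q (amin d Q t (P i))) <= sumR (t + 1) (fun q => phi (Q q))).
    { apply (sumR_term_le (t + 1) (fun q => phi (Q q))); [intros; apply Hphi|].
      pose proof (amin_le d Q t (P i)); lia. }
    pose proof (Hphi (Q (amin d Q t (P i)))). specialize (Hchi i Hi).
    destruct Rle_dec; nra. }
  set (idx := fun r => fst (scan (fun i => dmin d Q t (P i)) n
    (INR r * (potential Q t / INR M)))).
  assert (Hfar : / (2 * s * INR G) * far <= avg M (fun r => phi (P (idx r)))).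
  { apply Rle_trans with (avg M (fun r => sumR n (fun i =>
      if Nat.eqb (idx r) i then phi (P i) else 0))).
    2:{ apply avg_le; intros r _. apply (sumR_pick_le n (fun i => phi (P i))).
        intros; apply Hphi. }
    unfold avg. rewrite sumR_swap, <- sumR_scal. unfold far. rewrite <- sumR_scal.
    apply sumR_le; intros i Hi.
    replace (/ INR M * sumR M (fun r => if Nat.eqb (idx r) i then phi (P i) else 0))
      with (phi (P i) * avg M (fun r => if Nat.eqb (idx r) i then 1 else 0)).
    2:{ unfold avg. rewrite <- Rmult_assoc, (Rmult_comm (phi (P i))), Rmult_assoc.
        f_equal. rewrite <- sumR_scal. apply sumR_ext; intros; destruct Nat.eqb; ring. }
    assert (Hpos : 0 < / (2 * s * INR G)).
    { apply Rinv_0_lt_compat. apply Rmult_lt_0_compat; lra. }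
    pose proof (Hphi (P i)) as Hphi0.
    destruct Rle_dec as [|Hfar].
    - rewrite Rmult_0_r. apply Rmult_le_pos; [assumption|].
      apply Rmult_le_pos; [apply inv_INR_nonneg|]. apply sumR_nonneg; intros.
      destruct Nat.eqb; lra.
    - assert (Hf := scan_frequency Q t M i s (INR G) Hi HMpos ltac:(lra)
        ltac:(lra) ltac:(lra) HMr).
      specialize (Hchi i Hi).
      apply Rle_trans with (phi (P i) * / (2 * s * INR G)).
      { rewrite Rmult_comm, Rmult_assoc.
        apply Rle_trans with (1 * (phi (P i) * / (2 * s * INR G))); [|lra].
        apply Rmult_le_compat_r; [|lra]. apply Rmult_le_pos; lra. }
      apply Rmult_le_compat_l; [assumption|]. apply Hf.
      eapply Rle_trans; [exact Hpot|]. apply Rmult_le_compat_r; [|lra].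
      apply Rmult_le_pos; lra. }
  set (sn := sumR (t + 1) (fun q => phi (Q q))) in *.
  set (sf := avg M (fun r => phi (P (idx r)))) in *.
  replace (avg (t + 2) (fun q => avg M (fun r => phi (pick M Q t q r))))
    with (/ INR (t + 2) * (sn + sf)).
  2:{ unfold avg at 1. f_equal. replace (t + 2)%nat with (S (t + 1)) by lia.
      cbn [sumR]. f_equal.
      - unfold sn. apply sumR_ext; intros q Hq. unfold pick.
        replace (Nat.ltb q (t + 1)) with true by (symmetry; apply Nat.ltb_lt; lia).
        now rewrite avg_const.
      - unfold pick. now rewrite Nat.ltb_irrefl. }
  assert (Hnear0 : 0 <= near).
  { apply sumR_nonneg; intros i Hi. specialize (Hchi i Hi).
    pose proof (Hphi (Q (amin d Q t (P i)))). destruct Rle_dec; [nra|lra]. }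
  assert (Hfar0 : 0 <= far).
  { apply sumR_nonneg; intros i Hi. specialize (Hchi i Hi).
    pose proof (Hphi (P i)). destruct Rle_dec; [lra|nra]. }
  assert (Hsinv : 0 < / s) by (now apply Rinv_0_lt_compat).
  assert (HGinv : 0 < / (2 * INR G)) by (apply Rinv_0_lt_compat; lra).
  assert (Hkinv : 0 < / INR (k + 1)) by (apply Rinv_0_lt_compat, lt_0_INR; lia).
  assert (HGle : / (2 * INR G) <= 1).
  { rewrite <- Rinv_1. apply Rinv_le_contravar; lra. }
  rewrite mult_INR, mult_INR, Rinv_mult. change (INR 2) with 2.
  apply Rle_trans with (/ INR (k + 1) * (sn + sf)).
  - rewrite (Rmult_comm (/ (2 * INR G))), Rmult_assoc.
    apply Rmult_le_compat_l; [lra|].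
    replace (/ (2 * s * INR G) * far) with (/ (2 * INR G) * (/ s * far)) in Hfar
      by (field; lra).
    assert (0 <= / s * near) by (apply Rmult_le_pos; lra). nra.
  - apply Rmult_le_compat_r.
    + apply Rplus_le_le_0_compat.
      * apply sumR_nonneg; intros; apply Hphi.
      * apply Rmult_le_pos; [apply inv_INR_nonneg|].
        apply sumR_nonneg; intros; apply Hphi.
    + apply Rinv_le_contravar; [apply lt_0_INR; lia|apply le_INR; lia].
Qed.

(** The draws are independent, so the loss of a single draw is raised to the power [j]. *)
Lemma draws_ge_unif Q t k G M chi rho b V j :
  (t < k)%nat -> (0 < G)%nat -> M = (2 * G * n)%nat ->
  (forall i, (i < n)%nat -> 0 <= chi i <= 1) -> 0 < sumR n chi -> 0 <= rho ->
  potential Q t <= rho * (sumR n chi * INR G) ->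
  (forall y, 0 <= V y) -> forall y,
  (/ INR (2 * G * (k + 1))) ^ j * unif n chi (snap Q t rho) b j y V
  <= draws M b Q t j y V.
Proof.
  intros Ht HG HM Hchi Hs Hrho Hpot HV.
  assert (HV0 : forall j y, 0 <= unif n chi (snap Q t rho) b j y V).
  { intros i y. pose proof (unif_affine_le n chi (snap Q t rho) b V (fun _ => 0) 0 0 i
      (fun i Hi => proj1 (Hchi i Hi)) Hs (fun y => ltac:(rewrite Rmult_0_l, Rplus_0_l;
      apply HV)) y). lra. }
  set (g := / INR (2 * G * (k + 1))).
  assert (Hg : 0 <= g) by apply inv_INR_nonneg.
  induction j as [|j IH]; intros y; [simpl; lra|].
  cbn [unif draws].
  pose proof (pick_expectation Q t k G M chi rho
    (fun z => unif n chi (snap Q t rho) b j (fun x => y x + z x * b) V)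
    Ht HG HM Hchi Hs Hrho Hpot (fun z => HV0 j _)) as H.
  fold g in H. simpl pow. rewrite (Rmult_comm g), Rmult_assoc.
  apply Rle_trans with (g ^ j * avg (t + 2) (fun q => avg M (fun r =>
     unif n chi (snap Q t rho) b j (fun x => y x + pick M Q t q r x * b) V))).
  { apply Rmult_le_compat_l; [now apply pow_le|exact H]. }
  unfold avg at 1. rewrite <- Rmult_assoc, (Rmult_comm (g ^ j)), Rmult_assoc.
  apply Rmult_le_compat_l; [apply inv_INR_nonneg|]. rewrite <- sumR_scal.
  apply sumR_le; intros q _.
  unfold avg at 1. rewrite <- Rmult_assoc, (Rmult_comm (g ^ j)), Rmult_assoc.
  apply Rmult_le_compat_l; [apply inv_INR_nonneg|]. rewrite <- sumR_scal.
  apply sumR_le; intros r _. apply IH.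
Qed.

Definition indicator (A : Prop) : R := if excluded_middle_informative A then 1 else 0.

Lemma indicator_range (A : Prop) : 0 <= indicator A <= 1.
Proof. unfold indicator. destruct excluded_middle_informative; lra. Qed.

(** Markov's inequality for the mean of [m] uniform samples of the moved cluster. Times [s], the
    expected squared distance to [o] is at most [A / (4 E)] for the shift of the centroid plus
    [4 A / m = A / (4 E)] for the variance, which is half the tolerance. *)
Lemma draws_close Q t k G M E m chi rho A :
  (t < k)%nat -> (0 < G)%nat -> M = (2 * G * n)%nat -> (0 < E)%nat ->
  m = (16 * E)%nat ->
  (forall i, (i < n)%nat -> 0 <= chi i <= 1) -> 0 < sumR n chi -> 0 <= rho -> 0 < A ->
  potential Q t <= rho * (sumR n chi * INR G) ->
  sumR n (fun i => chi i * sqdist d (P i) (centroid n chi P)) <= A ->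
  sumR n (fun i => if Rle_dec (dmin d Q t (P i)) rho
                   then chi i * dmin d Q t (P i) else 0) <= / (4 * INR E) * A ->
  (/ INR (2 * G * (k + 1))) ^ m * / 2
  <= draws M (/ INR m) Q t m (fun _ => 0) (fun y =>
       indicator (sumR n chi * sqdist d y (centroid n chi P) <= / INR E * A)).
Proof.
  intros Ht HG HM HE Hm Hchi Hs Hrho HA Hpot HvarA Hnear.
  set (s := sumR n chi) in *. set (o := centroid n chi P) in *.
  set (e := / INR E). set (a := snap Q t rho).
  assert (HEr : 1 <= INR E) by (apply (le_INR 1); lia).
  assert (He : 0 < e <= 1).
  { unfold e. split; [apply Rinv_0_lt_compat; lra|].
    rewrite <- Rinv_1. apply Rinv_le_contravar; lra. }
  replace (/ (4 * INR E)) with (e / 4) in Hnear by (unfold e; field; lra).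
  eapply Rle_trans;
    [|apply (draws_ge_unif Q t k G M chi rho (/ INR m)); try assumption;
      intros; apply indicator_range].
  fold a. apply Rmult_le_compat_l; [apply pow_le, inv_INR_nonneg|].
  set (c := s / (e * A)).
  assert (HeA : 0 < e * A) by (apply Rmult_lt_0_compat; lra).
  eapply Rle_trans; [|apply (unif_affine_le n chi a (/ INR m) _
    (fun y => sqdist d y o) 1 (- c))]; [|apply Hchi|assumption|].
  2:{ intros y. unfold indicator. destruct excluded_middle_informative as [|Hbig].
      - assert (0 <= c * sqdist d y o); [|lra].
        apply Rmult_le_pos; [|apply sqdist_nonneg].
        apply Rmult_le_pos; [lra|left; now apply Rinv_0_lt_compat].
      - apply Rnot_le_lt in Hbig. fold e in Hbig.
        assert (1 <= c * sqdist d y o); [|lra]. unfold c.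
        apply (Rmult_le_reg_r (e * A)); [assumption|].
        replace (s / (e * A) * sqdist d y o * (e * A)) with (s * sqdist d y o)
          by (field; lra). lra. }
  rewrite unif_sqdist by assumption. fold s.
  set (mu := centroid n chi a).
  assert (Hmr : INR m = 16 * INR E).
  { rewrite Hm, mult_INR. change (INR 16) with (IZR (Z.of_nat 16)) || rewrite INR_IZR_INZ.
    simpl. ring. }
  rewrite (sqdist_ext d _ mu).
  2:{ intros x _. field. lra. }
  set (var := sumR n (fun i => chi i * sqdist d (a i) mu)).
  assert (Hdisp : sumR n (fun i => chi i * sqdist d (a i) (P i)) <= e / 4 * A).
  { eapply Rle_trans; [|exact Hnear]. apply sumR_le; intros i _. unfold a, snap.
    destruct Rle_dec; [rewrite (sqdist_sym d (Q _)); unfold dmin; lra|].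
    rewrite sqdist_refl; lra. }
  (* The centroid is linear in the points: [mu - o] is the centroid of the displacements, so its
     squared norm is at most their mean squared norm. *)
  assert (Hmu : s * sqdist d mu o <= e / 4 * A).
  { eapply Rle_trans; [|exact Hdisp].
    pose proof (sumR_sqdist_centroid n d chi (fun i x => a i x - P i x) (fun _ => 0) Hs)
      as Hc.
    rewrite (sumR_ext n _ (fun i => chi i * sqdist d (a i) (P i))) in Hc.
    2:{ intros i _. f_equal. apply sumR_ext; intros; ring. }
    rewrite Hc. fold s.
    replace (sqdist d (centroid n chi (fun i x => a i x - P i x)) (fun _ => 0))
      with (sqdist d mu o).
    2:{ apply sumR_ext; intros x _. f_equal. unfold mu, o, centroid. fold s.
        rewrite (sumR_ext n (fun i => chi i * (a i x - P i x))
          (fun i => chi i * a i x + -1 * (chi i * P i x))) by (intros; ring).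
        rewrite sumR_plus, sumR_scal. ring. }
    match goal with |- _ <= _ + ?r => assert (0 <= r) end; [|lra].
    apply sumR_nonneg; intros i Hi. apply Rmult_le_pos; [now apply Hchi|].
    apply sqdist_nonneg. }
  (* The dispersion about [mu] is at most that about [o], which the triangle inequality bounds by
     [2 * (e / 4 * A) + 2 * A]. *)
  assert (Hvar : var <= 4 * A).
  { apply Rle_trans with (sumR n (fun i => chi i * sqdist d (a i) o)).
    - rewrite (sumR_sqdist_centroid n d chi a o Hs). fold s mu var.
      pose proof (sqdist_nonneg d mu o). nra.
    - apply Rle_trans with (sumR n (fun i => 2 * (chi i * sqdist d (a i) (P i))
        + 2 * (chi i * sqdist d (P i) o))).
      + apply sumR_le; intros i Hi.
        pose proof (sqdist_triangle d (a i) (P i) o). specialize (Hchi i Hi). nra.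
      + rewrite sumR_plus, !sumR_scal. nra. }
  assert (Hgoal : c * (sqdist d mu o + INR m * (/ INR m) ^ 2 * (/ s * var)) <= / 2);
    [|lra].
  apply (Rmult_le_reg_r (e * A)); [assumption|].
  replace (c * (sqdist d mu o + INR m * (/ INR m) ^ 2 * (/ s * var)) * (e * A))
    with (s * sqdist d mu o + / INR m * var) by (unfold c; field; lra).
  assert (Hmi : / INR m * var <= / INR m * (4 * A)).
  { apply Rmult_le_compat_l; [apply inv_INR_nonneg|assumption]. }
  replace (/ INR m * (4 * A)) with (e / 4 * A) in Hmi
    by (rewrite Hmr; unfold e; field; lra).
  lra.
Qed.

End Step.

(** * The cost of assignments *)

(** Selections are Boolean vectors; [lsmall_le_wsum] and [choose_spec] together say that [lsmall] is
    the minimum over those with [l] true entries. *)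
Fixpoint wsum (bs : list bool) (xs : list R) : R :=
  match bs, xs with
  | b :: bs', x :: xs' => (if b then x else 0) + wsum bs' xs'
  | _, _ => 0
  end.

Definition ntrue (bs : list bool) : nat := list_sum (map Nat.b2n bs).

Lemma ntrue_le bs : (ntrue bs <= length bs)%nat.
Proof.
  induction bs as [|b bs IH]; unfold ntrue in *; simpl; [lia|]. destruct b; simpl; lia.
Qed.

Lemma lsmall_le_wsum xs : forall bs,
  length bs = length xs -> lsmall (ntrue bs) xs <= wsum bs xs.
Proof.
  induction xs as [|x xs IH]; intros [|b bs] Hlen; try discriminate; [simpl; lra|].
  injection Hlen as Hlen. specialize (IH bs Hlen). pose proof (ntrue_le bs) as Hle.
  destruct b.
  - change (ntrue (true :: bs)) with (S (ntrue bs)). cbn [lsmall wsum].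
    destruct Nat.ltb; [lra|]. eapply Rle_trans; [apply Rmin_l|]. lra.
  - change (ntrue (false :: bs)) with (ntrue bs). cbn [wsum].
    rewrite Rplus_0_l. destruct (ntrue bs) as [|c]; [destruct xs; exact IH|].
    cbn [lsmall]. replace (Nat.ltb (length xs) (S c)) with false.
    + eapply Rle_trans; [apply Rmin_r|]. exact IH.
    + symmetry; apply Nat.ltb_ge; lia.
Qed.

Fixpoint choose (l : nat) (xs : list R) : list bool :=
  match xs with
  | [] => []
  | x :: xs' =>
    match l with
    | O => false :: choose l xs'
    | S l' => if Nat.ltb (length xs') l then true :: choose l' xs'
              else if Rle_dec (x + lsmall l' xs') (lsmall l xs')
                   then true :: choose l' xs' else false :: choose l xs'
    end
  end.

Lemma length_choose xs : forall l, length (choose l xs) = length xs.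
Proof.
  induction xs as [|x xs IH]; intros [|l]; simpl; auto.
  destruct Nat.ltb; [|destruct Rle_dec]; simpl; auto.
Qed.

Lemma choose_spec xs : forall l, (l <= length xs)%nat ->
  ntrue (choose l xs) = l /\ wsum (choose l xs) xs = lsmall l xs.
Proof.
  induction xs as [|x xs IH]; intros l Hl.
  - simpl in Hl. replace l with 0%nat by lia. now split.
  - destruct l as [|l].
    + destruct (IH 0%nat ltac:(lia)) as [H1 H2]. cbn [choose wsum]. split; [exact H1|].
      rewrite H2, Rplus_0_l. now destruct xs.
    + cbn [choose lsmall]. destruct (IH l ltac:(simpl in Hl; lia)) as [H1 H2].
      destruct (Nat.ltb_spec (length xs) (S l)) as [Hlt|Hge].
      * cbn [wsum]. split; [exact (f_equal S H1)|now rewrite H2].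
      * destruct (IH (S l) Hge) as [H3 H4].
        destruct Rle_dec as [Hle|Hgt]; cbn [wsum].
        -- split; [exact (f_equal S H1)|]. now rewrite H2, Rmin_left.
        -- split; [exact H3|]. rewrite H4, Rmin_right; lra.
Qed.

Definition b2R (b : bool) : R := if b then 1 else 0.

Lemma wsum_sumR bs f : forall a,
  wsum bs (map f (seq a (length bs)))
  = sumR (length bs) (fun c => b2R (nth c bs false) * f (a + c)%nat).
Proof.
  induction bs as [|b bs IH]; intros a; [reflexivity|].
  cbn [length]. rewrite sumR_S_l. cbn [seq map wsum]. rewrite IH. f_equal.
  - rewrite Nat.add_0_r. destruct b; simpl; ring.
  - apply sumR_ext; intros c _. cbn [nth]. now rewrite <- plus_n_Sm.
Qed.

Lemma sumR_nth (L : list nat) (g : nat -> R) :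
  sumR (length L) (fun c => g (nth c L 0%nat)) = fold_right Rplus 0 (map g L).
Proof.
  induction L as [|x L IH]; [reflexivity|]. cbn [length]. rewrite sumR_S_l. simpl.
  now rewrite IH.
Qed.

Lemma sumR_permutation k L (g : nat -> R) :
  Permutation L (seq 0 k) -> sumR k (fun c => g (nth c L 0%nat)) = sumR k g.
Proof.
  intros H. pose proof (Permutation_length H) as Hlen. rewrite length_seq in Hlen.
  rewrite <- Hlen at 1. rewrite sumR_nth.
  replace (sumR k g) with (fold_right Rplus 0 (map g (seq 0 k))).
  - clear Hlen. apply (Permutation_map g) in H. revert H.
    generalize (map g L) (map g (seq 0 k)). intros u v H.
    induction H; simpl; lra.
  - rewrite <- sumR_nth, length_seq. apply sumR_ext; intros c Hc.
    now rewrite seq_nth.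
Qed.

Lemma map_nth_seq_bool (bs : list bool) :
  map (fun j => nth j bs false) (seq 0 (length bs)) = bs.
Proof.
  induction bs as [|b bs IH]; [reflexivity|]. cbn [length seq map nth]. f_equal.
  rewrite <- seq_shift, map_map. exact IH.
Qed.

(** [L] will list the clusters in the order in which a trial serves them. A point belonging to [l]
    clusters can be charged to the [l] distinct centres serving these, and its [l] nearest centres
    cost no more. *)
Lemma lnear_cost_permuted d k l C p bs L :
  length bs = k -> ntrue bs = l -> Permutation L (seq 0 k) ->
  lnear_cost d k l C p
  <= sumR k (fun c => b2R (nth (nth c L 0%nat) bs false) * sqdist d p (C c)).
Proof.
  intros Hlen Hn HL. set (bs' := map (fun j => nth j bs false) L).
  pose proof (Permutation_length HL) as HlenL. rewrite length_seq in HlenL.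
  assert (Hlen' : length bs' = k) by (unfold bs'; now rewrite length_map).
  assert (Hn' : ntrue bs' = l).
  { rewrite <- Hn, <- (map_nth_seq_bool bs), Hlen.
    unfold ntrue, bs'. apply (Permutation_map (fun j => nth j bs false)) in HL.
    apply (Permutation_map Nat.b2n) in HL. revert HL.
    generalize (map Nat.b2n (map (fun j => nth j bs false) L))
      (map Nat.b2n (map (fun j => nth j bs false) (seq 0 k))).
    intros u v H. induction H; simpl; lia. }
  unfold lnear_cost. rewrite <- Hn'.
  eapply Rle_trans; [apply (lsmall_le_wsum _ bs')|].
  - now rewrite length_map, length_seq.
  - rewrite <- Hlen', wsum_sumR. apply Req_le, sumR_ext; intros c Hc.
    (* [map_nth] wants as default the image of the default [0] of [L]. *)
    do 2 f_equal. transitivity (nth c bs' (nth 0%nat bs false)).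
    + now apply nth_indep.
    + apply (map_nth (fun j => nth j bs false)).
Qed.

(** * Trials *)

Definition setc (Q : nat -> nat -> R) (c : nat) (y : nat -> R) : nat -> nat -> R :=
  fun c' => if Nat.eqb c' c then y else Q c'.

Section Trial.
Variables n d : nat.
Variable P : nat -> nat -> R.
Hypothesis Hn : (0 < n)%nat.

Lemma draws_affine_le M b Q t V W c0 c j :
  (0 < M)%nat -> (forall y, c0 + c * W y <= V y) ->
  forall y, c0 + c * draws n d P M b Q t j y W <= draws n d P M b Q t j y V.
Proof.
  intros HM HVW. induction j as [|j IH]; intros y; cbn [draws]; [apply HVW|].
  rewrite <- avg_affine by lia. apply avg_le; intros q _.
  rewrite <- avg_affine by assumption. apply avg_le; intros r _. apply IH.
Qed.

(* The expectation of [V] on the centres obtained from [Q] by choosing the centres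
   [t + 1, .., t + s]; centre [0] is never chosen and can be anything. *)
Fixpoint trial (M : nat) (b : R) (m : nat) (Q : nat -> nat -> R) (t s : nat)
  (V : (nat -> nat -> R) -> R) : R :=
  match s with
  | O => V Q
  | S s' => draws n d P M b Q t m (fun _ => 0)
              (fun y => trial M b m (setc Q (S t) y) (S t) s' V)
  end.

Lemma trial_affine_le M b m V W c0 c s :
  (0 < M)%nat -> (forall Q, c0 + c * W Q <= V Q) ->
  forall Q t, c0 + c * trial M b m Q t s W <= trial M b m Q t s V.
Proof.
  intros HM HVW. induction s as [|s IH]; intros Q t; cbn [trial]; [apply HVW|].
  apply draws_affine_le; [assumption|]. intros y. apply IH.
Qed.

(** * Serving the clusters of a reference solution *)

Section Clusters.
Variables (k E G M m : nat).
Variable chi : nat -> nat -> R.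
Variable A : R.
Hypothesis Hk : (1 <= k)%nat.
Hypothesis HkE : (k <= E)%nat.
Hypothesis HG : G = (64 * k * E)%nat.
Hypothesis HM : M = (2 * G * n)%nat.
Hypothesis Hm : m = (16 * E)%nat.
Hypothesis HA : 0 < A.
Hypothesis Hchi : forall j i, (j < k)%nat -> (i < n)%nat -> 0 <= chi j i <= 1.
Hypothesis Hcover : forall i, (i < n)%nat -> 1 <= sumR k (fun j => chi j i).

Let size (j : nat) : R := sumR n (chi j).
Let center (j : nat) : nat -> R := centroid n (chi j) P.
Let spread (j : nat) : R := sumR n (fun i => chi j i * sqdist d (P i) (center j)).

Hypothesis Hspread : sumR k spread <= A.

(** Multiplying by the size measures the error in units of the total cost; it also lets any vector
    serve an empty cluster. *)
Definition close (j : nat) (y : nat -> R) : Prop :=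
  size j * sqdist d y (center j) <= / INR E * A.

Lemma E_ge1 : 1 <= INR E.
Proof. apply (le_INR 1), (Nat.le_trans 1 k E); assumption. Qed.

Lemma size_nonneg j : (j < k)%nat -> 0 <= size j.
Proof. intros Hj. apply sumR_nonneg; intros; now apply Hchi. Qed.

Lemma spread_nonneg j : (j < k)%nat -> 0 <= spread j.
Proof.
  intros Hj. apply sumR_nonneg; intros. apply Rmult_le_pos; [now apply Hchi|].
  apply sqdist_nonneg.
Qed.

Lemma spread_le j : (j < k)%nat -> spread j <= A.
Proof.
  intros Hj. eapply Rle_trans; [|exact Hspread].
  apply (sumR_term_le k spread); [intros; now apply spread_nonneg|assumption].
Qed.

Lemma moved_cost j y : (j < k)%nat ->
  sumR n (fun i => chi j i * sqdist d (P i) y) <= spread j + size j * sqdist d y (center j).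
Proof.
  intros Hj. pose proof (size_nonneg j Hj) as Hs.
  destruct (Rle_lt_or_eq_dec _ _ Hs) as [Hpos|Hz].
  - rewrite sumR_sqdist_centroid by exact Hpos.
    fold (size j) (center j) (spread j). rewrite (sqdist_sym d y). lra.
  (* In an empty cluster the centroid is meaningless, but all weights vanish. *)
  - rewrite <- Hz, Rmult_0_l, Rplus_0_r.
    assert (H0 : forall i, (i < n)%nat -> chi j i = 0).
    { intros i Hi. apply Rle_antisym; [|now apply Hchi]. rewrite Hz.
      apply (sumR_term_le n (chi j)); [intros; now apply Hchi|assumption]. }
    eapply Rle_trans; [|now apply spread_nonneg].
    rewrite (sumR_ext _ _ (fun _ => 0)) by (intros; rewrite H0 by assumption; ring).
    rewrite sumR_const; lra.
Qed.

Lemma absent_index (L : list nat) : (length L < k)%nat -> exists j, (j < k)%nat /\ ~ In j L.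
Proof.
  intros HL. apply NNPP; intros Hno.
  assert (Hincl : incl (seq 0 k) L).
  { intros j Hj. apply in_seq in Hj. apply NNPP; intros Hj'.
    apply Hno; exists j; split; [lia|assumption]. }
  apply NoDup_incl_length in Hincl; [rewrite length_seq in Hincl; lia|apply seq_NoDup].
Qed.

(* If the potential is at most [4 k A], points within the squared distance
   [A / (4 E size)] can be moved at a small cost, and all others are heavy, for any cluster.
   Otherwise a cluster carrying a [1/k] fraction of the potential is far from all chosen
   centres compared to its spread; it contains no cluster that is already served. *)
Lemma next_cluster Q t L :
  (t < k)%nat -> length L = t ->
  (forall c, (c < t)%nat -> close (nth c L 0%nat) (Q (S c))) ->
  exists j, (j < k)%nat /\ ~ In j L /\
    (size j = 0 \/
     0 < size j /\ exists rho, 0 <= rho /\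
       potential n d P Q t <= rho * (size j * INR G) /\
       sumR n (fun i => if Rle_dec (dmin d Q t (P i)) rho
                        then chi j i * dmin d Q t (P i) else 0) <= / (4 * INR E) * A).
Proof.
  intros Ht HL Hclose. pose proof E_ge1 as HE.
  assert (Hkr : 1 <= INR k) by (apply (le_INR 1); lia).
  assert (HGr : INR G = 64 * INR k * INR E).
  { rewrite HG, !mult_INR. do 2 f_equal. rewrite INR_IZR_INZ. reflexivity. }
  set (Delta := potential n d P Q t). set (D := fun i => dmin d Q t (P i)).
  assert (HD : forall i, 0 <= D i) by (intros; apply dmin_nonneg).
  destruct (Rle_dec Delta (4 * INR k * A)) as [Hlow|Hhigh].
  - destruct (absent_index L ltac:(lia)) as [j [Hj HjL]].
    exists j; split; [assumption|split; [assumption|]].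
    destruct (Rle_lt_or_eq_dec _ _ (size_nonneg j Hj)) as [Hs|Hs]; [right|now left].
    split; [assumption|]. exists (/ (4 * INR E) * A / size j).
    assert (Hrho : 0 <= / (4 * INR E) * A / size j).
    { apply Rmult_le_pos; [|left; now apply Rinv_0_lt_compat].
      apply Rmult_le_pos; [|lra]. left; apply Rinv_0_lt_compat; lra. }
    split; [assumption|split].
    + rewrite HGr. replace (/ (4 * INR E) * A / size j * (size j * (64 * INR k * INR E)))
        with (16 * INR k * A) by (field; lra). nra.
    + apply Rle_trans with (sumR n (fun i => / (4 * INR E) * A / size j * chi j i)).
      * apply sumR_le; intros i Hi. specialize (Hchi j i Hj Hi).
        fold (D i). specialize (HD i). destruct Rle_dec; nra.
      * rewrite sumR_scal. fold (size j). right. field; lra.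
  - apply Rnot_le_lt in Hhigh.
    (* Pigeonhole: as the clusters cover every point, their potentials sum to at least [Delta]. *)
    assert (Hj : exists j, (j < k)%nat /\ Delta <= INR k * sumR n (fun i => chi j i * D i)).
    { apply NNPP; intros Hno.
      assert (Hall : forall j, (j < k)%nat ->
          sumR n (fun i => chi j i * D i) < Delta / INR k).
      { intros j Hj. apply Rnot_le_lt; intros Hge. apply Hno; exists j.
        split; [assumption|]. apply (Rmult_le_compat_l (INR k)) in Hge; [|lra].
        replace (INR k * (Delta / INR k)) with Delta in Hge by (field; lra). assumption. }
      assert (Hsum : Delta <= sumR k (fun j => sumR n (fun i => chi j i * D i))).
      { rewrite sumR_swap. unfold Delta, potential. apply sumR_le; intros i Hi.
        fold (D i). rewrite (sumR_ext _ _ (fun j => D i * chi j i)) by (intros; ring).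
        rewrite sumR_scal. specialize (HD i). specialize (Hcover i Hi). nra. }
      assert (Hlt : sumR k (fun j => sumR n (fun i => chi j i * D i)) < Delta); [|lra].
      replace Delta with (sumR k (fun _ => Delta / INR k)) at 1
        by (rewrite sumR_const; field; lra).
      assert (Hstrict : forall l, (l <= k)%nat -> (0 < l)%nat ->
        sumR l (fun j => sumR n (fun i => chi j i * D i)) < sumR l (fun _ => Delta / INR k)).
      { induction l as [|l IH]; intros Hl Hl0; [lia|]. cbn [sumR].
        specialize (Hall l ltac:(lia)).
        destruct l as [|l]; [simpl; lra|]. specialize (IH ltac:(lia) ltac:(lia)).
        cbn [sumR] in *. lra. }
      apply Hstrict; lia. }
    destruct Hj as [j [Hj Hbig]]. set (DS := sumR n (fun i => chi j i * D i)) in *.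
    assert (HDS : 4 * A < DS) by nra.
    pose proof (spread_le j Hj) as Hsp. pose proof (size_nonneg j Hj) as Hs0.
    exists j; split; [assumption|split].
    (* A served cluster has potential at most [A + A / E <= 2 A], contradicting [4 A < DS]. *)
    + intros HjL. apply (In_nth _ _ 0%nat) in HjL as [c [Hc Hcj]].
      rewrite HL in Hc. specialize (Hclose c Hc). rewrite Hcj in Hclose.
      unfold close in Hclose.
      assert (Hm1 : DS <= spread j + size j * sqdist d (Q (S c)) (center j)).
      { eapply Rle_trans; [|apply moved_cost; assumption].
        apply sumR_le; intros i Hi. apply Rmult_le_compat_l; [now apply Hchi|].
        apply dmin_le; lia. }
      assert (/ INR E * A <= A); [|lra].
      assert (/ INR E <= 1) by (rewrite <- Rinv_1; apply Rinv_le_contravar; lra). nra.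
    + set (D0 := dmin d Q t (center j)).
      assert (HD0 : 0 <= D0) by apply dmin_nonneg.
      assert (Hfar : DS <= 2 * spread j + 2 * (size j * D0)).
      { unfold spread, size. rewrite (Rmult_comm (sumR n (chi j))).
        rewrite <- (sumR_scal n D0), <- !sumR_scal, <- sumR_plus.
        apply sumR_le; intros i Hi. specialize (Hchi j i Hj Hi).
        pose proof (dmin_triangle d Q t (P i) (center j)) as Htri.
        fold (D i) D0 in Htri. nra. }
      destruct (Rle_lt_or_eq_dec _ _ Hs0) as [Hs|Hs]; [right|now left].
      (* In [Hfar] the spread accounts for at most half of [DS], so [DS <= 4 * size j * D0]; with
         this threshold the 64 in [G] is exactly 16 times 4. A point below the threshold satisfies
         [D0 <= 4 * sqdist] to the centroid, so moving it costs at most [/ (4 * INR E)] times its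
         share of the spread. *)
      split; [assumption|]. exists (/ (16 * INR E) * D0).
      assert (HEi : 0 < / (16 * INR E)) by (apply Rinv_0_lt_compat; lra).
      split; [apply Rmult_le_pos; lra|split].
      * rewrite HGr. replace (/ (16 * INR E) * D0 * (size j * (64 * INR k * INR E)))
          with (4 * INR k * (size j * D0)) by (field; lra). nra.
      * apply Rle_trans with (/ (4 * INR E) * spread j).
        2:{ apply Rmult_le_compat_l; [left; apply Rinv_0_lt_compat|]; lra. }
        unfold spread. rewrite <- sumR_scal. apply sumR_le; intros i Hi.
        specialize (Hchi j i Hj Hi). fold (D i).
        pose proof (sqdist_nonneg d (P i) (center j)) as Hsq.
        replace (/ (4 * INR E)) with (4 * / (16 * INR E)) by (field; lra).
        destruct Rle_dec as [Hnear|_].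
        2:{ assert (0 <= chi j i * sqdist d (P i) (center j)) by
              (apply Rmult_le_pos; lra). nra. }
        assert (Ho : D0 <= 2 * sqdist d (P i) (center j) + 2 * D i).
        { eapply Rle_trans; [apply (dmin_le d Q t (center j) (amin d Q t (P i))), amin_le|].
          eapply Rle_trans; [apply (sqdist_triangle d _ (P i))|].
          rewrite (sqdist_sym d (center j)). unfold D, dmin. lra. }
        assert (Hi16 : / (16 * INR E) <= / 16) by (apply Rinv_le_contravar; lra).
        assert (HD0' : D0 <= 4 * sqdist d (P i) (center j)) by nra.
        assert (Di4 : D i <= 4 * / (16 * INR E) * sqdist d (P i) (center j)) by nra.
        nra.
Qed.

Let rate : R := (/ INR (2 * G * (k + 1))) ^ m * / 2.

Lemma rate_range : 0 <= rate <= 1.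
Proof.
  unfold rate. assert (H0 : 0 <= / INR (2 * G * (k + 1))) by apply inv_INR_nonneg.
  assert (H1 : / INR (2 * G * (k + 1)) <= 1).
  { destruct (2 * G * (k + 1))%nat as [|x] eqn:Hx; [simpl; rewrite Rinv_0; lra|].
    rewrite <- Rinv_1. apply Rinv_le_contravar; [lra|]. apply (le_INR 1); lia. }
  pose proof (pow_le _ m H0). pose proof (pow_incr _ 1 m (conj H0 H1)) as Hp.
  rewrite pow1 in Hp. lra.
Qed.

Lemma draws_serve Q t L :
  (t < k)%nat -> length L = t ->
  (forall c, (c < t)%nat -> close (nth c L 0%nat) (Q (S c))) ->
  exists j, (j < k)%nat /\ ~ In j L /\
    rate <= draws n d P M (/ INR m) Q t m (fun _ => 0) (fun y => indicator (close j y)).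
Proof.
  intros Ht HL Hclose.
  assert (HMpos : (0 < M)%nat) by (rewrite HM, HG; nia).
  destruct (next_cluster Q t L Ht HL Hclose) as (j & Hj & HjL & Hcase).
  exists j; split; [assumption|split; [assumption|]].
  destruct Hcase as [Hz|(Hs & rho & Hrho & Hpot & Hnear)].
  - pose proof (draws_affine_le M (/ INR m) Q t (fun y => indicator (close j y)) (fun _ => 0)
      1 0 m HMpos) as H.
    pose proof rate_range. eapply Rle_trans; [|apply H].
    + lra.
    + intros y. unfold indicator. destruct excluded_middle_informative as [|Hno]; [lra|].
      exfalso; apply Hno. unfold close. rewrite Hz, Rmult_0_l.
      apply Rmult_le_pos; [apply inv_INR_nonneg|lra].
  - apply (draws_close n d P Hn Q t k G M E m (chi j) rho A); try assumption.
    + rewrite HG; nia.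
    + lia.
    + intros; now apply Hchi.
    + now apply spread_le.
Qed.

(** Which cluster is likely to be served next depends on the previous draws, but the bound [rate]
    does not, so the probabilities multiply. [L] grows by a new cluster at each success and ends as
    a permutation; after a failure only [0 <= V] is used. *)
Lemma trial_success V :
  (forall Q, 0 <= V Q) ->
  (forall Q L, Permutation L (seq 0 k) ->
     (forall c, (c < k)%nat -> close (nth c L 0%nat) (Q (S c))) -> 1 <= V Q) ->
  forall Q, rate ^ k <= trial M (/ INR m) m Q 0 k V.
Proof.
  intros HV0 HV1.
  assert (HMpos : (0 < M)%nat) by (rewrite HM, HG; nia).
  enough (Hgen : forall s t Q L, (t + s = k)%nat -> length L = t -> NoDup L ->
    (forall j, In j L -> (j < k)%nat) ->
    (forall c, (c < t)%nat -> close (nth c L 0%nat) (Q (S c))) ->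
    rate ^ s <= trial M (/ INR m) m Q t s V).
  { intros Q. apply (Hgen k 0%nat Q []); simpl; auto; try constructor; try tauto.
    intros; lia. }
  induction s as [|s IH]; intros t Q L Hts HL Hnd Hlt Hclose.
  - simpl. apply (HV1 Q L).
    + apply NoDup_Permutation_bis; [assumption|rewrite length_seq; lia|].
      intros j Hj. apply in_seq. specialize (Hlt j Hj); lia.
    + intros c Hc. apply Hclose; lia.
  - destruct (draws_serve Q t L ltac:(lia) HL Hclose) as (j & Hj & HjL & Hd).
    cbn [trial]. pose proof rate_range as Hr.
    apply Rle_trans with (0 + rate ^ s *
      draws n d P M (/ INR m) Q t m (fun _ => 0) (fun y => indicator (close j y))).
    + assert (0 <= rate ^ s) by (apply pow_le; lra). simpl. nra.
    + apply draws_affine_le; [assumption|]. intros y. unfold indicator.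
      destruct excluded_middle_informative as [Hc|_].
      * rewrite Rplus_0_l, Rmult_1_r. apply (IH (S t) _ (L ++ [j])); [lia| | | |].
        -- rewrite length_app; simpl; lia.
        -- apply NoDup_app; [assumption|constructor; [tauto|constructor]|].
           intros a Ha [<-|[]]; tauto.
        -- intros a Ha. apply in_app_or in Ha as [Ha|[<-|[]]]; auto.
        -- intros c Hct. unfold setc. destruct (Nat.eqb_spec (S c) (S t)) as [Heq|Hne].
           ++ rewrite app_nth2 by lia. replace (c - length L)%nat with 0%nat by lia.
              exact Hc.
           ++ rewrite app_nth1 by lia. apply Hclose; lia.
      * rewrite Rmult_0_r, Rplus_0_r.
        pose proof (trial_affine_le M (/ INR m) m V V 0 0 s HMpos
          (fun Q => ltac:(specialize (HV0 Q); lra)) (setc Q (S t) y) (S t)). lra.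
Qed.

Lemma served_cost Q L :
  Permutation L (seq 0 k) ->
  (forall c, (c < k)%nat -> close (nth c L 0%nat) (Q (S c))) ->
  sumR n (fun i => sumR k (fun c => chi (nth c L 0%nat) i * sqdist d (P i) (Q (S c))))
  <= (1 + INR k / INR E) * A.
Proof.
  intros HL Hclose. pose proof E_ge1 as HE. rewrite sumR_swap.
  apply Rle_trans with (sumR k (fun c => spread (nth c L 0%nat) + / INR E * A)).
  - apply sumR_le; intros c Hc.
    assert (Hlc : (nth c L 0 < k)%nat).
    { assert (Hin : In (nth c L 0%nat) (seq 0 k)).
      { apply (Permutation_in _ HL), nth_In.
        apply Permutation_length in HL. rewrite length_seq in HL. lia. }
      apply in_seq in Hin. lia. }
    eapply Rle_trans; [now apply moved_cost|]. specialize (Hclose c Hc).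
    unfold close in Hclose. lra.
  - rewrite sumR_plus, sumR_const, (sumR_permutation k L spread HL).
    replace ((1 + INR k / INR E) * A) with (A + INR k * (/ INR E * A)) by (field; lra).
    lra.
Qed.

End Clusters.

(** The selections made by [choose] define the clusters: each point lies in [l >= 1] of them, and
    passing from the reference centres to the centroids only lowers the cost, so the total spread is
    at most [A]. *)
Lemma trial_approx k l E G M m C A eps Q :
  (1 <= l <= k)%nat -> (k <= E)%nat -> INR k <= eps * INR E ->
  G = (64 * k * E)%nat -> M = (2 * G * n)%nat -> m = (16 * E)%nat -> 0 < A ->
  sumR n (fun i => lnear_cost d k l C (P i)) <= A ->
  ((/ INR (2 * G * (k + 1))) ^ m * / 2) ^ k
  <= trial M (/ INR m) m Q 0 k (fun Q =>
       indicator (sumR n (fun i => lnear_cost d k l (fun c => Q (S c)) (P i)) <= (1 + eps) * A)).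
Proof.
  intros Hl HkE Heps HG HM Hm HA Hcost.
  assert (HE : 1 <= INR E) by (apply (le_INR 1); lia).
  set (ds := fun i => map (fun c => sqdist d (P i) (C c)) (seq 0 k)).
  set (bs := fun i => choose l (ds i)).
  set (chi := fun j i => b2R (nth j (bs i) false)).
  assert (Hds : forall i, length (ds i) = k)
    by (intros; unfold ds; now rewrite length_map, length_seq).
  assert (Hbs : forall i, length (bs i) = k)
    by (intros; unfold bs; now rewrite length_choose).
  assert (Hspec : forall i, ntrue (bs i) = l /\
    sumR k (fun j => chi j i * sqdist d (P i) (C j)) = lnear_cost d k l C (P i)).
  { intros i. destruct (choose_spec (ds i) l) as [H1 H2]; [rewrite Hds; lia|].
    split; [exact H1|]. unfold lnear_cost. fold (ds i). rewrite <- H2. fold (bs i).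
    unfold ds. rewrite <- (Hbs i) at 1 2. rewrite wsum_sumR, Hbs. reflexivity. }
  assert (Hchi : forall j i, 0 <= chi j i <= 1).
  { intros j i. unfold chi, b2R. destruct nth; lra. }
  assert (Hspread : sumR k (fun j => sumR n (fun i =>
      chi j i * sqdist d (P i) (centroid n (chi j) P))) <= A).
  { eapply Rle_trans; [|exact Hcost].
    rewrite (sumR_ext n (fun i => lnear_cost d k l C (P i))
      (fun i => sumR k (fun j => chi j i * sqdist d (P i) (C j))))
      by (intros; now rewrite (proj2 (Hspec i))).
    rewrite (sumR_swap n k). apply sumR_le; intros j Hj.
    assert (Hs : 0 <= sumR n (chi j)) by (apply sumR_nonneg; intros; apply Hchi).
    destruct (Rle_lt_or_eq_dec _ _ Hs) as [Hpos|Hz].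
    - rewrite (sumR_sqdist_centroid n d (chi j) P (C j) Hpos).
      pose proof (sqdist_nonneg d (centroid n (chi j) P) (C j)). nra.
    - right. apply sumR_ext; intros i Hi. replace (chi j i) with 0; [ring|].
      apply Rle_antisym; [apply Hchi|]. rewrite Hz.
      apply (sumR_term_le n (chi j)); [intros; apply Hchi|assumption]. }
  apply (trial_success k E G M m chi A); try assumption; try lia.
  - intros; apply Hchi.
  - intros i Hi. destruct (Hspec i) as [Hnt _].
    assert (Hsum : sumR k (fun j => chi j i) = INR l).
    { rewrite <- Hnt. unfold chi. rewrite <- (Hbs i) at 1. clear.
      induction (bs i) as [|b u IH]; [reflexivity|].
      cbn [length]. rewrite sumR_S_l. cbn [nth]. rewrite IH.
      unfold ntrue. cbn [map list_sum fold_right]. rewrite plus_INR.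
      f_equal. destruct b; reflexivity. }
    rewrite Hsum. apply (le_INR 1); lia.
  - intros Q'. apply indicator_range.
  - intros Q' L HL Hclose. unfold indicator.
    destruct excluded_middle_informative as [|Hno]; [lra|]. exfalso; apply Hno.
    apply Rle_trans with ((1 + INR k / INR E) * A).
    + eapply Rle_trans; [|apply (served_cost k E G M m chi A) with (L := L) (Q := Q');
        try assumption; try lia; intros; apply Hchi].
      apply sumR_le; intros i Hi. unfold chi.
      apply (lnear_cost_permuted d k l (fun c => Q' (S c)) (P i) (bs i) L);
        [apply Hbs|apply Hspec|assumption].
    + apply Rmult_le_compat_r; [lra|]. apply Rplus_le_compat_l.
      apply (Rmult_le_reg_r (INR E)); [lra|].
      replace (INR k / INR E * INR E) with (INR k) by (field; lra). assumption.
Qed.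

End Trial.

(** * The program *)

Section Deterministic.
Variable I : input.
Variable good : (nat -> R) -> Prop.

(** A deterministic command hands the success probability on unchanged; quantifying over it leaves
    an ordinary postcondition. *)
Definition wpd (c : cmd) (t : nat) (m : mem) (Post : mem -> Prop) : Prop :=
  forall v, wp I good c t m (fun m' v' => Post m' /\ v' = v) v.

Lemma wp_of_wpd c t m Post (Phi : assertion) v :
  wpd c t m Post -> (forall m', Post m' -> Phi m' v) -> wp I good c t m Phi v.
Proof.
  intros H HP. apply (wp_weaken _ _ _ t _ _ _ _ _ (H v)); [lia|].
  intros m' v' [Hm ->]. now apply HP.
Qed.

Lemma wpd_weaken c t t' m (Post Post' : mem -> Prop) :
  wpd c t m Post -> (t <= t')%nat -> (forall m', Post m' -> Post' m') -> wpd c t' m Post'.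
Proof.
  intros H Ht HP v. apply (wp_weaken _ _ _ t _ _ _ _ _ (H v) Ht).
  intros m' v' [Hm ->]. auto.
Qed.

Lemma wpd_le c t t' m Post : wpd c t m Post -> (t <= t')%nat -> wpd c t' m Post.
Proof. intros H Ht. now apply (wpd_weaken c t t' m Post). Qed.

Lemma wpd_skip m (Post : mem -> Prop) : Post m -> wpd Skip 0 m Post.
Proof. intros H v. now apply wp_skip. Qed.

Lemma wpd_prim i m (Post : mem -> Prop) :
  is_prim i = true -> Post (exec_mem I i m 0) -> wpd (Prim i) 1 m Post.
Proof. intros Hi H v. now apply wp_prim. Qed.

Lemma wpd_seq c1 c2 t1 t2 m (Mid Post : mem -> Prop) :
  wpd c1 t1 m Mid -> (forall m', Mid m' -> wpd c2 t2 m' Post) ->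
  wpd (Seq c1 c2) (t1 + t2) m Post.
Proof.
  intros H1 H2 v. eapply wp_seq; [apply H1|]. intros m' v' [Hm ->]. now apply H2.
Qed.

Lemma wpd_cons i c t m (Post : mem -> Prop) :
  is_prim i = true -> wpd c t (exec_mem I i m 0) Post -> wpd (Seq (Prim i) c) (S t) m Post.
Proof.
  intros Hi H. apply (wpd_seq _ _ 1 t _ (fun m' => m' = exec_mem I i m 0)).
  - now apply wpd_prim.
  - intros m' ->. exact H.
Qed.

Lemma wp_cons i c t m (Phi : assertion) v :
  is_prim i = true -> wp I good c t (exec_mem I i m 0) Phi v ->
  wp I good (Seq (Prim i) c) (S t) m Phi v.
Proof.
  intros Hi H. apply (wp_seq _ _ _ _ 1 t _ (fun m' v' => m' = exec_mem I i m 0 /\ v' = v)).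
  - now apply wp_prim.
  - intros m' v' [-> ->]. exact H.
Qed.

Lemma wp_seq_wpd c1 c2 t1 t2 m Mid Phi v :
  wpd c1 t1 m Mid -> (forall m', Mid m' -> wp I good c2 t2 m' Phi v) ->
  wp I good (Seq c1 c2) (t1 + t2) m Phi v.
Proof.
  intros H1 H2. eapply wp_seq; [apply H1|]. intros m' v' [Hm ->]. now apply H2.
Qed.

Lemma wpd_ifR x y c1 c2 t1 t2 m Post :
  (snd m x < snd m y -> wpd c1 t1 m Post) -> (snd m y <= snd m x -> wpd c2 t2 m Post) ->
  wpd (IfR x y c1 c2) (2 + (t1 + t2)) m Post.
Proof. intros H1 H2 v. apply wp_ifR; intros H; [exact (H1 H v)|exact (H2 H v)]. Qed.

Lemma wpd_ifN x y c1 c2 t1 t2 m Post :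
  ((fst m x < fst m y)%nat -> wpd c1 t1 m Post) ->
  ((fst m y <= fst m x)%nat -> wpd c2 t2 m Post) ->
  wpd (IfN x y c1 c2) (2 + (t1 + t2)) m Post.
Proof. intros H1 H2 v. apply wp_ifN; intros H; [exact (H1 H v)|exact (H2 H v)]. Qed.

(* Register [N[3]] holds the constant [1]. *)
Definition For (a b : nat) (c : cmd) : cmd :=
  (NConst a 0 ;; While a b (c ;; NAdd a a 3))%cmd.

Lemma wpd_for a b c t L (Inv : nat -> mem -> Prop) m :
  (forall i m', (i <= L)%nat -> Inv i m' -> fst m' a = i /\ fst m' b = L) ->
  (forall i m', (i < L)%nat -> Inv i m' -> wpd c t m' (fun m'' =>
     fst m'' a = i /\ fst m'' 3%nat = 1%nat /\ Inv (S i) (updN (fst m'') a (S i), snd m''))) ->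
  Inv 0%nat (updN (fst m) a 0%nat, snd m) ->
  wpd (For a b c) (L * (t + 3) + 3) m (Inv L).
Proof.
  intros Hab Hbody H0. apply (wpd_weaken _ (S (L * ((t + 1) + 2) + 2)) _ _ (Inv L));
    [|nia|auto].
  apply wpd_cons; [reflexivity|]. intros v.
  apply (wp_while _ _ a b _ (t + 1) L (fun i m' v' => Inv i m' /\ v' = v)).
  - intros i m' v' Hi [HI _]. now apply Hab.
  - intros i m' v' Hi [HI ->]. eapply wp_seq_wpd; [exact (Hbody i m' Hi HI)|].
    intros m'' (Ha & H1 & HI'). apply wp_prim; [reflexivity|]. split; [|reflexivity].
    unfold exec_mem; simpl. rewrite Ha, H1, Nat.add_1_r. exact HI'.
  - split; [exact H0|reflexivity].
Qed.

End Deterministic.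

(** A frame condition. [lo = hi] encodes an empty heap range, which is why side conditions single
    out this case. *)
Definition same (fn fr : list nat) (lo hi : nat) (m m' : mem) : Prop :=
  (forall x, ~ In x fn -> fst m' x = fst m x) /\
  (forall x, ~ In x fr -> (x < lo \/ hi <= x)%nat -> snd m' x = snd m x).

Lemma same_refl fn fr lo hi m : same fn fr lo hi m m.
Proof. split; auto. Qed.

Lemma same_trans fn fr lo hi fn' fr' lo' hi' m m' m'' :
  same fn fr lo hi m m' -> same fn' fr' lo' hi' m' m'' ->
  incl fn' fn -> incl fr' fr -> (lo' = hi' \/ (lo <= lo' /\ hi' <= hi))%nat ->
  same fn fr lo hi m m''.
Proof.
  intros [H1 H2] [H3 H4] Hn Hr Hs. split; intros x Hx.
  - rewrite H3; [now apply H1|]. intros Hi; apply Hx, Hn, Hi.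
  - intros Ho. rewrite H4; [now apply H2| |lia]. intros Hi; apply Hx, Hr, Hi.
Qed.

Lemma same_updN fn fr lo hi m m' a v :
  same fn fr lo hi m m' -> In a fn -> same fn fr lo hi m (updN (fst m') a v, snd m').
Proof.
  intros [H1 H2] Ha. split; [|exact H2]. intros x Hx. simpl. unfold updN.
  destruct (Nat.eqb_spec x a) as [->|]; [contradiction|]. now apply H1.
Qed.

Lemma same_updR fn fr lo hi m m' a v :
  same fn fr lo hi m m' -> (In a fr \/ (lo <= a < hi)%nat) ->
  same fn fr lo hi m (fst m', updR (snd m') a v).
Proof.
  intros [H1 H2] Ha. split; [exact H1|]. intros x Hx Ho. simpl. unfold updR.
  destruct (Nat.eqb_spec x a) as [->|]; [|now apply H2].
  destruct Ha; [contradiction|lia].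
Qed.

Lemma updN_eq f a v : updN f a v a = v.
Proof. unfold updN. now rewrite Nat.eqb_refl. Qed.

Lemma updN_ne f a v x : x <> a -> updN f a v x = f x.
Proof. intros H. unfold updN. now apply Nat.eqb_neq in H as ->. Qed.

Lemma updR_eq f a v : updR f a v a = v.
Proof. unfold updR. now rewrite Nat.eqb_refl. Qed.

Lemma updR_ne f a v x : x <> a -> updR f a v x = f x.
Proof. intros H. unfold updR. now apply Nat.eqb_neq in H as ->. Qed.

Ltac exec := unfold exec_mem; cbn [exec nreg rreg at_pc fst snd].
Ltac upd :=
  repeat match goal with
  | |- context [updN ?f ?a ?v ?a] => rewrite (updN_eq f a v)
  | |- context [updR ?f ?a ?v ?a] => rewrite (updR_eq f a v)
  | |- context [updN ?f ?a ?v ?x] => rewrite (updN_ne f a v x) by lia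
  | |- context [updR ?f ?a ?v ?x] => rewrite (updR_ne f a v x) by lia
  end.
Ltac inl := simpl; tauto.
Ltac frame :=
  repeat first [apply (same_updN _ _ _ _ _ (_, _)); [|inl]
               |apply (same_updR _ _ _ _ _ (_, _)); [|inl]].
Ltac incl_tac := let x := fresh in let H := fresh in intros x H; simpl in H |- *; tauto.

Section Machine.
Variables n d l k M mm hb : nat.
Variable P : nat -> nat -> R.
Variable good : (nat -> R) -> Prop.
Hypothesis Hn : (0 < n)%nat.
Hypothesis Hd : (0 < d)%nat.
Hypothesis Hlk : (l <= k)%nat.
Hypothesis HM : (0 < M)%nat.

Let Inp : input := mkInput n d l P.
(** The real registers [20, .., 20 + k] hold the table of [lsmall] values. From [hb] on there are
    the centres [0, .., k] in blocks of [d] registers, followed by the best solution so far. *)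
Hypothesis Hhb : hb = (21 + k)%nat.

(* Integer registers: 0 = n, 1 = d, 2 = l, 3 = 1, 4 = M, 5 = k d, 15 = 0, and 20 + c is the
   address of the centre c; real registers: 1 = 0, 3 = 1 / mm. *)
Definition consts (m : mem) : Prop :=
  (fst m 0 = n /\ fst m 1 = d /\ fst m 2 = l /\ fst m 3 = 1 /\ fst m 4 = M /\
   fst m 5 = k * d /\ fst m 15 = 0)%nat /\
  (forall c, (c <= k + 1)%nat -> fst m (20 + c)%nat = (hb + c * d)%nat) /\
  snd m 1%nat = 0 /\ snd m 3%nat = / INR mm.

Definition stored (Q : nat -> nat -> R) (t : nat) (m : mem) : Prop :=
  forall c j, (c <= t)%nat -> (j < d)%nat -> snd m (hb + c * d + j)%nat = Q c j.

Definition best (B : nat -> R) (bc : R) (m : mem) : Prop :=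
  (forall x, (x < k * d)%nat -> snd m (hb + (k + 1) * d + x)%nat = B x) /\
  snd m 11%nat = bc.

Lemma same_consts fn fr lo hi m m' :
  same fn fr lo hi m m' -> consts m ->
  (forall x, In x fn -> (6 <= x < 15 \/ 16 <= x < 20)%nat) ->
  (forall x, In x fr -> x <> 1%nat /\ x <> 3%nat) -> (lo = hi \/ 4 <= lo)%nat -> consts m'.
Proof.
  intros [H1 H2] ((C0 & C1 & C2 & C3 & C4 & C5 & C15) & Cb & R1 & R3) Hfn Hfr Hlo.
  unfold consts.
  rewrite !H1, !H2 by (intros Hx; apply Hfn in Hx || apply Hfr in Hx; lia) || lia.
  repeat split; auto. intros c Hc. rewrite H1; [now apply Cb|].
  intros Hx; apply Hfn in Hx; lia.
Qed.

Lemma same_stored fn fr lo hi m m' Q t :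
  same fn fr lo hi m m' -> stored Q t m -> (forall x, In x fr -> (x < 20)%nat) ->
  (lo = hi \/ hi <= hb \/ hb + (t + 1) * d <= lo)%nat -> stored Q t m'.
Proof.
  intros [_ H2] HQ Hfr Hs c j Hc Hj. rewrite H2; [now apply HQ| |].
  - intros Hx; apply Hfr in Hx. lia.
  - assert (c * d + d <= (t + 1) * d)%nat by nia. lia.
Qed.

Lemma same_best fn fr lo hi m m' B bc :
  same fn fr lo hi m m' -> best B bc m -> (forall x, In x fr -> (x < 20)%nat /\ x <> 11%nat) ->
  (lo = hi \/ 12 <= lo /\ hi <= hb + (k + 1) * d)%nat -> best B bc m'.
Proof.
  intros [_ H2] [HB Hc] Hfr Hs. split.
  - intros x Hx. rewrite H2; [now apply HB| |lia].
    intros Hi; apply Hfr in Hi. lia.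
  - rewrite H2; [exact Hc| |lia]. intros Hi; apply Hfr in Hi; lia.
Qed.

(** * Distances, potential and the scan of the weights *)

Definition DIST (c : nat) : cmd :=
  (RAdd 4 1 1 ;;
   For 7 1 (RInput 5 6 7 ;; NAdd 8 (20 + c) 7 ;; RLoad 6 8 ;; RSub 5 5 6 ;;
            RMul 5 5 5 ;; RAdd 4 4 5))%cmd.

Lemma wpd_DIST Q c i m :
  consts m -> (forall j, (j < d)%nat -> snd m (hb + c * d + j)%nat = Q c j) ->
  (c <= k)%nat -> fst m 6%nat = i -> (i < n)%nat ->
  wpd Inp good (DIST c) (13 * d) m (fun m' =>
    same [7; 8]%nat [4; 5; 6]%nat 0 0 m m' /\ snd m' 4%nat = sqdist d (P i) (Q c)).
Proof.
  intros HC HQ Hc Hi Hin.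
  set (Inv := fun j (m' : mem) => same [7; 8]%nat [4; 5; 6]%nat 0 0 m m' /\
    fst m' 7%nat = j /\ snd m' 4%nat = sumR j (fun j => (P i j - Q c j) ^ 2)).
  apply (wpd_weaken _ _ _ (S (d * (6 + 3) + 3)) _ _ (Inv d)); [|lia|].
  2:{ intros m' (H1 & _ & H2). now split. }
  destruct HC as ((C0 & C1 & C2 & C3 & C4 & C5 & C15) & Cb & R1 & R3).
  unfold DIST. apply wpd_cons; [reflexivity|]. apply wpd_for.
  - intros j m' _ ([S1 _] & Hj & _). split; [exact Hj|]. rewrite S1 by (simpl; lia). exact C1.
  - intros j m' Hj (HS & H7 & H4). pose proof HS as [S1 S2].
    assert (E6 : fst m' 6%nat = i) by (rewrite S1 by (simpl; lia); exact Hi).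
    assert (E3 : fst m' 3%nat = 1%nat) by (rewrite S1 by (simpl; lia); exact C3).
    assert (Eb : fst m' (20 + c)%nat = (hb + c * d)%nat)
      by (rewrite S1 by (simpl; lia); apply Cb; lia).
    assert (EQ : snd m' (hb + c * d + j)%nat = Q c j).
    { rewrite S2 by (simpl; lia). now apply HQ. }
    do 5 (apply wpd_cons; [reflexivity|]). apply wpd_prim; [reflexivity|].
    split; [exact H7|split; [exact E3|split; [|split; [reflexivity|]]]].
    + exec. frame. destruct m'; exact HS.
    + exec. upd. rewrite E6, H7, Eb, EQ, H4. cbn [in_n in_d in_P Inp sumR].
      replace (Nat.ltb i n) with true by (symmetry; now apply Nat.ltb_lt).
      replace (Nat.ltb j d) with true by (symmetry; now apply Nat.ltb_lt).
      simpl. ring.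
  - split; [|split; [reflexivity|]].
    + apply same_updN; [|inl]. apply (same_updR _ _ _ _ _ m); [apply same_refl|inl].
    + exec. upd. rewrite R1. simpl. ring.
Qed.

(** The loop over the centres is unrolled, as [t] is known when the program is built. The machine
    has no move instruction: adding real register 1, which is 0, copies a value. *)
Fixpoint D2 (t : nat) : cmd :=
  match t with
  | O => DIST 0 ;; RAdd 7 4 1
  | S t' => D2 t' ;; DIST (S t') ;; IfR 4 7 (RAdd 7 4 1) Skip
  end%cmd.

Lemma wpd_D2 Q t i m :
  consts m -> stored Q t m -> (t <= k)%nat -> fst m 6%nat = i -> (i < n)%nat ->
  wpd Inp good (D2 t) (16 * (t + 1) * d) m (fun m' =>
    same [7; 8]%nat [4; 5; 6; 7]%nat 0 0 m m' /\ snd m' 7%nat = dmin d Q t (P i)).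
Proof.
  intros HC HQ Ht Hi Hin. induction t as [|t IH].
  - apply (wpd_le _ _ _ (13 * d + 1)); [|lia].
    eapply wpd_seq.
    + apply (wpd_DIST Q 0 i); auto.
    + intros m' [HS H4]. apply wpd_prim; [reflexivity|].
      exec. split.
      * apply (same_updR _ _ _ _ _ m'); [|inl].
        apply (same_trans _ _ _ _ _ _ _ _ _ _ _ (same_refl _ _ _ _ _) HS); [incl_tac|incl_tac|lia].
      * upd. rewrite H4. destruct HS as [_ S2].
        rewrite S2 by (simpl; lia). destruct HC as (_ & _ & -> & _). unfold dmin; simpl. ring.
  - apply (wpd_le _ _ _ (16 * (t + 1) * d + (13 * d + (2 + (1 + 0))))); [|lia].
    eapply wpd_seq.
    + apply IH; [|lia]. intros c j Hc Hj. apply HQ; lia.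
    + intros m1 [HS1 H7].
      assert (HC1 : consts m1).
      { apply (same_consts _ _ _ _ _ _ HS1 HC); [..|lia]; intros x Hx; simpl in Hx; lia. }
      assert (HQ1 : stored Q (S t) m1).
      { apply (same_stored _ _ _ _ _ _ _ _ HS1 HQ); [|lia]. intros x Hx; simpl in Hx; lia. }
      eapply wpd_seq.
      * apply (wpd_DIST Q (S t) i); auto.
        rewrite (proj1 HS1) by (simpl; lia). exact Hi.
      * intros m2 [HS2 H4].
        assert (H7' : snd m2 7%nat = dmin d Q t (P i)).
        { rewrite (proj2 HS2) by (simpl; lia). exact H7. }
        assert (HS : same [7; 8]%nat [4; 5; 6; 7]%nat 0 0 m m2).
        { apply (same_trans _ _ _ _ _ _ _ _ _ _ _ HS1 HS2); [incl_tac|incl_tac|lia]. }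
        apply wpd_ifR; rewrite H4, H7'; intros Hcmp.
        -- apply wpd_prim; [reflexivity|]. exec. split.
           ++ apply (same_updR _ _ _ _ _ m2); [exact HS|inl].
           ++ upd. rewrite H4, (proj2 HS2) by (simpl; lia).
              destruct HC1 as (_ & _ & -> & _). unfold dmin in *; simpl.
              destruct Rlt_dec; [ring|lra].
        -- apply wpd_skip. split; [exact HS|]. rewrite H7'.
           unfold dmin in *; simpl. destruct Rlt_dec; [lra|reflexivity].
Qed.

Ltac consts_by HS HC :=
  apply (same_consts _ _ _ _ _ _ HS HC);
  [intros ? Hx; simpl in Hx; lia|intros ? Hx; simpl in Hx; lia|lia].
Ltac stored_by HS HQ :=
  apply (same_stored _ _ _ _ _ _ _ _ HS HQ); [intros ? Hx; simpl in Hx; lia|lia].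
Ltac best_by HS HB :=
  apply (same_best _ _ _ _ _ _ _ _ HS HB); [intros ? Hx; simpl in Hx; lia|nia].
Ltac widen H1 H2 :=
  apply (same_trans _ _ _ _ _ _ _ _ _ _ _ H1 H2); [incl_tac|incl_tac|lia].

Definition TOTAL (t : nat) : cmd := (RAdd 8 1 1 ;; For 6 0 (D2 t ;; RAdd 8 8 7))%cmd.

Lemma wpd_TOTAL Q t m :
  consts m -> stored Q t m -> (t <= k)%nat ->
  wpd Inp good (TOTAL t) (24 * n * (t + 1) * d) m (fun m' =>
    same [6; 7; 8]%nat [4; 5; 6; 7; 8]%nat 0 0 m m' /\ snd m' 8%nat = potential n d P Q t).
Proof.
  intros HC HQ Ht.
  set (Inv := fun i (m' : mem) => same [6; 7; 8]%nat [4; 5; 6; 7; 8]%nat 0 0 m m' /\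
    fst m' 6%nat = i /\ snd m' 8%nat = sumR i (fun i => dmin d Q t (P i))).
  apply (wpd_weaken _ _ _ (S (n * (16 * (t + 1) * d + 1 + 3) + 3)) _ _ (Inv n)); [|nia|].
  2:{ intros m' (H1 & _ & H2). now split. }
  unfold TOTAL. apply wpd_cons; [reflexivity|]. apply wpd_for.
  - intros i m' _ (HS & Hi & _). split; [exact Hi|].
    rewrite (proj1 HS) by (simpl; lia). apply HC.
  - intros i m' Hi (HS & H6 & H8).
    assert (HC' : consts m') by consts_by HS HC.
    assert (HQ' : stored Q t m') by stored_by HS HQ.
    eapply wpd_seq; [now apply (wpd_D2 Q t i)|].
    intros m'' [HS' H7]. apply wpd_prim; [reflexivity|]. exec.
    rewrite !(proj1 HS') by (simpl; lia).
    split; [exact H6|split; [apply HC'|split; [|split; [reflexivity|]]]].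
    + frame. cut (same [6; 7; 8]%nat [4; 5; 6; 7; 8]%nat 0 0 m m''); [now destruct m''|].
      widen HS HS'.
    + exec. upd. rewrite H7, (proj2 HS') by (simpl; lia). now rewrite H8.
  - split; [|split; [reflexivity|]].
    + exec. frame. destruct m; apply same_refl.
    + exec. upd. destruct HC as (_ & _ & -> & _). simpl. ring.
Qed.

Definition SCAN (t : nat) : cmd :=
  (NConst 11 0 ;; For 6 0 (D2 t ;; IfR 9 1 Skip (NAdd 11 6 15 ;; RSub 9 9 7)))%cmd.

Lemma wpd_SCAN Q t m :
  consts m -> stored Q t m -> (t <= k)%nat ->
  wpd Inp good (SCAN t) (28 * n * (t + 1) * d) m (fun m' =>
    same [6; 7; 8; 11]%nat [4; 5; 6; 7; 9]%nat 0 0 m m' /\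
    fst m' 11%nat = fst (scan (fun i => dmin d Q t (P i)) n (snd m 9%nat))).
Proof.
  intros HC HQ Ht. set (w := fun i => dmin d Q t (P i)). set (u := snd m 9%nat).
  set (Inv := fun i (m' : mem) =>
    same [6; 7; 8; 11]%nat [4; 5; 6; 7; 9]%nat 0 0 m m' /\ fst m' 6%nat = i /\
    fst m' 11%nat = fst (scan w i u) /\ snd m' 9%nat = snd (scan w i u)).
  apply (wpd_weaken _ _ _ (S (n * (16 * (t + 1) * d + (2 + (0 + 2)) + 3) + 3)) _ _ (Inv n));
    [|nia|].
  2:{ intros m' (H1 & _ & H2 & _). now split. }
  unfold SCAN. apply wpd_cons; [reflexivity|]. apply wpd_for.
  - intros i m' _ (HS & Hi & _). split; [exact Hi|].
    rewrite (proj1 HS) by (simpl; lia). apply HC.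
  - intros i m' Hi (HS & H6 & H11 & H9).
    assert (HC' : consts m') by consts_by HS HC.
    assert (HQ' : stored Q t m') by stored_by HS HQ.
    eapply wpd_seq; [now apply (wpd_D2 Q t i)|].
    intros m'' [HS' H7].
    assert (HC'' : consts m'') by consts_by HS' HC'.
    assert (H6' : fst m'' 6%nat = i) by (rewrite (proj1 HS') by (simpl; lia); exact H6).
    assert (H11' : fst m'' 11%nat = fst (scan w i u))
      by (rewrite (proj1 HS') by (simpl; lia); exact H11).
    assert (H9' : snd m'' 9%nat = snd (scan w i u))
      by (rewrite (proj2 HS') by (simpl; lia); exact H9).
    assert (HS2 : same [6; 7; 8; 11]%nat [4; 5; 6; 7; 9]%nat 0 0 m m'') by widen HS HS'.
    destruct HC'' as ((_ & _ & _ & C3 & _ & _ & C15) & _ & R1 & _).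
    apply wpd_ifR; rewrite H9', R1; intros Hcmp.
    + apply wpd_skip. split; [exact H6'|split; [exact C3|split; [|split; [reflexivity|]]]].
      * apply same_updN; [exact HS2|inl].
      * exec. upd. cbn [scan]. destruct Rlt_dec; [|lra]. now split.
    + apply wpd_cons; [reflexivity|]. apply wpd_prim; [reflexivity|]. exec. upd.
      split; [exact H6'|split; [exact C3|split; [|split; [reflexivity|]]]].
      * frame. destruct m''; exact HS2.
      * exec. upd. cbn [scan]. destruct Rlt_dec; [lra|]. cbn [fst snd].
        rewrite H6', C15, H9', H7. split; [lia|reflexivity].
  - split; [|split; [reflexivity|split; reflexivity]].
    exec. frame. destruct m; apply same_refl.
Qed.

(** Guarantees that [RInput] reads a point and not its default value 0. *)
Lemma scan_lt w q u : (0 < q)%nat -> (fst (scan w q u) < q)%nat.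
Proof.
  induction q as [|q IH]; intros Hq; [lia|]. cbn [scan]. destruct Rlt_dec; simpl; [|lia].
  destruct q; [simpl; lia|]. specialize (IH ltac:(lia)). lia.
Qed.

(** [fetch] leaves one coordinate of the drawn vector in real register 5. Dividing by [mm] before
    adding makes the block of centre [t + 1] the mean once all draws are made. *)
Definition GATHER (t : nat) (fetch : cmd) : cmd :=
  (For 7 1 (fetch ;; RMul 5 5 3 ;; NAdd 8 (20 + S t) 7 ;; RLoad 6 8 ;; RAdd 6 6 5 ;;
            RStore 8 6))%cmd.

Lemma wpd_GATHER fetch tf t y z m :
  consts m -> (t < k)%nat ->
  (forall j, (j < d)%nat -> snd m (hb + S t * d + j)%nat = y j) ->
  (forall m' j, (j < d)%nat ->
     same [7; 8]%nat [5; 6]%nat (hb + S t * d) (hb + S t * d + d) m m' ->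
     fst m' 7%nat = j ->
     wpd Inp good fetch tf m' (fun m'' =>
       same [8]%nat [5]%nat 0 0 m' m'' /\ snd m'' 5%nat = z j)) ->
  wpd Inp good (GATHER t fetch) (d * (tf + 5 + 3) + 3) m (fun m' =>
    same [7; 8]%nat [5; 6]%nat (hb + S t * d) (hb + S t * d + d) m m' /\
    forall j, (j < d)%nat -> snd m' (hb + S t * d + j)%nat = y j + z j * / INR mm).
Proof.
  intros HC Ht Hy Hfetch. set (a := (hb + S t * d)%nat) in *.
  set (Inv := fun j (m' : mem) =>
    same [7; 8]%nat [5; 6]%nat a (a + d) m m' /\ fst m' 7%nat = j /\
    (forall x, (x < d)%nat ->
      snd m' (a + x)%nat = if Nat.ltb x j then y x + z x * / INR mm else y x)).
  apply (wpd_weaken _ _ _ (d * (tf + 5 + 3) + 3) _ _ (Inv d)); [|lia|].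
  2:{ intros m' (H1 & _ & H2). split; [exact H1|]. intros j Hj. rewrite H2 by assumption.
      apply Nat.ltb_lt in Hj as ->. reflexivity. }
  apply wpd_for.
  - intros j m' _ (HS & Hj & _). split; [exact Hj|].
    rewrite (proj1 HS) by (simpl; lia). apply HC.
  - intros j m' Hj (HS & H7 & Hheap). eapply wpd_seq; [exact (Hfetch m' j Hj HS H7)|].
    intros m'' [HS' H5].
    assert (HS2 : same [7; 8]%nat [5; 6]%nat a (a + d) m m'') by widen HS HS'.
    assert (HC' : consts m'') by consts_by HS2 HC.
    assert (H7' : fst m'' 7%nat = j) by (rewrite (proj1 HS') by (simpl; lia); exact H7).
    assert (Hheap' : forall x, (x < d)%nat ->
      snd m'' (a + x)%nat = if Nat.ltb x j then y x + z x * / INR mm else y x).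
    { intros x Hx. rewrite (proj2 HS') by (simpl; lia). now apply Hheap. }
    destruct HC' as ((_ & _ & _ & C3 & _) & Cb & _ & R3).
    specialize (Cb (S t) ltac:(lia)). fold a in Cb.
    do 4 (apply wpd_cons; [reflexivity|]). apply wpd_prim; [reflexivity|]. exec. upd.
    split; [exact H7'|split; [exact C3|split; [|split; [reflexivity|]]]].
    + rewrite Cb, H7'. repeat first [apply (same_updN _ _ _ _ _ (_, _)); [|inl]
        |apply (same_updR _ _ _ _ _ (_, _)); [|simpl; lia]]. destruct m''; exact HS2.
    + intros x Hx. exec. rewrite Cb, H7'. destruct (Nat.eq_dec x j) as [->|Hne].
      * upd. rewrite Hheap' by assumption. rewrite Nat.ltb_irrefl, H5, R3.
        replace (Nat.ltb j (S j)) with true by (symmetry; apply Nat.ltb_lt; lia). ring.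
      * upd. rewrite Hheap' by assumption.
        destruct (Nat.ltb_spec x j), (Nat.ltb_spec x (S j)); lia || reflexivity.
  - split; [|split; [reflexivity|]].
    + apply same_updN; [apply same_refl|inl].
    + intros x Hx. cbn [fst snd Nat.ltb]. now apply Hy.
Qed.

(** Invariant between two draws: the partial mean [y] occupies the block of centre [t + 1], while
    distances refer to the centres up to [t] only. Real register 12 is the grid step. *)
Definition drawing (Q : nat -> nat -> R) (t : nat) (B : nat -> R) (bc : R) (y : nat -> R)
  (m : mem) : Prop :=
  consts m /\ stored (setc Q (S t) y) (S t) m /\ best B bc m /\
  snd m 12%nat = potential n d P Q t / INR M /\
  fst m 16%nat = (t + 2)%nat /\ fst m 17%nat = (t + 1)%nat.

Lemma stored_setc Q t y m :
  stored Q t m -> (forall j, (j < d)%nat -> snd m (hb + S t * d + j)%nat = y j) ->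
  stored (setc Q (S t) y) (S t) m.
Proof.
  intros HQ Hy c j Hc Hj. unfold setc. destruct (Nat.eqb_spec c (S t)) as [->|Hne].
  - now apply Hy.
  - apply HQ; lia.
Qed.

Lemma stored_setc_inv Q t y m :
  stored (setc Q (S t) y) (S t) m ->
  stored Q t m /\ forall j, (j < d)%nat -> snd m (hb + S t * d + j)%nat = y j.
Proof.
  intros H. split.
  - intros c j Hc Hj. rewrite (H c j) by lia. unfold setc.
    destruct (Nat.eqb_spec c (S t)); [lia|reflexivity].
  - intros j Hj. rewrite (H (S t) j) by lia. unfold setc. now rewrite Nat.eqb_refl.
Qed.

Definition ADD_PICK (t : nat) : cmd :=
  (RofN 9 10 ;; RMul 9 9 12 ;; SCAN t ;;
   IfN 9 17
     (NConst 8 20 ;; NAdd 8 8 9 ;; NLoad 14 8 ;; GATHER t (NAdd 8 14 7 ;; RLoad 5 8))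
     (GATHER t (RInput 5 11 7)))%cmd.

Lemma wpd_ADD_PICK Q t B bc y q r m :
  drawing Q t B bc y m -> (t < k)%nat -> fst m 9%nat = q -> fst m 10%nat = r ->
  wpd Inp good (ADD_PICK t) (60 * n * k * d) m
    (drawing Q t B bc (fun x => y x + pick n d P M Q t q r x * / INR mm)).
Proof.
  intros (HC & HQy & HB & H12 & H16 & H17) Ht H9 H10.
  destruct (stored_setc_inv _ _ _ _ HQy) as [HQ Hy].
  apply (wpd_le _ _ _ (S (S (28 * n * (t + 1) * d +
    (2 + (S (S (S (d * (2 + 5 + 3) + 3))) + (d * (1 + 5 + 3) + 3))))))).
  2:{ assert (28 * n * (t + 1) * d <= 28 * n * k * d)%nat by nia.
      assert (d <= n * k * d)%nat by nia. nia. }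
  unfold ADD_PICK. do 2 (apply wpd_cons; [reflexivity|]).
  set (m1 := exec_mem _ _ (exec_mem _ _ m 0) 0).
  assert (HS1 : same [6; 7; 8; 11]%nat [4; 5; 6; 7; 9]%nat 0 0 m m1).
  { unfold m1. exec. frame. destruct m; apply same_refl. }
  assert (Hu : snd m1 9%nat = INR r * (potential n d P Q t / INR M)).
  { unfold m1. exec. upd. now rewrite H10, H12. }
  assert (HC1 : consts m1) by consts_by HS1 HC.
  assert (HQ1 : stored Q t m1) by stored_by HS1 HQ.
  clearbody m1. eapply wpd_seq; [apply (wpd_SCAN Q t); auto; lia|].
  intros m2 [HS2' H11]. rewrite Hu in H11.
  assert (HS2 : same [6; 7; 8; 11]%nat [4; 5; 6; 7; 9]%nat 0 0 m m2) by widen HS1 HS2'.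
  assert (HC2 : consts m2) by consts_by HS2 HC.
  assert (HQ2 : stored Q t m2) by stored_by HS2 HQ.
  assert (Hy2 : forall j, (j < d)%nat -> snd m2 (hb + S t * d + j)%nat = y j).
  { intros j Hj. rewrite (proj2 HS2) by (simpl; lia). now apply Hy. }
  set (v := pick n d P M Q t q r).
  assert (Hend : forall m3, same [7; 8; 14]%nat [5; 6]%nat
      (hb + S t * d) (hb + S t * d + d) m2 m3 ->
    (forall j, (j < d)%nat -> snd m3 (hb + S t * d + j)%nat = y j + v j * / INR mm) ->
    drawing Q t B bc (fun x => y x + v x * / INR mm) m3).
  { intros m3 HS3' Hy3.
    assert (HS3 : same [6; 7; 8; 11; 14]%nat [4; 5; 6; 7; 9]%nat
      (hb + S t * d) (hb + S t * d + d) m m3).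
    { apply (same_trans _ _ _ _ _ _ _ _ _ m2 _) with (2 := HS3');
        [|incl_tac|incl_tac|lia].
      apply (same_trans _ _ _ _ _ _ _ _ _ _ _ (same_refl _ _ _ _ _) HS2);
        [incl_tac|incl_tac|lia]. }
    assert (HQ3 : stored Q t m3).
    { apply (same_stored _ _ _ _ _ _ _ _ HS3 HQ); [intros ? Hx; simpl in Hx; lia|nia]. }
    repeat split.
    all: try (apply (same_consts _ _ _ _ _ _ HS3 HC);
      [intros ? Hx; simpl in Hx; lia|intros ? Hx; simpl in Hx; lia|lia]).
    - now apply stored_setc.
    - apply (same_best _ _ _ _ _ _ _ _ HS3 HB); [intros ? Hx; simpl in Hx; lia|nia].
    - apply (same_best _ _ _ _ _ _ _ _ HS3 HB); [intros ? Hx; simpl in Hx; lia|nia].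
    - rewrite (proj2 HS3) by (simpl; lia). exact H12.
    - rewrite (proj1 HS3) by (simpl; lia). exact H16.
    - rewrite (proj1 HS3) by (simpl; lia). exact H17. }
  assert (E9 : fst m2 9%nat = q) by (rewrite (proj1 HS2) by (simpl; lia); exact H9).
  assert (E17 : fst m2 17%nat = (t + 1)%nat)
    by (rewrite (proj1 HS2) by (simpl; lia); exact H17).
  apply wpd_ifN; rewrite E9, E17; intros Hq.
  - assert (Hv : v = Q q).
    { unfold v, pick. now apply Nat.ltb_lt in Hq as ->. }
    do 3 (apply wpd_cons; [reflexivity|]).
    set (m3 := exec_mem _ _ (exec_mem _ _ (exec_mem _ _ m2 0) 0) 0).
    assert (HS3 : same [7; 8; 14]%nat [5; 6]%nat 0 0 m2 m3).
    { unfold m3. exec. frame. destruct m2; apply same_refl. }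
    assert (H14 : fst m3 14%nat = (hb + q * d)%nat).
    { unfold m3. exec. upd. rewrite E9. upd. apply HC2; lia. }
    assert (HC3 : consts m3) by consts_by HS3 HC2.
    assert (HQ3 : stored Q t m3) by stored_by HS3 HQ2.
    clearbody m3.
    eapply wpd_weaken; [apply (wpd_GATHER _ 2 t y v m3 HC3 Ht)|apply le_n|].
    + intros j Hj. rewrite (proj2 HS3) by (simpl; lia). now apply Hy2.
    + intros m' j Hj HS' H7. apply wpd_cons; [reflexivity|]. apply wpd_prim; [reflexivity|].
      exec. split.
      * frame. destruct m'; apply same_refl.
      * upd. rewrite H7, (proj1 HS'), H14 by (simpl; lia).
        rewrite (proj2 HS') by (simpl; try lia; nia). rewrite Hv. apply HQ3; lia.
    + intros m4 [HS4 Hy4]. apply Hend; [|exact Hy4].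
      apply (same_trans _ _ _ _ _ _ _ _ _ m3 _) with (2 := HS4); [|incl_tac|incl_tac|lia].
      apply (same_trans _ _ _ _ _ _ _ _ _ _ _ (same_refl _ _ _ _ _) HS3);
        [incl_tac|incl_tac|lia].
  - assert (Hv : v = P (fst m2 11%nat)).
    { unfold v, pick. rewrite H11. now apply Nat.ltb_ge in Hq as ->. }
    eapply wpd_weaken; [apply (wpd_GATHER _ 1 t y v m2 HC2 Ht Hy2)|apply le_n|].
    + intros m' j Hj HS' H7. apply wpd_prim; [reflexivity|].
      exec. split.
      * frame. destruct m'; apply same_refl.
      * upd. rewrite H7, (proj1 HS') by (simpl; lia). cbn [in_n in_d in_P Inp].
        rewrite Hv. apply Nat.ltb_lt in Hj as ->.
        pose proof (scan_lt (fun i => dmin d Q t (P i)) n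
          (INR r * (potential n d P Q t / INR M)) Hn) as Hlt.
        rewrite <- H11 in Hlt. apply Nat.ltb_lt in Hlt as ->. reflexivity.
    + intros m4 [HS4 Hy4]. apply Hend; [|exact Hy4].
      apply (same_trans _ _ _ _ _ _ _ _ _ _ _ (same_refl _ _ _ _ _) HS4);
        [incl_tac|incl_tac|lia].
Qed.

Definition DRAW (t : nat) : cmd := (NRand 9 16 ;; NRand 10 4 ;; ADD_PICK t)%cmd.

Lemma wp_DRAW Q t B bc y m (Phi : assertion) V :
  drawing Q t B bc y m -> (t < k)%nat ->
  (forall y' m', drawing Q t B bc y' m' -> Phi m' (V y')) ->
  wp Inp good (DRAW t) (62 * n * k * d) m Phi
    (avg (t + 2) (fun q => avg M (fun r =>
       V (fun x => y x + pick n d P M Q t q r x * / INR mm)))).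
Proof.
  intros HD Ht HPhi. pose proof HD as (HC & HQ & HB & H12 & H16 & H17).
  apply (wp_weaken _ _ _ (1 + (1 + 60 * n * k * d)) _ _ Phi _ _); [| |auto].
  2:{ assert (0 < n * k * d)%nat by (repeat apply Nat.mul_pos_pos; lia). nia. }
  unfold DRAW. eapply wp_seq.
  - rewrite <- H16. apply (wp_rand _ _ _ _ _ (fun m' v' => exists q,
      m' = (updN (fst m) 9 q, snd m) /\ v' = avg M (fun r =>
         V (fun x => y x + pick n d P M Q t q r x * / INR mm)))); [lia|].
    intros q Hq. exists q; split; reflexivity.
  - intros m1 v1 (q & -> & ->). eapply wp_seq.
    + assert (H4 : fst (updN (fst m) 9 q, snd m) 4%nat = M)
        by (exec; upd; apply HC).
      rewrite <- H4 at 1. apply (wp_rand _ _ _ _ _ (fun m' v' => exists r,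
        m' = (updN (updN (fst m) 9 q) 10 r, snd m) /\
        v' = V (fun x => y x + pick n d P M Q t q r x * / INR mm))); [lia|].
      intros r Hr. exists r; split; reflexivity.
    + intros m2 v2 (r & -> & ->).
      set (m2 := (updN (updN (fst m) 9 q) 10 r, snd m)).
      assert (HS : same [9; 10]%nat [] 0 0 m m2).
      { unfold m2. frame. destruct m; apply same_refl. }
      eapply wp_of_wpd; [apply (wpd_ADD_PICK Q t B bc y q r)|].
      * repeat split; try (consts_by HS HC); try (best_by HS HB).
        -- stored_by HS HQ.
        -- rewrite (proj2 HS) by (simpl; lia). exact H12.
        -- rewrite (proj1 HS) by (simpl; lia). exact H16.
        -- rewrite (proj1 HS) by (simpl; lia). exact H17.
      * assumption.
      * unfold m2. exec. now upd.
      * unfold m2. exec. now upd.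
      * intros m' Hm'. now apply HPhi.
Qed.

(** Unrolled repetition: all counts for which it is used depend on [k] and [E] alone, so the program
    stays independent of the input. *)
Fixpoint REPEAT (j : nat) (c : cmd) : cmd :=
  match j with
  | O => Skip
  | S j' => c ;; REPEAT j' c
  end%cmd.

Lemma wp_DRAWS Q t B bc (Phi : assertion) V j : (t < k)%nat ->
  (forall y' m', drawing Q t B bc y' m' -> Phi m' (V y')) ->
  forall y m, drawing Q t B bc y m ->
  wp Inp good (REPEAT j (DRAW t)) (j * (62 * n * k * d)) m Phi
    (draws n d P M (/ INR mm) Q t j y V).
Proof.
  intros Ht HPhi. induction j as [|j IH]; intros y m HD; cbn [REPEAT draws].
  - apply wp_skip. now apply HPhi.
  - change (S j * (62 * n * k * d))%nat with (62 * n * k * d + j * (62 * n * k * d))%nat.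
    eapply wp_seq.
    + apply (wp_DRAW Q t B bc y m (fun m' v' => exists y', drawing Q t B bc y' m' /\
        v' = draws n d P M (/ INR mm) Q t j y' V) (fun y' =>
        draws n d P M (/ INR mm) Q t j y' V) HD Ht).
      intros y' m' HD'. now exists y'.
    + intros m' v' (y' & HD' & ->). now apply IH.
Qed.

(** * Steps and trials *)

Definition ZERO (t : nat) : cmd := (For 7 1 (NAdd 8 (20 + S t) 7 ;; RStore 8 1))%cmd.

Lemma wpd_ZERO t m :
  consts m -> (t < k)%nat ->
  wpd Inp good (ZERO t) (8 * d) m (fun m' =>
    same [7; 8]%nat [] (hb + S t * d) (hb + S t * d + d) m m' /\
    forall j, (j < d)%nat -> snd m' (hb + S t * d + j)%nat = 0).
Proof.
  intros HC Ht. set (a := (hb + S t * d)%nat).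
  set (Inv := fun j (m' : mem) => same [7; 8]%nat [] a (a + d) m m' /\
    fst m' 7%nat = j /\ forall x, (x < j)%nat -> snd m' (a + x)%nat = 0).
  apply (wpd_weaken _ _ _ (d * (2 + 3) + 3) _ _ (Inv d)); [|lia|].
  2:{ intros m' (H1 & _ & H2). now split. }
  apply wpd_for.
  - intros j m' _ (HS & Hj & _). split; [exact Hj|].
    rewrite (proj1 HS) by (simpl; lia). apply HC.
  - intros j m' Hj (HS & H7 & Hz). apply wpd_cons; [reflexivity|].
    apply wpd_prim; [reflexivity|].
    assert (HC' : consts m') by consts_by HS HC.
    destruct HC' as ((_ & _ & _ & C3 & _) & Cb & R1 & _).
    specialize (Cb (S t) ltac:(lia)). fold a in Cb. exec. upd.
    split; [exact H7|split; [exact C3|split; [|split; [reflexivity|]]]].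
    + rewrite Cb, H7. repeat first [apply (same_updN _ _ _ _ _ (_, _)); [|inl]
        |apply (same_updR _ _ _ _ _ (_, _)); [|simpl; lia]]. destruct m'; exact HS.
    + intros x Hx. exec. rewrite Cb, H7, R1. destruct (Nat.eq_dec x j) as [->|Hne]; upd.
      * reflexivity.
      * apply Hz; lia.
  - split; [|split; [reflexivity|intros; lia]].
    apply same_updN; [apply same_refl|inl].
Qed.

Definition STEP (t : nat) : cmd :=
  (ZERO t ;; TOTAL t ;; RofN 12 4 ;; RDiv 12 8 12 ;; NConst 16 (t + 2) ;;
   NConst 17 (t + 1) ;; REPEAT mm (DRAW t))%cmd.

Lemma wp_STEP Q t B bc m (Phi : assertion) V :
  consts m -> stored Q t m -> best B bc m -> (t < k)%nat ->
  (forall y' m', consts m' -> stored (setc Q (S t) y') (S t) m' -> best B bc m' ->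
     Phi m' (V y')) ->
  wp Inp good (STEP t) (62 * (mm + 1) * n * k * d) m Phi
    (draws n d P M (/ INR mm) Q t mm (fun _ => 0) V).
Proof.
  intros HC HQ HB Ht HPhi.
  apply (wp_weaken _ _ _ (8 * d + (24 * n * (t + 1) * d +
    (S (S (S (S (mm * (62 * n * k * d)))))))) _ _ Phi _ _); [| |auto].
  2:{ assert (24 * n * (t + 1) * d <= 24 * n * k * d)%nat by nia.
      assert (d <= n * k * d)%nat by nia. nia. }
  unfold STEP. eapply wp_seq_wpd; [now apply wpd_ZERO|]. intros m1 [HS1 Hz].
  assert (HC1 : consts m1) by consts_by HS1 HC.
  assert (HQ1 : stored Q t m1).
  { apply (same_stored _ _ _ _ _ _ _ _ HS1 HQ); [intros ? Hx; simpl in Hx; lia|nia]. }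
  assert (HB1 : best B bc m1) by best_by HS1 HB.
  eapply wp_seq_wpd; [apply (wpd_TOTAL Q t); auto; lia|]. intros m2 [HS2 H8].
  assert (HC2 : consts m2) by consts_by HS2 HC1.
  assert (HQ2 : stored Q t m2) by stored_by HS2 HQ1.
  assert (HB2 : best B bc m2) by best_by HS2 HB1.
  assert (Hz2 : forall j, (j < d)%nat -> snd m2 (hb + S t * d + j)%nat = 0).
  { intros j Hj. rewrite (proj2 HS2) by (simpl; lia). now apply Hz. }
  do 4 (apply wp_cons; [reflexivity|]).
  match goal with |- wp _ _ _ _ ?x _ _ => set (m3 := x) end.
  assert (HS3 : same [16; 17]%nat [12]%nat 0 0 m2 m3).
  { unfold m3. exec. frame. destruct m2; apply same_refl. }
  apply (wp_DRAWS Q t B bc Phi V mm Ht).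
  - intros y' m' (HC' & HQ' & HB' & _). now apply HPhi.
  - split; [consts_by HS3 HC2|split; [|split; [best_by HS3 HB2|]]].
    + apply stored_setc; [stored_by HS3 HQ2|].
      intros j Hj. rewrite (proj2 HS3) by (simpl; lia). now apply Hz2.
    + destruct HC2 as ((_ & _ & _ & _ & C4 & _) & _).
      unfold m3. exec. upd. rewrite H8, C4. now repeat split.
Qed.

Fixpoint TRIAL (t s : nat) : cmd :=
  match s with
  | O => Skip
  | S s' => STEP t ;; TRIAL (S t) s'
  end%cmd.

Lemma wp_TRIAL B bc (Phi : assertion) V s :
  (forall Q' m', consts m' -> stored Q' k m' -> best B bc m' -> Phi m' (V Q')) ->
  forall t Q m, (t + s = k)%nat -> consts m -> stored Q t m -> best B bc m ->
  wp Inp good (TRIAL t s) (s * (62 * (mm + 1) * n * k * d)) m Phi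
    (trial n d P M (/ INR mm) mm Q t s V).
Proof.
  intros HPhi. induction s as [|s IH]; intros t Q m Hts HC HQ HB; cbn [TRIAL trial].
  - apply wp_skip. apply HPhi; try assumption. now replace k with t by lia.
  - change (S s * (62 * (mm + 1) * n * k * d))%nat
      with (62 * (mm + 1) * n * k * d + s * (62 * (mm + 1) * n * k * d))%nat.
    eapply wp_seq.
    + apply (wp_STEP Q t B bc m (fun m' v' => exists y', consts m' /\
        stored (setc Q (S t) y') (S t) m' /\ best B bc m' /\
        v' = trial n d P M (/ INR mm) mm (setc Q (S t) y') (S t) s V)
        (fun y' => trial n d P M (/ INR mm) mm (setc Q (S t) y') (S t) s V));
        try assumption; [lia|].
      intros y' m' H1 H2 H3. now exists y'.
    + intros m' v' (y' & H1 & H2 & H3 & ->). apply IH; auto; lia.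
Qed.

(* After the squared distances [xs] have been processed, the register [20 + t] contains
   [lsmall t xs] for each [t <= length xs]. *)
Fixpoint LOWER (e : nat) : cmd :=
  match e with
  | O => Skip
  | S e' => RAdd 5 (20 + e') 4 ;; IfR 5 (20 + e) (RAdd (20 + e) 5 1) Skip ;; LOWER e'
  end%cmd.

Definition dp (xs : list R) (m : mem) : Prop :=
  forall t, (t <= length xs)%nat -> snd m (20 + t)%nat = lsmall t xs.

Lemma lsmall_full x xs : lsmall (S (length xs)) (x :: xs) = x + lsmall (length xs) xs.
Proof. cbn [lsmall]. now rewrite (proj2 (Nat.ltb_lt _ _) (Nat.lt_succ_diag_r _)). Qed.

Lemma lsmall_step t x xs : (t < length xs)%nat ->
  lsmall (S t) (x :: xs) = Rmin (x + lsmall t xs) (lsmall (S t) xs).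
Proof.
  intros H. cbn [lsmall]. replace (Nat.ltb (length xs) (S t)) with false; [reflexivity|].
  symmetry; apply Nat.ltb_ge; lia.
Qed.

(** The table is updated in place from the top down, so that the entry below is still the old one
    when it is read: entries up to [e] belong to [xs], those above already to [x :: xs]. *)
Lemma wpd_LOWER x xs e : (e <= length xs)%nat -> forall m,
  snd m 1%nat = 0 -> snd m 4%nat = x ->
  (forall t, (t <= e)%nat -> snd m (20 + t)%nat = lsmall t xs) ->
  (forall t, (e < t <= S (length xs))%nat -> snd m (20 + t)%nat = lsmall t (x :: xs)) ->
  wpd Inp good (LOWER e) (4 * e) m (fun m' =>
    same [] [5]%nat 20 (20 + S (length xs)) m m' /\ dp (x :: xs) m').
Proof.
  induction e as [|e IH]; intros He m R1 H4 Hlow Hhigh; cbn [LOWER].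
  - apply wpd_skip. split; [apply same_refl|]. intros t Ht. destruct t as [|t].
    + rewrite Hlow by lia. now destruct xs.
    + apply Hhigh. simpl in Ht; lia.
  - apply (wpd_le _ _ _ (S ((2 + (1 + 0)) + 4 * e))); [|lia].
    apply wpd_cons; [reflexivity|].
    set (m1 := exec_mem _ _ m 0).
    assert (HS1 : same [] [5]%nat 20 (20 + S (length xs)) m m1).
    { unfold m1. exec. frame. destruct m; apply same_refl. }
    assert (H5 : snd m1 5%nat = x + lsmall e xs).
    { unfold m1. exec. upd. rewrite H4, Hlow by lia. ring. }
    assert (Hlow1 : forall t, (t <= S e)%nat -> snd m1 (20 + t)%nat = lsmall t xs).
    { intros t Ht. unfold m1. exec. upd. now apply Hlow. }
    assert (Hhigh1 : forall t, (S e < t <= S (length xs))%nat ->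
      snd m1 (20 + t)%nat = lsmall t (x :: xs)).
    { intros t Ht. unfold m1. exec. upd. now apply Hhigh. }
    assert (H41 : snd m1 4%nat = x) by (unfold m1; exec; now upd).
    assert (R11 : snd m1 1%nat = 0) by (unfold m1; exec; now upd).
    clearbody m1.
    apply (wpd_seq _ _ _ _ _ _ _ (fun m2 =>
      same [] [5]%nat 20 (20 + S (length xs)) m m2 /\
      snd m2 1%nat = 0 /\ snd m2 4%nat = x /\
      (forall t, (t <= e)%nat -> snd m2 (20 + t)%nat = lsmall t xs) /\
      (forall t, (e < t <= S (length xs))%nat ->
        snd m2 (20 + t)%nat = lsmall t (x :: xs)))).
    + pose proof (lsmall_step e x xs ltac:(lia)) as Hstep.
      apply wpd_ifR; rewrite H5, Hlow1 by lia; intros Hcmp.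
      * apply wpd_prim; [reflexivity|]. exec. split; [|repeat split].
        -- apply (same_updR _ _ _ _ _ m1); [exact HS1|right; lia].
        -- now upd.
        -- now upd.
        -- intros t Ht. upd. apply Hlow1; lia.
        -- intros t Ht. destruct (Nat.eq_dec t (S e)) as [->|]; upd.
           ++ rewrite Hstep, H5, R11, Rmin_left; lra.
           ++ apply Hhigh1; lia.
      * apply wpd_skip. split; [exact HS1|repeat split; auto].
        intros t Ht. destruct (Nat.eq_dec t (S e)) as [->|].
        -- rewrite Hstep, Hlow1, Rmin_right by (lia || lra). reflexivity.
        -- apply Hhigh1; lia.
    + intros m2 (HS2 & R12 & H42 & Hlow2 & Hhigh2).
      eapply wpd_weaken; [apply IH; auto; lia|apply le_n|].
      intros m3 [HS3 Hdp]. split; [|exact Hdp]. widen HS2 HS3.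
Qed.

(* The centre [c] of the solution is the centre [c + 1] of the trial. *)
Fixpoint NEAREST (e : nat) : cmd :=
  match e with
  | O => Skip
  | S e' => NEAREST e' ;; DIST (k - e') ;; RAdd (20 + e) (20 + e') 4 ;; LOWER e'
  end%cmd.

(** Centres are processed from the last to the first, because [lsmall] recurses on the head of the
    list. The entry for the full length has no competitor and is written before [LOWER] runs. *)
Lemma wpd_NEAREST Q i m e :
  consts m -> stored Q k m -> fst m 6%nat = i -> (i < n)%nat ->
  snd m 20%nat = 0 -> (e <= k)%nat ->
  wpd Inp good (NEAREST e) (e * (18 * k * d)) m (fun m' =>
    same [7; 8]%nat [4; 5; 6]%nat 20 hb m m' /\
    dp (map (fun c => sqdist d (P i) (Q (S c))) (seq (k - e) e)) m').
Proof.
  intros HC HQ H6 Hi H20. induction e as [|e IH]; intros He; cbn [NEAREST].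
  - apply wpd_skip. split; [apply same_refl|]. intros t Ht. simpl in Ht.
    replace t with 0%nat by lia. exact H20.
  - apply (wpd_le _ _ _ (e * (18 * k * d) + (13 * d + (S (4 * e))))); [|nia].
    eapply wpd_seq; [apply IH; lia|]. intros m1 [HS1 Hdp1].
    set (xs := map (fun c => sqdist d (P i) (Q (S c))) (seq (k - e) e)) in *.
    assert (Hlen : length xs = e) by (unfold xs; now rewrite length_map, length_seq).
    assert (HC1 : consts m1) by consts_by HS1 HC.
    assert (HQ1 : stored Q k m1) by stored_by HS1 HQ.
    assert (H61 : fst m1 6%nat = i) by (rewrite (proj1 HS1) by (simpl; lia); exact H6).
    eapply wpd_seq.
    { apply (wpd_DIST Q (k - e) i); auto; [|lia]. intros j Hj. apply HQ1; lia. }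
    intros m2 [HS2 H4]. set (x := sqdist d (P i) (Q (k - e)%nat)) in *.
    assert (HS2' : same [7; 8]%nat [4; 5; 6]%nat 20 hb m m2) by widen HS1 HS2.
    assert (Hdp2 : dp xs m2).
    { intros t Ht. rewrite (proj2 HS2) by (simpl; lia). now apply Hdp1. }
    apply wpd_cons; [reflexivity|]. set (m3 := exec_mem _ _ m2 0).
    assert (HS3 : same [7; 8]%nat [4; 5; 6]%nat 20 hb m m3).
    { unfold m3. exec. apply (same_updR _ _ _ _ _ m2); [exact HS2'|right; lia]. }
    assert (HC3 : consts m3) by consts_by HS3 HC.
    replace (map (fun c => sqdist d (P i) (Q (S c))) (seq (k - S e) (S e)))
      with (x :: xs).
    2:{ cbn [seq map]. replace (S (k - S e)) with (k - e)%nat by lia. reflexivity. }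
    eapply wpd_weaken; [apply (wpd_LOWER x xs e)|apply le_n|].
    + lia.
    + apply HC3.
    + unfold m3. exec. upd. exact H4.
    + intros t Ht. unfold m3. exec. upd. apply Hdp2; lia.
    + intros t Ht. replace t with (S (length xs)) by lia. rewrite lsmall_full, Hlen.
      unfold m3. exec. upd. rewrite H4, (Hdp2 e) by lia. ring.
    + intros m4 [HS4 Hdp4]. split; [|exact Hdp4].
      apply (same_trans _ _ _ _ _ _ _ _ _ _ _ HS3 HS4); [incl_tac|incl_tac|lia].
Qed.

(** [l] is known only at run time, so the whole table is computed and its entry [l] is read through
    an address. *)
Definition EVAL : cmd :=
  (RAdd 10 1 1 ;;
   For 6 0 (RAdd 20 1 1 ;; NEAREST k ;; NConst 8 20 ;; NAdd 8 8 2 ;; RLoad 5 8 ;;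
            RAdd 10 10 5))%cmd.

Definition total_cost (C : nat -> nat -> R) : R :=
  sumR n (fun i => lnear_cost d k l C (P i)).

Lemma wpd_EVAL Q m :
  consts m -> stored Q k m ->
  wpd Inp good EVAL (18 * n * (k * k + 1) * d) m (fun m' =>
    same [6; 7; 8]%nat [4; 5; 6; 10]%nat 20 hb m m' /\
    snd m' 10%nat = total_cost (fun c => Q (S c))).
Proof.
  intros HC HQ.
  set (Inv := fun i (m' : mem) => same [6; 7; 8]%nat [4; 5; 6; 10]%nat 20 hb m m' /\
    fst m' 6%nat = i /\
    snd m' 10%nat = sumR i (fun i => lnear_cost d k l (fun c => Q (S c)) (P i))).
  apply (wpd_weaken _ _ _ (S (n * (S (k * (18 * k * d) + 4) + 3) + 3)) _ _ (Inv n));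
    [|nia|].
  2:{ intros m' (H1 & _ & H2). now split. }
  unfold EVAL. apply wpd_cons; [reflexivity|]. apply wpd_for.
  - intros i m' _ (HS & Hi & _). split; [exact Hi|].
    rewrite (proj1 HS) by (simpl; lia). apply HC.
  - intros i m' Hi (HS & H6 & H10). apply wpd_cons; [reflexivity|].
    set (m1 := exec_mem _ _ m' 0).
    assert (HS1 : same [6; 7; 8]%nat [4; 5; 6; 10]%nat 20 hb m m1).
    { unfold m1. exec. apply (same_updR _ _ _ _ _ m'); [exact HS|right; lia]. }
    assert (HC1 : consts m1) by consts_by HS1 HC.
    assert (HQ1 : stored Q k m1) by stored_by HS1 HQ.
    assert (H101 : snd m1 10%nat = snd m' 10%nat) by (unfold m1; exec; now upd).
    eapply wpd_seq; [apply (wpd_NEAREST Q i m1 k); auto|].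
    { unfold m1. exec. upd. assert (HC' : consts m') by consts_by HS HC.
      destruct HC' as (_ & _ & -> & _). ring. }
    rewrite Nat.sub_diag. intros m2 [HS2' Hdp].
    set (xs := map (fun c => sqdist d (P i) (Q (S c))) (seq 0 k)) in *.
    assert (HS2 : same [6; 7; 8]%nat [4; 5; 6; 10]%nat 20 hb m m2) by widen HS1 HS2'.
    assert (HC2 : consts m2) by consts_by HS2 HC.
    destruct HC2 as ((_ & _ & C2 & C3 & _) & _).
    do 3 (apply wpd_cons; [reflexivity|]). apply wpd_prim; [reflexivity|].
    exec. upd. split; [|split; [exact C3|split; [|split; [reflexivity|]]]].
    + rewrite (proj1 HS2') by (simpl; lia). exact H6.
    + frame. destruct m2; exact HS2.
    + exec. upd. rewrite C2, (Hdp l), (proj2 HS2'), H101, H10; [reflexivity|simpl; lia|lia|].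
      unfold xs. rewrite length_map, length_seq. exact Hlk.
  - split; [|split; [reflexivity|]].
    + exec. frame. destruct m; apply same_refl.
    + exec. upd. destruct HC as (_ & _ & -> & _). simpl. ring.
Qed.

(** * Keeping the best solution *)

Definition COPY : cmd :=
  (For 12 5 (NAdd 8 21 12 ;; RLoad 0 8 ;; NAdd 8 (20 + (k + 1)) 12 ;; RStore 8 0))%cmd.

Lemma wpd_COPY m :
  consts m ->
  wpd Inp good COPY (10 * k * d + 3) m (fun m' =>
    consts m' /\ snd m' 11%nat = snd m 11%nat /\
    forall x, (x < k * d)%nat ->
      snd m' (hb + (k + 1) * d + x)%nat = snd m (hb + d + x)%nat).
Proof.
  intros HC. set (a := (hb + (k + 1) * d)%nat).
  set (Inv := fun j (m' : mem) => same [8; 12]%nat [0]%nat a (a + k * d) m m' /\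
    fst m' 12%nat = j /\
    forall x, (x < j)%nat -> snd m' (a + x)%nat = snd m (hb + d + x)%nat).
  apply (wpd_weaken _ _ _ (k * d * (4 + 3) + 3) _ _ (Inv (k * d)%nat)); [|nia|].
  2:{ intros m' (HS & _ & H2). split; [|split; [|exact H2]].
      - consts_by HS HC.
      - apply HS; simpl; lia. }
  apply wpd_for.
  - intros j m' _ (HS & Hj & _). split; [exact Hj|].
    rewrite (proj1 HS) by (simpl; lia). apply HC.
  - intros j m' Hj (HS & H12 & Hcp).
    assert (HC' : consts m') by consts_by HS HC.
    destruct HC' as ((_ & _ & _ & C3 & _) & Cb & _).
    pose proof (Cb (k + 1)%nat ltac:(lia)) as Ca. fold a in Ca.
    specialize (Cb 1%nat ltac:(lia)). rewrite Nat.mul_1_l in Cb.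
    change (20 + 1)%nat with 21%nat in Cb.
    do 3 (apply wpd_cons; [reflexivity|]). apply wpd_prim; [reflexivity|]. exec. upd.
    split; [exact H12|split; [exact C3|split; [|split; [reflexivity|]]]].
    + rewrite Ca, Cb, H12. repeat first [apply (same_updN _ _ _ _ _ (_, _)); [|inl]
        |apply (same_updR _ _ _ _ _ (_, _)); [|simpl; lia]]. destruct m'; exact HS.
    + intros x Hx. exec. rewrite Ca, Cb, H12. destruct (Nat.eq_dec x j) as [->|Hne]; upd.
      * apply HS; simpl; lia.
      * apply Hcp; lia.
  - split; [|split; [reflexivity|intros; lia]].
    apply same_updN; [apply same_refl|inl].
Qed.

Definition unflatten (B : nat -> R) : nat -> nat -> R := fun c j => B (c * d + j)%nat.

Lemma lnear_cost_ext C C' p :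
  (forall c j, (c < k)%nat -> (j < d)%nat -> C c j = C' c j) ->
  lnear_cost d k l C p = lnear_cost d k l C' p.
Proof.
  intros H. unfold lnear_cost. f_equal. apply map_ext_in. intros c Hc.
  apply in_seq in Hc. apply sumR_ext; intros j Hj. rewrite H by lia. reflexivity.
Qed.

Lemma best_after_COPY Q m m' :
  stored Q k m ->
  (forall x, (x < k * d)%nat -> snd m' (hb + (k + 1) * d + x)%nat = snd m (hb + d + x)%nat) ->
  exists B, best B (snd m' 11%nat) m' /\
    total_cost (unflatten B) = total_cost (fun c => Q (S c)).
Proof.
  intros HQ Hcp. exists (fun x => snd m' (hb + (k + 1) * d + x)%nat).
  split; [split; reflexivity|]. apply sumR_ext; intros i _. apply lnear_cost_ext.
  intros c j Hc Hj. unfold unflatten. rewrite Hcp by nia.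
  rewrite <- (HQ (S c) j) by lia. f_equal. lia.
Qed.

Definition ROUND : cmd :=
  (TRIAL 0 k ;; EVAL ;; IfR 10 11 (RAdd 11 10 1 ;; COPY) Skip)%cmd.

Definition round_time : nat := (k * (62 * (mm + 1) * n * k * d) + 40 * n * (k * k + 1) * d)%nat.

Lemma stored_any m : exists Q, forall t, stored Q t m.
Proof. exists (fun c j => snd m (hb + c * d + j)%nat). intros t c j _ _. reflexivity. Qed.

(** What a round finds in the blocks of the centres is not tracked; therefore [v] has to bound
    [trial] from every [Q]. *)
Lemma wp_ROUND B m (Phi : assertion) V v :
  consts m -> best B (total_cost (unflatten B)) m ->
  (forall Q, v <= trial n d P M (/ INR mm) mm Q 0 k V) ->
  (forall Q' B' m', consts m' -> best B' (total_cost (unflatten B')) m' ->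
     total_cost (unflatten B') <= total_cost (unflatten B) ->
     total_cost (unflatten B') <= total_cost (fun c => Q' (S c)) -> Phi m' (V Q')) ->
  wp Inp good ROUND round_time m Phi v.
Proof.
  intros HC HB Hv HPhi. destruct (stored_any m) as [Q HQ].
  eapply wp_le; [|apply (Hv Q)].
  apply (wp_weaken _ _ _ (k * (62 * (mm + 1) * n * k * d) +
    (18 * n * (k * k + 1) * d + (2 + (S (10 * k * d + 3) + 0)))) _ _ Phi _ _); [| |auto].
  2:{ unfold round_time.
      assert (k * d <= n * (k * k + 1) * d)%nat.
      { apply Nat.mul_le_mono_r. nia. }
      assert (0 < n * (k * k + 1) * d)%nat by (repeat apply Nat.mul_pos_pos; lia). lia. }
  unfold ROUND. eapply wp_seq.
  - apply (wp_TRIAL B (total_cost (unflatten B)) (fun m' v' => exists Q', consts m' /\ stored Q' k m' /\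
      best B (total_cost (unflatten B)) m' /\ v' = V Q') V k) with (Q := Q); auto.
    intros Q' m' H1 H2 H3. now exists Q'.
  - intros m1 v1 (Q' & HC1 & HQ1 & HB1 & ->).
    eapply wp_seq_wpd; [now apply (wpd_EVAL Q')|]. intros m2 [HS2 H10].
    assert (HC2 : consts m2) by consts_by HS2 HC1.
    assert (HQ2 : stored Q' k m2) by stored_by HS2 HQ1.
    assert (HB2 : best B (total_cost (unflatten B)) m2).
    { apply (same_best _ _ _ _ _ _ _ _ HS2 HB1); [intros ? Hx; simpl in Hx; lia|lia]. }
    apply wp_ifR; rewrite (proj2 HB2), H10; intros Hcmp.
    + apply wp_cons; [reflexivity|]. set (m3 := exec_mem _ _ m2 0).
      assert (HS3 : same [] [11]%nat 0 0 m2 m3).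
      { unfold m3. exec. frame. destruct m2; apply same_refl. }
      assert (HC3 : consts m3) by consts_by HS3 HC2.
      assert (HQ3 : stored Q' k m3) by stored_by HS3 HQ2.
      assert (H11 : snd m3 11%nat = total_cost (fun c => Q' (S c))).
      { unfold m3. exec. upd. destruct HC2 as (_ & _ & -> & _). rewrite H10. ring. }
      eapply wp_of_wpd; [now apply wpd_COPY|]. intros m4 (HC4 & H4 & Hcp).
      destruct (best_after_COPY Q' m3 m4 HQ3 Hcp) as (B' & HB' & Hcost).
      rewrite H4, H11 in HB'. apply (HPhi Q' B'); [assumption|now rewrite Hcost|lra|lra].
    + apply wp_skip. apply (HPhi Q' B); auto; lra.
Qed.

(** [beta] occurs in the analysis only. The kept cost never increases, so a win is permanent, and
    [N] rounds all fail with probability at most [(1 - q) ^ N]. *)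
Lemma wp_ROUNDS beta q :
  let won B := indicator (total_cost (unflatten B) <= beta) in
  0 <= q <= 1 ->
  (forall Q, q <= trial n d P M (/ INR mm) mm Q 0 k (fun Q' =>
     indicator (total_cost (fun c => Q' (S c)) <= beta))) ->
  forall N B m, consts m -> best B (total_cost (unflatten B)) m ->
  wp Inp good (REPEAT N ROUND) (N * round_time) m (fun m' v' => exists B',
    consts m' /\ best B' (total_cost (unflatten B')) m' /\ v' = won B')
    (won B + (1 - won B) * (1 - (1 - q) ^ N)).
Proof.
  intros won Hq Hsucc.
  assert (Hwon : forall B, 0 <= won B <= 1) by (intros; apply indicator_range).
  assert (Hmono : forall x y, x <= y -> indicator (y <= beta) <= indicator (x <= beta)).
  { intros x y Hxy. unfold indicator. do 2 destruct excluded_middle_informative; lra. }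
  induction N as [|N IH]; intros B m HC HB; cbn [REPEAT].
  - apply wp_skip. exists B. split; [assumption|split; [assumption|]]. simpl; ring.
  - change (S N * round_time)%nat with (round_time + N * round_time)%nat.
    set (a := 1 - (1 - q) ^ N) in *.
    assert (Ha : 0 <= a <= 1).
    { assert (Hq1 : 0 <= 1 - q <= 1) by (split; lra).
      assert (0 <= (1 - q) ^ N) by (now apply pow_le).
      pose proof (pow_incr (1 - q) 1 N Hq1) as Hp. rewrite pow1 in Hp.
      unfold a; lra. }
    set (hit := fun Q' : nat -> nat -> R =>
      indicator (total_cost (fun c => Q' (S c)) <= beta)) in *.
    pose proof (Hwon B) as Hg. set (g := won B) in *.
    assert (Hc : 0 <= (1 - g) * (1 - a)) by (apply Rmult_le_pos; lra).
    eapply wp_seq.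
    (* The value after the round is 1 if the target was met before or is met now, and [a] otherwise;
       written affinely in [hit], it fits [trial_affine_le]. *)
    + apply (wp_ROUND B m (fun m' v' => exists B', consts m' /\
        best B' (total_cost (unflatten B')) m' /\ v' <= won B' + (1 - won B') * a)
        (fun Q' => (g + (1 - g) * a) + ((1 - g) * (1 - a)) * hit Q')); auto.
      * intros Q.
        eapply Rle_trans; [|apply (trial_affine_le n d P Hn M _ mm _ hit
          (g + (1 - g) * a) ((1 - g) * (1 - a)) k HM); intros; apply Rle_refl].
        pose proof (Rmult_le_compat_l _ _ _ Hc (Hsucc Q)) as Hhit.
        replace (g + (1 - g) * (1 - (1 - q) ^ S N))
          with (g + (1 - g) * a + (1 - g) * (1 - a) * q) by (unfold a; simpl; ring).
        lra.
      * intros Q' B' m' HC' HB' Hle Hle'. exists B'.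
        split; [assumption|split; [assumption|]].
        apply Hmono in Hle, Hle'. fold (won B') (won B) g in Hle. fold (won B') in Hle'.
        change (hit Q' <= won B') in Hle'.
        assert (H01 : won B' = 0 \/ won B' = 1).
        { unfold won, indicator. destruct excluded_middle_informative; auto. }
        assert (Hh : 0 <= hit Q') by apply indicator_range.
        destruct H01 as [H0|H1].
        -- rewrite H0 in *. replace g with 0 by lra. replace (hit Q') with 0 by lra. lra.
        -- rewrite H1 in *. assert ((1 - g) * (1 - a) * hit Q' <= (1 - g) * (1 - a)); [|nra].
           rewrite <- (Rmult_1_r ((1 - g) * (1 - a))) at 2.
           apply Rmult_le_compat_l; lra.
    + intros m' v' (B' & HC' & HB' & Hv'). eapply wp_le; [|exact Hv']. now apply IH.
Qed.

(* The addresses are used in decreasing order: register 0 serves as a temporary until the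
   last value is written to it. *)
Definition OUTPUT : cmd :=
  (For 12 5 (NAdd 13 12 3 ;; NSub 13 5 13 ;; NAdd 8 (20 + (k + 1)) 13 ;; RLoad 0 8 ;;
             RStore 13 0))%cmd.

(** The output may overwrite the real constants, so the invariant frames integer registers only. The
    block of the best solution starts beyond [k * d] and survives. *)
Lemma wpd_OUTPUT B bc m :
  consts m -> best B bc m ->
  wpd Inp good OUTPUT (10 * k * d + 3) m (fun m' =>
    forall x, (x < k * d)%nat -> snd m' x = B x).
Proof.
  intros HC HB.
  pose proof HC as ((_ & _ & _ & C3 & _ & C5 & _) & Cb & _).
  specialize (Cb (k + 1)%nat ltac:(lia)). destruct HB as [HB _].
  set (a := (hb + (k + 1) * d)%nat) in *.
  set (Inv := fun j (m' : mem) =>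
    (forall x, ~ In x [8; 12; 13]%nat -> fst m' x = fst m x) /\ fst m' 12%nat = j /\
    (forall x, (x < k * d)%nat -> snd m' (a + x)%nat = B x) /\
    (forall x, (k * d - j <= x < k * d)%nat -> snd m' x = B x)).
  apply (wpd_weaken _ _ _ (k * d * (5 + 3) + 3) _ _ (Inv (k * d)%nat)); [|nia|].
  2:{ intros m' (_ & _ & _ & H) x Hx. apply H; lia. }
  apply wpd_for.
  - intros j m' _ (HS & Hj & _). split; [exact Hj|].
    rewrite HS by (simpl; lia). exact C5.
  - intros j m' Hj (HS & H12 & HB' & Hout).
    assert (E3 : fst m' 3%nat = 1%nat) by (rewrite HS by (simpl; lia); exact C3).
    assert (E5 : fst m' 5%nat = (k * d)%nat) by (rewrite HS by (simpl; lia); exact C5).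
    assert (Ea : fst m' (20 + (k + 1))%nat = a) by (rewrite HS by (simpl; lia); exact Cb).
    do 4 (apply wpd_cons; [reflexivity|]). apply wpd_prim; [reflexivity|].
    exec. upd. rewrite E3, E5, Ea, H12.
    split; [reflexivity|split; [reflexivity|split; [|split; [reflexivity|split]]]].
    + intros x Hx. exec. simpl in Hx. upd. apply HS. simpl; lia.
    + intros x Hx. exec. assert (k * d < a)%nat by (unfold a; nia).
      upd. now apply HB'.
    + intros x Hx. exec. destruct (Nat.eq_dec x (k * d - (j + 1))) as [->|Hne]; upd.
      * apply HB'; lia.
      * apply Hout; lia.
  - split; [|split; [reflexivity|split]].
    + intros x Hx. simpl in Hx. exec. now upd.
    + exact HB.
    + intros x Hx; lia.
Qed.

(** * Initialisation and the complete program *)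

Lemma wpd_REPEAT c t (Inv : nat -> mem -> Prop) :
  (forall i m, Inv i m -> wpd Inp good c t m (Inv (S i))) ->
  forall j i m, Inv i m -> wpd Inp good (REPEAT j c) (j * t) m (Inv (i + j)%nat).
Proof.
  intros Hstep. induction j as [|j IH]; intros i m HI; cbn [REPEAT].
  - apply wpd_skip. now rewrite Nat.add_0_r.
  - change (S j * t)%nat with (t + j * t)%nat. eapply wpd_seq; [exact (Hstep i m HI)|].
    intros m' HI'. rewrite <- plus_n_Sm. now apply (IH (S i)).
Qed.

Fixpoint BASES (e : nat) : cmd :=
  match e with
  | O => Skip
  | S e' => BASES e' ;; NAdd (20 + e) (20 + e') 1
  end%cmd.

(** Integers cannot be multiplied by the machine: [M = c * n] and [k * d] are computed by repeated
    addition, with [c] and [k] fixed in the program. *)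
Definition INIT (c : nat) : cmd :=
  (NConst 3 1 ;; REPEAT c (NAdd 4 4 0) ;; REPEAT k (NAdd 5 5 1) ;; NConst 20 hb ;;
   BASES (k + 1) ;; NConst 13 mm ;; RofN 3 13 ;; RofN 5 3 ;; RDiv 3 5 3)%cmd.

Definition start : mem := (nreg (init_state Inp), rreg (init_state Inp)).

Lemma wpd_BASES m e :
  fst m 20%nat = hb -> fst m 1%nat = d ->
  wpd Inp good (BASES e) e m (fun m' =>
    (forall x, (x < 20)%nat -> fst m' x = fst m x) /\ snd m' = snd m /\
    forall c, (c <= e)%nat -> fst m' (20 + c)%nat = (hb + c * d)%nat).
Proof.
  intros H20 H1. induction e as [|e IH]; cbn [BASES].
  - apply wpd_skip. split; [auto|split; [reflexivity|]]. intros c Hc.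
    replace c with 0%nat by lia. simpl. lia.
  - apply (wpd_le _ _ _ (e + 1)); [|lia]. eapply wpd_seq; [exact IH|].
    intros m' (H & Hr & Hb). apply wpd_prim; [reflexivity|]. exec.
    split; [|split; [exact Hr|]].
    + intros x Hx. upd. now apply H.
    + intros c Hc. destruct (Nat.eq_dec c (S e)) as [->|Hne]; upd.
      * rewrite Hb, H, H1 by lia. lia.
      * apply Hb; lia.
Qed.

Lemma wpd_INIT c : M = (c * n)%nat ->
  wpd Inp good (INIT c) (c + 2 * k + 7) start consts.
Proof.
  intros Hc.
  apply (wpd_le _ _ _ (S (c * 1 + (k * 1 + (S ((k + 1) + 4)))))); [|lia].
  unfold INIT. apply wpd_cons; [reflexivity|].
  set (Inv := fun a b (m : mem) => snd m 1%nat = 0 /\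
    (fst m 0 = n /\ fst m 1 = d /\ fst m 2 = l /\ fst m 3 = 1 /\
     fst m 4 = a * n /\ fst m 5 = b * d /\ fst m 15 = 0)%nat).
  eapply wpd_seq.
  { apply (wpd_REPEAT _ 1 (fun i => Inv i 0%nat)) with (i := 0%nat).
    - intros i m (H1 & H). apply wpd_prim; [reflexivity|]. unfold Inv. exec. upd.
      split; [exact H1|]. repeat split; try apply H. replace (fst m 0%nat) with n by lia. lia.
    - unfold Inv, start, init_state. exec. upd. now repeat split. }
  intros m1 HI1. eapply wpd_seq.
  { apply (wpd_REPEAT _ 1 (fun i => Inv c i)) with (i := 0%nat); [|exact HI1].
    intros i m (H1 & H). apply wpd_prim; [reflexivity|]. unfold Inv. exec. upd.
    split; [exact H1|]. repeat split; try apply H. replace (fst m 1%nat) with d by lia. lia. }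
  intros m2 (R1 & H0 & H1 & H2 & H3 & H4 & H5 & H15). rewrite Nat.add_0_l in H5.
  apply wpd_cons; [reflexivity|]. eapply wpd_seq.
  { apply wpd_BASES; exec; upd; [reflexivity|exact H1]. }
  intros m3 (Hlow & Hr & Hb). do 3 (apply wpd_cons; [reflexivity|]).
  apply wpd_prim; [reflexivity|].
  assert (Hfst : forall x, (x < 20)%nat -> fst m3 x = fst m2 x).
  { intros x Hx. rewrite Hlow by assumption. exec. now upd. }
  unfold consts. exec. upd. rewrite !Hfst, Hr by lia. exec.
  split; [subst M; repeat split; assumption|split; [|split; [exact R1|]]].
  - intros e He. upd. now apply Hb.
  - rewrite H3. simpl. unfold Rdiv. ring.
Qed.

(** The initial memory contents serve as the first candidate, so the rounds always start from a
    solution together with its true cost. *)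
Definition MAIN (c N : nat) : cmd :=
  (INIT c ;; EVAL ;; RAdd 11 10 1 ;; COPY ;; REPEAT N ROUND ;; OUTPUT)%cmd.

Definition main_time (c N : nat) : nat :=
  (c + 2 * k + 7 + (18 * n * (k * k + 1) * d + (S (10 * k * d + 3 +
    (N * round_time + (10 * k * d + 3))))))%nat.

Lemma ok_MAIN c N beta q :
  (forall regs, good regs <-> total_cost (output_centers d regs) <= beta) ->
  M = (c * n)%nat -> 0 <= q <= 1 ->
  (forall Q, q <= trial n d P M (/ INR mm) mm Q 0 k (fun Q' =>
     indicator (total_cost (fun c => Q' (S c)) <= beta))) ->
  ok (compile 0 (MAIN c N)) Inp good (main_time c N) (init_state Inp) (1 - (1 - q) ^ N).
Proof.
  intros Hgood Hc Hq Hsucc.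
  assert (Hwp : wp Inp good (MAIN c N) (main_time c N) start (fun m' v' =>
      v' <= indicator (good (snd m'))) (1 - (1 - q) ^ N)).
  { unfold MAIN, main_time. eapply wp_seq_wpd; [now apply wpd_INIT|]. intros m1 HC1.
    destruct (stored_any m1) as [Q HQ1].
    eapply wp_seq_wpd; [now apply (wpd_EVAL Q)|]. intros m2 [HS2 H10].
    assert (HC2 : consts m2) by consts_by HS2 HC1.
    assert (HQ2 : stored Q k m2).
    { apply (same_stored _ _ _ _ _ _ _ _ HS2 (HQ1 k)); [intros ? Hx; simpl in Hx; lia|lia]. }
    apply wp_cons; [reflexivity|]. set (m3 := exec_mem _ _ m2 0).
    assert (HS3 : same [] [11]%nat 0 0 m2 m3).
    { unfold m3. exec. frame. destruct m2; apply same_refl. }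
    assert (HC3 : consts m3) by consts_by HS3 HC2.
    assert (HQ3 : stored Q k m3) by stored_by HS3 HQ2.
    assert (H11 : snd m3 11%nat = total_cost (fun c => Q (S c))).
    { unfold m3. exec. upd. destruct HC2 as (_ & _ & -> & _). rewrite H10. ring. }
    eapply wp_seq_wpd; [now apply wpd_COPY|]. intros m4 (HC4 & H4 & Hcp).
    destruct (best_after_COPY Q m3 m4 HQ3 Hcp) as (B & HB & Hcost).
    rewrite H4, H11, <- Hcost in HB.
    eapply wp_le with (v := _ + (1 - _) * (1 - (1 - q) ^ N)).
    - eapply wp_seq; [now apply (wp_ROUNDS beta q Hq Hsucc N B)|].
      intros m5 v5 (B' & HC5 & HB5 & ->).
      eapply wp_of_wpd; [now apply (wpd_OUTPUT B' _ m5 HC5 HB5)|].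
      intros m6 Hout. apply Req_le. unfold indicator.
      assert (Hiff : good (snd m6) <-> total_cost (unflatten B') <= beta).
      { rewrite Hgood. replace (total_cost (output_centers d (snd m6)))
          with (total_cost (unflatten B')); [reflexivity|].
        apply sumR_ext; intros i _. apply lnear_cost_ext. intros e j He Hj.
        unfold unflatten, output_centers. rewrite Hout; [reflexivity|nia]. }
      do 2 destruct excluded_middle_informative; tauto || reflexivity.
    - pose proof (indicator_range (total_cost (unflatten B) <= beta)).
      assert (0 <= (1 - q) ^ N) by (apply pow_le; lra). cbv zeta. nra. }
  set (p := compile 0 (MAIN c N)). rewrite <- (Nat.add_0_r (main_time c N)).
  change (init_state Inp) with (at_pc 0 start).
  apply Hwp.
  - exists [], []. now rewrite app_nil_r.
  - intros m' v' Hv. eapply ok_mono; [apply ok_stop|apply le_n|exact Hv].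
    assert (Hend : nth_error p (0 + clen (MAIN c N)) = None).
    { apply nth_error_None. unfold p. now rewrite length_compile. }
    unfold current, at_pc. cbn [pc]. now rewrite Hend.
Qed.

End Machine.

(** * Running time and success probability *)

Lemma succ_prob_mono p I (good good' : (nat -> R) -> Prop) T s :
  (forall o, good o -> good' o) -> succ_prob p I good T s <= succ_prob p I good' T s.
Proof.
  intros H. revert s; induction T as [|T IH]; intros s; simpl; destruct (current p s);
    try (do 2 destruct excluded_middle_informative; lra || (exfalso; auto)); [lra|].
  apply Rmult_le_compat_l; [apply inv_INR_nonneg|]. apply sumR_le; intros; apply IH.
Qed.

(** [(1 - q) ^ N * (1 + q) ^ N <= 1], while Bernoulli's inequality [poly] gives
    [(1 + q) ^ N >= 1 + N q = 2]. *)
Lemma amplification N q : 0 <= q <= 1 -> INR N * q = 1 -> / 2 <= 1 - (1 - q) ^ N.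
Proof.
  intros Hq HN.
  assert (Hq0 : 0 < q) by (destruct (proj1 Hq) as [|<-]; [assumption|lra]).
  pose proof (poly N q Hq0) as Hb. rewrite HN in Hb.
  assert (Hp : (1 - q) ^ N * (1 + q) ^ N <= 1).
  { rewrite <- Rpow_mult_distr. pose proof (pow_incr ((1 - q) * (1 + q)) 1 N) as Hi.
    rewrite pow1 in Hi. apply Hi. nra. }
  assert (0 <= (1 - q) ^ N) by (apply pow_le; lra). nra.
Qed.

Lemma le_pow2 x : (x <= 2 ^ x)%nat.
Proof. apply Nat.lt_le_incl, Nat.pow_gt_lin_r. lia. Qed.

(** The exact inverse of the success probability guaranteed for one trial, as [amplification]
    requires. *)
Definition repetitions (k E : nat) : nat :=
  (2 * (2 * (64 * k * E) * (k + 1)) ^ (16 * E)) ^ k.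

(** The base is at most [256 E^3 <= 2^(11 E)]. Raising to [16 E], doubling and raising to [k <= E]
    gives the exponent [E (1 + 176 E^2) <= 177 E^3]. *)
Lemma repetitions_le k E : (1 <= k <= E)%nat -> (repetitions k E <= 2 ^ (177 * E ^ 3))%nat.
Proof.
  intros HkE. unfold repetitions.
  assert (Hbase : (2 * (64 * k * E) * (k + 1) <= 2 ^ (11 * E))%nat).
  { apply Nat.le_trans with (2 ^ 8 * (2 ^ E * 2 ^ E * 2 ^ E))%nat.
    - pose proof (le_pow2 E). change (2 ^ 8)%nat with 256%nat.
      assert (k * E * (k + 1) <= 2 * (E * E * E))%nat by nia.
      assert (E * E * E <= 2 ^ E * 2 ^ E * 2 ^ E)%nat
        by (repeat apply Nat.mul_le_mono; assumption).
      nia.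
    - rewrite <- !Nat.pow_add_r. apply Nat.pow_le_mono_r; lia. }
  apply Nat.le_trans with ((2 * (2 ^ (11 * E)) ^ (16 * E)) ^ k)%nat.
  - apply Nat.pow_le_mono_l, Nat.mul_le_mono_l, Nat.pow_le_mono_l. exact Hbase.
  - rewrite <- Nat.pow_mul_r. change 2%nat with (2 ^ 1)%nat at 1.
    rewrite <- Nat.pow_add_r, <- Nat.pow_mul_r.
    apply Nat.pow_le_mono_r; [lia|]. simpl Nat.pow.
    assert (k * (1 + 11 * E * (16 * E)) <= E * (1 + 11 * E * (16 * E)))%nat
      by (apply Nat.mul_le_mono_r; lia).
    assert (E <= E * (E * (E * 1)))%nat by nia. nia.
Qed.

(** Here 1400 is 1200 for the rounds plus 200 for the rest, and the additional [3 E^3] in the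
    exponent absorbs a factor [E^3]. *)
Lemma main_time_le n d k E : (1 <= n)%nat -> (1 <= d)%nat -> (1 <= k <= E)%nat ->
  (main_time n d k (16 * E) (2 * (64 * k * E)) (repetitions k E)
   <= 1400 * 2 ^ (180 * E ^ 3) * (n * d))%nat.
Proof.
  intros Hn Hd HkE. set (N := repetitions k E).
  assert (HN : (1 <= N <= 2 ^ (177 * E ^ 3))%nat).
  { split; [|now apply repetitions_le]. unfold N, repetitions.
    apply Nat.neq_0_lt_0, Nat.pow_nonzero.
    apply Nat.neq_mul_0; split; [lia|]. apply Nat.pow_nonzero. nia. }
  set (X := (n * d)%nat). assert (HX : (1 <= X)%nat) by (unfold X; nia).
  assert (H3 : (E * E * E <= 2 ^ (3 * E ^ 3))%nat).
  { pose proof (le_pow2 (E ^ 3)) as Hp.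
    replace (E * E * E)%nat with (E ^ 3)%nat by (simpl; ring).
    eapply Nat.le_trans; [exact Hp|]. apply Nat.pow_le_mono_r; lia. }
  assert (Hr : (round_time n d k (16 * E) <= 1200 * (E * E * E) * X)%nat).
  { unfold round_time.
    replace (k * (62 * (16 * E + 1) * n * k * d) + 40 * n * (k * k + 1) * d)%nat
      with ((62 * (k * k * (16 * E + 1)) + 40 * (k * k + 1)) * X)%nat by (unfold X; ring).
    apply Nat.mul_le_mono_r.
    assert (k * k <= E * E)%nat by nia.
    assert (k * k * (16 * E + 1) <= E * E * (17 * E))%nat
      by (apply Nat.mul_le_mono; lia).
    assert (1 <= E * E)%nat by nia. assert (E * E <= E * E * E)%nat by nia. nia. }
  assert (Hrest : (2 * (64 * k * E) + 2 * k + 7 + (18 * n * (k * k + 1) * d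
     + S (10 * k * d + 3 + (10 * k * d + 3))) <= 200 * (E * E * E) * X)%nat).
  { assert (k * k <= E * E)%nat by nia. assert (k * E <= E * E)%nat by nia.
    assert (1 <= E * E)%nat by nia. assert (E * E <= E * E * E)%nat by nia.
    assert (E <= E * E)%nat by nia.
    assert (k * d <= E * E * E * X)%nat.
    { unfold X. apply Nat.mul_le_mono; nia. }
    assert (E * E * E <= E * E * E * X)%nat by nia.
    assert (n * (k * k + 1) * d <= 2 * (E * E * E * X))%nat.
    { replace (n * (k * k + 1) * d)%nat with ((k * k + 1) * X)%nat by (unfold X; ring).
      rewrite Nat.mul_assoc. apply Nat.mul_le_mono_r. lia. }
    lia. }
  unfold main_time. fold N.
  apply Nat.le_trans with (1400 * (N * (E * E * E)) * X)%nat.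
  - assert (E * E * E * X <= N * (E * E * E * X))%nat by nia.
    apply (Nat.mul_le_mono_l _ _ N) in Hr. nia.
  - apply Nat.mul_le_mono_r, Nat.mul_le_mono_l.
    replace (180 * E ^ 3)%nat with (177 * E ^ 3 + 3 * E ^ 3)%nat by ring.
    rewrite Nat.pow_add_r. apply Nat.mul_le_mono; lia.
Qed.

(** The running time has no logarithmic factor, but [ln n] is below 1 for [n = 2]; a factor
    [2 ^ (k + 1)] compensates for this. *)
Lemma ln_pow_lower n k E : (2 <= n)%nat -> (1 <= k <= E)%nat ->
  1 <= 2 ^ (2 * E ^ 3) * ln (INR n) ^ (k + 1).
Proof.
  intros Hn HkE.
  assert (Hln : / 2 <= ln (INR n)).
  { pose proof ln_lt_2. assert (ln 2 <= ln (INR n)); [|lra].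
    apply le_INR in Hn. change (INR 2) with 2 in Hn.
    destruct (Rle_lt_or_eq_dec _ _ Hn) as [Hlt|<-]; [|apply Rle_refl].
    left. apply ln_increasing; lra. }
  apply Rle_trans with (2 ^ (k + 1) * ln (INR n) ^ (k + 1)).
  - rewrite <- Rpow_mult_distr. rewrite <- (pow1 (k + 1)). apply pow_incr. split; lra.
  - apply Rmult_le_compat_r; [apply pow_le; lra|]. apply Rle_pow; [lra|].
    simpl Nat.pow. nia.
Qed.

Lemma time_bound n d k E x : (2 <= n)%nat -> (1 <= d)%nat -> (1 <= k <= E)%nat ->
  0 <= x -> INR E <= x + 1 ->
  INR (main_time n d k (16 * E) (2 * (64 * k * E)) (repetitions k E))
  <= 1400 * Rpower 2 (INR 732 * x ^ 3 + INR 732) * ln (INR n) ^ (k + 1) * INR n * INR d.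
Proof.
  intros Hn Hd HkE Hx HE.
  pose proof (main_time_le n d k E ltac:(lia) Hd HkE) as HT. apply le_INR in HT.
  rewrite !mult_INR, pow_INR in HT. replace (INR 1400) with 1400 in HT
    by (rewrite INR_IZR_INZ; reflexivity).
  change (INR 2) with 2 in HT.
  pose proof (ln_pow_lower n k E Hn HkE) as Hl. set (lnk := ln (INR n) ^ (k + 1)) in *.
  assert (Hexp : 2 ^ (182 * E ^ 3) <= Rpower 2 (INR 732 * x ^ 3 + INR 732)).
  { rewrite <- Rpower_pow by lra. apply Rle_Rpower; [lra|].
    rewrite mult_INR, pow_INR.
    replace (INR 732) with 732 by (rewrite INR_IZR_INZ; reflexivity).
    replace (INR 182) with 182 by (rewrite INR_IZR_INZ; reflexivity).
    assert (INR E ^ 3 <= (x + 1) ^ 3) by (apply pow_incr; split; [apply pos_INR|lra]).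
    (* The difference of the two sides is [3 (x - 1)^2 (x + 1)]. *)
    assert ((x + 1) ^ 3 <= 4 * x ^ 3 + 4).
    { assert (0 <= 3 * ((x - 1) ^ 2 * (x + 1)))
        by (apply Rmult_le_pos; [lra|apply Rmult_le_pos; [apply pow2_ge_0|lra]]). nra. }
    nra. }
  replace (182 * E ^ 3)%nat with (180 * E ^ 3 + 2 * E ^ 3)%nat in Hexp by ring.
  rewrite pow_add in Hexp.
  assert (Hnd : 0 <= INR n * INR d) by (apply Rmult_le_pos; apply pos_INR).
  eapply Rle_trans; [exact HT|].
  rewrite !Rmult_assoc. apply Rmult_le_compat_l; [lra|].
  rewrite <- !Rmult_assoc, (Rmult_assoc _ (INR n)), (Rmult_assoc _ (INR n)).
  apply Rmult_le_compat_r; [exact Hnd|].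
  assert (H1 : 0 < 2 ^ (180 * E ^ 3)) by (apply pow_lt; lra).
  assert (H2 : 0 < 2 ^ (2 * E ^ 3)) by (apply pow_lt; lra).
  assert (Hl0 : 0 <= lnk).
  { apply Rnot_lt_le; intros Hneg. nra. }
  apply Rle_trans with (2 ^ (180 * E ^ 3) * (2 ^ (2 * E ^ 3) * lnk)).
  - rewrite <- (Rmult_1_r (2 ^ (180 * E ^ 3))) at 1.
    apply Rmult_le_compat_l; [left; exact H1|exact Hl].
  - rewrite <- Rmult_assoc. apply Rmult_le_compat_r; assumption.
Qed.

Lemma slack_removal a b e : 0 <= e ->
  (forall j, a <= (1 + e) * (b + / INR (S j))) -> a <= (1 + e) * b.
Proof.
  intros He H. apply Rnot_lt_le; intros Hlt.
  destruct (archimed_cor1 ((a - (1 + e) * b) / (1 + e))) as (N & HN & HN0).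
  { apply Rmult_lt_0_compat; [lra|apply Rinv_0_lt_compat; lra]. }
  destruct N as [|N]; [lia|]. specialize (H N).
  apply (Rmult_lt_compat_l (1 + e)) in HN; [|lra].
  replace ((1 + e) * ((a - (1 + e) * b) / (1 + e))) with (a - (1 + e) * b) in HN
    by (field; lra). lra.
Qed.

Lemma lnear_cost_nonneg d k l C p : 0 <= lnear_cost d k l C p.
Proof.
  unfold lnear_cost.
  assert (Hpos : forall x, In x (map (fun c => sqdist d p (C c)) (seq 0 k)) -> 0 <= x).
  { intros x Hx. apply in_map_iff in Hx as (c & <- & _). apply sqdist_nonneg. }
  revert l Hpos. generalize (map (fun c => sqdist d p (C c)) (seq 0 k)).
  induction l as [|x xs IH]; intros [|l] Hpos; simpl; try lra.
  assert (0 <= x) by (apply Hpos; now left).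
  assert (IH' : forall l, 0 <= lsmall l xs) by (intros; apply IH; intros; apply Hpos; now right).
  pose proof (IH' l). destruct Nat.ltb; [lra|]. apply Rmin_glb; [lra|apply IH'].
Qed.

Definition fmeans_program (k E : nat) : program :=
  compile 0 (MAIN k (16 * E) (21 + k) (2 * (64 * k * E)) (repetitions k E)).

Theorem theorem7 :
  exists (a b : nat) (Cst c : R), 0 < Cst /\ 0 < c /\
  forall (k : nat) (eps : R), (1 <= k)%nat -> 0 < eps < 1 ->
  exists prog : program,
  forall (n d l : nat) (P : nat -> nat -> R),
    (2 <= n)%nat -> (1 <= d)%nat -> (1 <= l <= k)%nat ->
    let I := mkInput n d l P in
    exists T : nat,
      INR T <= Cst * Rpower 2 (INR a * (INR k / eps) ^ b + INR a)
                   * (ln (INR n)) ^ (k + 1) * INR n * INR d /\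
      halts_within prog I T (init_state I) /\
      c <= succ_prob prog I (good_output k eps I) T (init_state I).
Proof.
  (* The exponent is at most [182 E^3] with [E <= k / eps + 1], and [(x + 1)^3 <= 4 x^3 + 4]; 732
     exceeds [4 * 182]. *)
  exists 732%nat, 3%nat, 1400, (/ 2). split; [lra|split; [lra|]].
  intros k eps Hk Heps. set (x := INR k / eps).
  assert (Hkr : 1 <= INR k) by (apply (le_INR 1); lia).
  assert (Hx : INR k <= x).
  { unfold x. apply (Rmult_le_reg_r eps); [lra|].
    replace (INR k / eps * eps) with (INR k) by (field; lra). nra. }
  (* [up x] lies in [(x, x + 1]], so [k / E <= eps] and [E <= k / eps + 1]. *)
  set (E := Z.to_nat (up x)). destruct (archimed x) as [Hup1 Hup2].
  assert (HE : INR E = IZR (up x)).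
  { unfold E. rewrite INR_IZR_INZ, Z2Nat.id; [reflexivity|]. apply le_IZR. lra. }
  assert (HkE : (1 <= k <= E)%nat) by (split; [assumption|apply INR_le; lra]).
  assert (HkEe : INR k <= eps * INR E).
  { apply Rle_trans with (eps * x); [|apply Rmult_le_compat_l; lra].
    unfold x. right. field. lra. }
  exists (fmeans_program k E). intros n d l P Hn Hd Hl I.
  set (T := main_time n d k (16 * E) (2 * (64 * k * E)) (repetitions k E)).
  exists T. split; [apply time_bound; auto; lra|].
  set (G := (64 * k * E)%nat). set (M := (2 * G * n)%nat). set (m := (16 * E)%nat).
  set (q := ((/ INR (2 * G * (k + 1))) ^ m * / 2) ^ k).
  assert (Hbase : (0 < 2 * G * (k + 1))%nat) by (unfold G; nia).
  assert (HNq : INR (repetitions k E) * q = 1).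
  { unfold repetitions, q. fold G m. rewrite pow_INR, <- Rpow_mult_distr.
    rewrite mult_INR, pow_INR, <- (pow1 k). f_equal. change (INR 2) with 2.
    rewrite pow_inv. field. apply pow_nonzero, not_0_INR. lia. }
  assert (Hq : 0 <= q <= 1).
  { assert (0 <= q).
    { apply pow_le, Rmult_le_pos; [apply pow_le, inv_INR_nonneg|lra]. }
    split; [assumption|].
    assert (1 <= INR (repetitions k E)); [|nra].
    apply (le_INR 1). destruct (repetitions k E); [simpl in HNq; lra|lia]. }
  set (cost := total_cost n d l k P).
  (* The slack [1 / (j + 1)] makes the target positive even if [C] has cost zero. *)
  set (good := fun (y : (nat -> nat -> R) * nat) (o : nat -> R) =>
    cost (output_centers d o) <= (1 + eps) * (cost (fst y) + / INR (S (snd y)))).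
  assert (Hok : forall y, ok (fmeans_program k E) I (good y) T (init_state I) (/ 2)).
  { intros [C j].
    assert (Hj : 0 < / INR (S j)) by (apply Rinv_0_lt_compat, lt_0_INR; lia).
    apply (ok_mono _ _ _ T T _ (1 - (1 - q) ^ repetitions k E)); [|lia|].
    - apply (ok_MAIN n d l k M m (21 + k) P (good (C, j))) with
        (beta := (1 + eps) * (cost C + / INR (S j))); try lia.
      + reflexivity.
      + exact Hq.
      + intros Q. apply (trial_approx n d P ltac:(lia) k l E G M m C); auto; try lia.
        * assert (0 <= cost C); [|lra]. apply sumR_nonneg; intros i _.
          apply lnear_cost_nonneg.
        * unfold cost, total_cost in *. lra.
    - now apply amplification. }
  split; [exact (proj1 (Hok (P, 0%nat)))|].
  (* All pairs [(C, j)] at once, ordered by their thresholds; letting [j] grow then removes the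
     slack. *)
  destruct (succ_prob_chain _ (P, 0%nat) good
    (fun y => (1 + eps) * (cost (fst y) + / INR (S (snd y))))
    ltac:(unfold good; intros; lra) (fmeans_program k E) I T (init_state I)) as [y Hy].
  eapply Rle_trans; [exact (proj2 (Hok y))|]. eapply Rle_trans; [exact Hy|].
  apply succ_prob_mono. intros o Ho C. unfold fmeans_cost.
  rewrite (Rmult_comm (1 + eps)), Rmult_assoc. apply Rmult_le_compat_l; [apply inv_INR_nonneg|].
  rewrite (Rmult_comm _ (1 + eps)). apply slack_removal; [lra|].
  intros j. exact (Ho (C, j)).
Qed.
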